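(* Let $(D,v^* )$ be a neighbor-acyclic instance of TFP. Then the problem can be solved in time $2^{\mathcal{O}(k\log k)}\cdot n^{\mathcal{O}(1)}$, where $n=|V(D)|$ and $k$ is the sfas-v number of $(D,v^* )$.
   Context: A tournament is a digraph with exactly one arc between every pair of distinct vertices; $(u,v)$ means $u$ beats $v$. TFP: given a tournament $D$ with $|V(D)|$ a power of two and a player $v^*$, decide whether there is a seeding of a balanced knockout tournament (complete binary tree with $|V(D)|$ leaves, in each round sibling winners play and the winner according to $D$ advances) under which $v^*$ is the champion. An instance $(D,v^* )$ is neighbor-acyclic if the induced subdigraphs $D[N_{\mathrm{in}}(v^* )]$ and $D[N_{\mathrm{out}}(v^* )]$ are both acyclic. The sfas-v number of $(D,v^* )$ is the minimum number of arcs of $D$ whose reversal yields a digraph with no directed cycle containing $v^*$. *)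

(* Defs.v *)
From mathcomp Require Import all_boot.
Set Implicit Arguments. Unset Strict Implicit. Unset Printing Implicit Defensive.

(* Players are 'I_(2^p); D u v means "u beats v".                       *)

Definition is_tournament (V : finType) (D : rel V) : Prop :=
  (forall u, ~~ D u u) /\
  (forall u v, u != v -> (D u v (+) D v u)).

Fixpoint ko_round (V : finType) (D : rel V) (s : seq V) : seq V :=
  match s with
  | u :: v :: t => (if D u v then u else v) :: ko_round D t
  | _ => s
  end.

(* v is champion of the balanced knockout tournament with seeding s
   (s lists the 2^p leaves from left to right) *)
Definition champion (p : nat) (D : rel 'I_(2 ^ p)) (s : seq 'I_(2 ^ p))
    (v : 'I_(2 ^ p)) : bool :=
  head v (iter p (ko_round D) s) == v.

Definition TFP_yes (p : nat) (D : rel 'I_(2 ^ p)) (v : 'I_(2 ^ p)) : Prop :=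
  exists s : seq 'I_(2 ^ p), perm_eq s (enum 'I_(2 ^ p)) /\ champion D s v.

(* directed cycles: closed walks of positive length *)
Definition acyclic_on (V : finType) (D : rel V) (A : pred V) : Prop :=
  forall c : seq V, c != [::] -> all A c -> ~~ cycle D c.

Definition in_nbh (V : finType) (D : rel V) (v : V) : pred V := fun u => D u v.
Definition out_nbh (V : finType) (D : rel V) (v : V) : pred V := fun u => D v u.

Definition neighbor_acyclic (V : finType) (D : rel V) (v : V) : Prop :=
  acyclic_on D (in_nbh D v) /\ acyclic_on D (out_nbh D v).

Definition reverse_arcs (V : finType) (D : rel V) (F : {set V * V}) : rel V :=
  fun u w => (D u w && ((u, w) \notin F)) || (D w u && ((w, u) \in F)).

Definition no_cycle_through (V : finType) (D : rel V) (v : V) : Prop :=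
  forall c : seq V, v \in c -> ~~ cycle D c.

Definition sfasv_feasible (V : finType) (D : rel V) (v : V) (F : {set V * V}) : Prop :=
  (forall e, e \in F -> D e.1 e.2) /\ no_cycle_through (reverse_arcs D F) v.

Definition is_sfasv_number (V : finType) (D : rel V) (v : V) (k : nat) : Prop :=
  (exists F, sfasv_feasible D v F /\ #|F| = k) /\
  (forall F, sfasv_feasible D v F -> k <= #|F|).

Inductive sym := Blank | Zero | One.
Inductive move := MoveL | Stay | MoveR.

Record TM := {
  tm_state : finType;
  tm_start : tm_state;
  tm_acc : tm_state;
  tm_rej : tm_state;
  tm_acc_neq_rej : tm_acc != tm_rej;
  tm_delta : tm_state -> sym -> tm_state * sym * move }.

Record config (Q : Type) := Config {
  cstate : Q; cleft : seq sym; chead : sym; cright : seq sym }.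

Definition tm_step (M : TM) (c : config (tm_state M)) : config (tm_state M) :=
  if (cstate c == @tm_acc M) || (cstate c == @tm_rej M) then c else
  let: (q', w, m) := @tm_delta M (cstate c) (chead c) in
  match m with
  | MoveL => match cleft c with
             | [::] => Config q' [::] Blank (w :: cright c)
             | a :: l => Config q' l a (w :: cright c)
             end
  | Stay => Config q' (cleft c) w (cright c)
  | MoveR => match cright c with
             | [::] => Config q' (w :: cleft c) Blank [::]
             | a :: r => Config q' (w :: cleft c) a r
             end
  end.

Definition tm_init (M : TM) (w : seq sym) : config (tm_state M) :=
  match w with
  | [::] => Config (@tm_start M) [::] Blank [::]
  | a :: r => Config (@tm_start M) [::] a r
  end.

Definition decides_within (M : TM) (w : seq sym) (b : bool) (t : nat) : bool :=
  cstate (iter t (@tm_step M) (@tm_init M w)) == (if b then @tm_acc M else @tm_rej M).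

Definition bit (b : bool) : sym := if b then One else Zero.

Definition encode_instance (p : nat) (D : rel 'I_(2 ^ p)) (v : 'I_(2 ^ p)) : seq sym :=
  [seq bit (D i j) | i <- enum 'I_(2 ^ p), j <- enum 'I_(2 ^ p)] ++
  [seq bit (i == v) | i <- enum 'I_(2 ^ p)].

(* Main.v *)
Require Import Defs.
From HB Require Import structures.
From Stdlib Require Import ZArith Lia.
From mathcomp Require Import all_boot zify.
Set Implicit Arguments. Unset Strict Implicit. Unset Printing Implicit Defensive.

(** A seeding won by [v] is the same thing as a spanning binomial arborescence of [D] rooted at
    [v].  Take [S] to be [v] together with the endpoints of a maximal family of disjoint arcs
    [b -> a] with [v -> b] and [a -> v]: such arcs give arc-disjoint cycles through [v], so
    [#|S| <= 2 k + 1], and by maximality and neighbor-acyclicity the other players are linearly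
    ordered by [D].  An arborescence can be rearranged so that the ancestors of [S] number at most
    [5 #|S|]; the shape and the ranks of these nodes form a template, and there are at most
    [(#|S| + log n)^O(#|S|)] templates.  Given a template, the other players are placed from
    the strongest to the weakest: a filler may go below any stronger player that still has
    room, so only a counting condition on prefixes matters, and of the free slots of a
    player of [S] the largest may be filled first.  Hence the state of the placement is one counter
    per node, and reachability among these states decides the instance.  Finally
    [(log n)^O(k) <= 2^O(k log k) n].

    The algorithm is a function on lists of numbers in unary, run by a one-tape machine that
    simulates three stacks holding binary trees; being polynomial in the number of states is then
    inherited through the constructions (composition, folds over lists) it is made of. *)

(** * A one-tape machine with three stacks *)

(** The machine never learns [k]: the core is built greedily, and [k] enters only in the analysis,
    through the bound on the core. Running times are therefore polynomial in a budget, the number of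
    candidate states, and only the enumeration of these states draws on it.

    The placement rests on one identity. A player of rank r heads 2^r players and opens slots of
    ranks 0, ..., r - 1, of total volume 2^r - 1. Hence seating a filler lowers the free volume by
    exactly one, whichever slot it takes, and each free slot outside [S] belongs to a stronger
    player. So the fillers need no bookkeeping: it suffices to compare the capacity created so far
    with the number of players placed.

    Transitivity outside [S] is what allows templates to shrink: a node with a single child can be
    bypassed when it, its parent and its child are outside [S], since the parent beats the child as
    well. The work lies in the case where the slot needed for the child is occupied. The nodes that
    remain are branching, or charged to a branching node or to [S], which gives a linear bound. *)

Inductive track := TA | TB | TC.

Record store := Store { stA : seq bool; stB : seq bool; stC : seq bool; stI : seq bool }.

Definition get (s : store) (t : track) : seq bool :=
  match t with TA => stA s | TB => stB s | TC => stC s end.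

Definition put (s : store) (t : track) (l : seq bool) : store :=
  match t with
  | TA => Store l (stB s) (stC s) (stI s)
  | TB => Store (stA s) l (stC s) (stI s)
  | TC => Store (stA s) (stB s) l (stI s)
  end.

Definition put_input (s : store) (l : seq bool) : store :=
  Store (stA s) (stB s) (stC s) l.

Definition ssize (s : store) : nat :=
  size (stA s) + size (stB s) + size (stC s) + size (stI s).

Inductive instr (Q : Type) :=
  | IPush of track & bool & Q
  | IPop of track & (option bool -> Q)
  | IRead of (option bool -> Q).

Definition istep (Q : Type) (i : instr Q) (s : store) : Q * store :=
  match i with
  | IPush t b q => (q, put s t (b :: get s t))
  | IPop t k => (k (ohead (get s t)), put s t (behead (get s t)))
  | IRead k => (k (ohead (stI s)), put_input s (behead (stI s)))
  end.

(** [MInit0], [MInit1] and [MInit2] write the sentinel. An instruction starts at [MHome]; on a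
    stack, [MSeek] walks left to the first free cell of the track, [MBack] goes from there to the
    top symbol, and [MRet] returns home. [MIn], [MTake] and [MInRet] serve the input on the
    right. *)
Inductive mode :=
  MInit0 | MInit1 | MInit2 | MHome | MSeek | MBack | MRet | MIn | MTake | MInRet.

Definition mode_enc (m : mode) : bool * bool * bool * bool :=
  match m with
  | MInit0 => (false, false, false, false)
  | MInit1 => (false, false, false, true)
  | MInit2 => (false, false, true, false)
  | MHome => (false, false, true, true)
  | MSeek => (false, true, false, false)
  | MBack => (false, true, false, true)
  | MRet => (false, true, true, false)
  | MIn => (false, true, true, true)
  | MTake => (true, false, false, false)
  | MInRet => (true, false, false, true)
  end.

Definition mode_dec (x : bool * bool * bool * bool) : mode :=
  match x with
  | (false, false, false, false) => MInit0
  | (false, false, false, true) => MInit1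
  | (false, false, true, false) => MInit2
  | (false, false, true, true) => MHome
  | (false, true, false, false) => MSeek
  | (false, true, false, true) => MBack
  | (false, true, true, false) => MRet
  | (false, true, true, true) => MIn
  | (true, false, false, false) => MTake
  | _ => MInRet
  end.

Lemma mode_encK : cancel mode_enc mode_dec. Proof. by case. Qed.

HB.instance Definition _ := Finite.copy mode (can_type mode_encK).

(** The index of the scanned cell modulo 4, which tells its track; [P0] is the sentinel track. *)
Inductive phase := P0 | P1 | P2 | P3.

Definition phase_enc (m : phase) : bool * bool :=
  match m with
  | P0 => (false, false) | P1 => (false, true) | P2 => (true, false) | P3 => (true, true)
  end.

Definition phase_dec (x : bool * bool) : phase :=
  match x with
  | (false, false) => P0 | (false, true) => P1 | (true, false) => P2 | (true, true) => P3
  end.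

Lemma phase_encK : cancel phase_enc phase_dec. Proof. by case. Qed.

HB.instance Definition _ := Finite.copy phase (can_type phase_encK).

Definition nextp (p : phase) := match p with P0 => P1 | P1 => P2 | P2 => P3 | P3 => P0 end.
Definition prevp (p : phase) := match p with P0 => P3 | P1 => P0 | P2 => P1 | P3 => P2 end.
Definition phase_of (k : nat) : phase := iter k nextp P0.
Definition off (t : track) : nat := match t with TA => 1 | TB => 2 | TC => 3 end.

Definition at_track (p : phase) (t : track) : bool :=
  match p, t with P1, TA | P2, TB | P3, TC => true | _, _ => false end.

Lemma phase_of4 k : phase_of (k + 4) = phase_of k.
Proof. by rewrite /phase_of addnC iterD; case: (iter k nextp P0). Qed.

Lemma phase_ofE k : phase_of k = phase_of (k %% 4).
Proof.
rewrite {1}(divn_eq k 4); elim: (k %/ 4) => [|n IH] //.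
by rewrite mulSn -addnA addnC phase_of4.
Qed.

Lemma at_trackE k t : at_track (phase_of k) t = (k %% 4 == off t).
Proof.
rewrite phase_ofE; have: k %% 4 < 4 by rewrite ltn_mod.
by case: (k %% 4) => [|[|[|[|]]]] //; case: t.
Qed.

Definition isP0 (p : phase) := if p is P0 then true else false.

Lemma isP0E k : isP0 (phase_of k) = (k %% 4 == 0).
Proof.
rewrite phase_ofE; have: k %% 4 < 4 by rewrite ltn_mod.
by case: (k %% 4) => [|[|[|[|]]]].
Qed.

Lemma prevp_of k : prevp (phase_of k.+1) = phase_of k.
Proof. by rewrite /phase_of /=; case: (iter k nextp P0). Qed.

Definition isBlank (s : sym) := if s is Blank then true else false.
Definition isOne (s : sym) := if s is One then true else false.

Section Machine.
Variables (Q : finType) (start : Q) (act : Q -> instr (Q + bool)).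

Definition mstate : finType := ((Q * mode * phase * option bool) + bool)%type.

Definition goto (x : Q + bool) : mstate :=
  match x with inl q => inl (q, MHome, P0, None) | inr b => inr b end.

Definition resume (q : Q) (r : option bool) : mstate :=
  match act q with
  | IPush _ _ q' => goto q'
  | IPop _ k => goto (k r)
  | IRead k => goto (k r)
  end.

Definition mdelta (x : mstate) (s : sym) : mstate * sym * move :=
  match x with
  | inr b => (inr b, s, Stay)
  | inl (q, m, p, r) =>
    match m with
    | MInit0 => (inl (q, MInit1, P0, None), s, MoveL)
    | MInit1 => (inl (q, MInit2, P0, None), s, MoveL)
    | MInit2 => (inl (q, MHome, P0, None), One, MoveR)
    | MHome => match act q with
               | IRead _ => (inl (q, MIn, P0, None), s, MoveR)
               | _ => (inl (q, MSeek, P0, None), s, MoveL)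
               end
    | MSeek =>
      match act q with
      | IPush t b _ =>
        if at_track p t && isBlank s then (inl (q, MRet, p, None), bit b, Stay)
        else (inl (q, MSeek, nextp p, None), s, MoveL)
      | IPop t _ =>
        if at_track p t && isBlank s then (inl (q, MBack, prevp p, None), s, MoveR)
        else (inl (q, MSeek, nextp p, None), s, MoveL)
      | IRead _ => (inl (q, MSeek, p, None), s, Stay)
      end
    | MBack =>
      match act q with
      | IPop t _ =>
        if isP0 p && isOne s then (inl (q, MRet, p, None), s, Stay)
        else if at_track p t then (inl (q, MRet, p, Some (isOne s)), Blank, Stay)
        else (inl (q, MBack, prevp p, None), s, MoveR)
      | _ => (inl (q, MBack, p, None), s, Stay)
      end
    | MRet =>
      if isP0 p && isOne s then (resume q r, s, MoveR)
      else (inl (q, MRet, prevp p, r), s, MoveR)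
    | MIn => if isBlank s then (inl (q, MTake, P0, None), s, MoveL)
             else (inl (q, MIn, P0, None), s, MoveR)
    | MTake => if isBlank s then (resume q None, s, Stay)
               else (inl (q, MInRet, P0, Some (isOne s)), Blank, MoveL)
    | MInRet => if isBlank s then (resume q r, s, Stay)
                else (inl (q, MInRet, P0, r), s, MoveL)
    end
  end.

Lemma acc_neq_rej : (inr true : mstate) != inr false. Proof. by []. Qed.

Definition machine : TM :=
  @Build_TM mstate (inl (start, MInit0, P0, None)) (inr true) (inr false) acc_neq_rej mdelta.

(** * Tape contents and head moves *)

Local Open Scope Z_scope.

Definition shift (m : move) : Z := match m with MoveL => -1 | Stay => 0 | MoveR => 1 end.

(* The tape is seen as a function on Z, up to the blanks that the lists omit. *)
Definition rep (c : config mstate) (x : mstate) (z : Z) (g : Z -> sym) : Prop :=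
  [/\ cstate c = x, chead c = g z,
      forall i : nat, nth Blank (cleft c) i = g (z - 1 - Z.of_nat i) &
      forall i : nat, nth Blank (cright c) i = g (z + 1 + Z.of_nat i)].

Lemma rep_step c q m p r z g x' w mv g' :
  rep c (inl (q, m, p, r)) z g -> mdelta (inl (q, m, p, r)) (g z) = (x', w, mv) ->
  (forall y, g' y = if y =? z then w else g y) ->
  rep (@tm_step machine c) x' (z + shift mv) g'.
Proof.
move=> Hc E Hg; case: c Hc => st l h rr [/= -> -> Hl Hr].
have Hg1 y : y <> z -> g' y = g y.
  by move=> N; rewrite Hg; case: Z.eqb_spec.
have Hg0 : g' z = w by rewrite Hg Z.eqb_refl.
have L i y : y = z - 1 - Z.of_nat i -> nth Blank l i = g' y.
  by move=> ->; rewrite Hg1; [rewrite Hl | lia].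
have R i y : y = z + 1 + Z.of_nat i -> nth Blank rr i = g' y.
  by move=> ->; rewrite Hg1; [rewrite Hr | lia].
have W y : y = z -> w = g' y by move=> ->.
rewrite /tm_step.
have -> : @tm_delta machine = mdelta by [].
cbn [cstate chead cleft cright]; rewrite E; cbn [andb orb].
case: mv E => E /=.
- case: l Hl L => [|a l] Hl L; split => //=.
  + by apply: (L 0%N); lia.
  + by move=> i; apply: etrans (L i.+1 _ _); [case: i | lia].
  + by case=> [|i] /=; [apply: W; lia | apply: R; lia].
  + by apply: (L 0%N); lia.
  + by move=> i; apply: (L i.+1); lia.
  + by case=> [|i] /=; [apply: W; lia | apply: R; lia].
- split => //=; first by apply: W; lia.
  + by move=> i; apply: L; lia.
  + by move=> i; apply: R; lia.
- case: rr Hr R => [|a rr] Hr R; split => //=.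
  + by apply: (R 0%N); lia.
  + by case=> [|i] /=; [apply: W; lia | apply: L; lia].
  + by move=> i; apply: etrans (R i.+1 _ _); [case: i | lia].
  + by apply: (R 0%N); lia.
  + by case=> [|i] /=; [apply: W; lia | apply: L; lia].
  + by move=> i; apply: (R i.+1); lia.
Qed.

Definition run (n : nat) (c : config mstate) : config mstate := iter n (@tm_step machine) c.

Definition reach x z g n x' z' g' : Prop :=
  forall c, rep c x z g -> rep (run n c) x' z' g'.

Lemma reach_trans x z g n x1 z1 g1 n' x2 z2 g2 :
  reach x z g n x1 z1 g1 -> reach x1 z1 g1 n' x2 z2 g2 ->
  reach x z g (n' + n)%N x2 z2 g2.
Proof. by move=> H1 H2 c Hc; rewrite /run iterD; apply: H2; apply: H1. Qed.

Lemma reach_ext x z g x' z' g' :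
  x = x' -> z = z' -> (forall y, g y = g' y) -> reach x z g 0 x' z' g'.
Proof.
move=> <- <- E c [H1 H2 H3 H4]; split => //=; first by rewrite -E.
  by move=> i; rewrite -E.
by move=> i; rewrite -E.
Qed.

Lemma reach_move q m p r z g x' mv z' :
  mdelta (inl (q, m, p, r)) (g z) = (x', g z, mv) -> z' = z + shift mv ->
  reach (inl (q, m, p, r)) z g 1 x' z' g.
Proof.
move=> E -> c Hc; apply: (rep_step Hc E) => y.
by case: Z.eqb_spec => [->|].
Qed.

(** The head of a list is the top of the stack while cell 0 is its bottom, hence [rev]. Beyond the
    list the cells are blank, so the first blank of a track locates its top. *)
Definition tcell (l : seq bool) (i : nat) : sym := nth Blank (map bit (rev l)) i.

Definition left_cell (s : store) (k : nat) : sym :=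
  match (k %% 4)%N with
  | 0%N => if k == 0%N then One else Blank
  | 1%N => tcell (stA s) (k %/ 4)
  | 2%N => tcell (stB s) (k %/ 4)
  | _ => tcell (stC s) (k %/ 4)
  end.

(* Cell [-1] is the home position; on its left the three stacks are interleaved
   with a sentinel track, bottom nearest to home; the input stack is on its right. *)
Definition tape (s : store) (z : Z) : sym :=
  if z >=? 0 then tcell (stI s) (Z.to_nat z)
  else if z =? -1 then Blank else left_cell s (Z.to_nat (-2 - z)).

Definition lpos (k : nat) : Z := -2 - Z.of_nat k.

Lemma tape_left s k : tape s (lpos k) = left_cell s k.
Proof.
rewrite /tape /lpos; have -> : (-2 - Z.of_nat k >=? 0) = false by lia.
have -> : (-2 - Z.of_nat k =? -1) = false by lia.
by congr (left_cell s _); lia.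
Qed.

Lemma tape_right s k : tape s (Z.of_nat k) = tcell (stI s) k.
Proof.
rewrite /tape; have -> : (Z.of_nat k >=? 0) = true by lia.
by congr (tcell _ _); lia.
Qed.

Lemma left_cell_track s k t : (k %% 4)%N = off t -> left_cell s k = tcell (get s t) (k %/ 4).
Proof. by rewrite /left_cell => ->; case: t. Qed.

(** On its way back the head cannot recognise home by a blank, since stacks of different heights
    leave blanks everywhere; the only [One] on the sentinel track, next to home, does it. *)
Lemma left_cell_sentinel s k : (isP0 (phase_of k) && isOne (left_cell s k)) = (k == 0%N).
Proof.
rewrite isP0E /left_cell; case: k => [|k] //=.
by case: (k.+1 %% 4)%N.
Qed.

Lemma tcell_blank l i : isBlank (tcell l i) = (size l <= i)%N.
Proof.
rewrite /tcell; case: leqP => H.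
  by rewrite nth_default // size_map size_rev.
rewrite (nth_map false) ?size_rev //; by case: (nth _ _ _).
Qed.

Lemma tcell_cons b l i : tcell (b :: l) i = if i == size l then bit b else tcell l i.
Proof.
rewrite /tcell rev_cons map_rcons nth_rcons size_map size_rev.
case: ltngtP => // H; by rewrite nth_default // size_map size_rev ltnW.
Qed.

Lemma left_cell_put s t l k :
  left_cell (put s t l) k =
  if (k %% 4)%N == off t then tcell l (k %/ 4) else left_cell s k.
Proof.
rewrite /left_cell; have: (k %% 4 < 4)%N by rewrite ltn_mod.
by case: (k %% 4)%N => [|[|[|[|]]]] //; case: t.
Qed.

Lemma tape_put s t l z :
  tape (put s t l) z =
  if (z <? -1) && (Z.to_nat (-2 - z) %% 4 == off t)%N then tcell l (Z.to_nat (-2 - z) %/ 4)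
  else tape s z.
Proof.
rewrite /tape; case: (Z.geb_spec z 0) => H.
  have -> : (z <? -1) = false by lia.
  by case: t.
case: Z.eqb_spec => [->|N] //=.
have -> : (z <? -1) = true by lia.
exact: left_cell_put.
Qed.

Definition tgt (s : store) (t : track) : nat := (4 * size (get s t) + off t)%N.

Lemma off_lt4 t : (off t < 4)%N. Proof. by case: t. Qed.

Definition stack_track (i : instr (Q + bool)) : option track :=
  match i with IPush t _ _ => Some t | IPop t _ => Some t | IRead _ => None end.

Lemma reach_seek q s t k : stack_track (act q) = Some t -> (k <= tgt s t)%N ->
  reach (inl (q, MSeek, phase_of k, None)) (lpos k) (tape s) (tgt s t - k)%N
        (inl (q, MSeek, phase_of (tgt s t), None)) (lpos (tgt s t)) (tape s).
Proof.
move=> Ht; rewrite leq_eqVlt => /orP [/eqP ->|].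
  by rewrite subnn; apply: reach_ext.
move En: (tgt s t - k)%N => n Hk.
elim: n k En Hk => [|n IH] k En Hk; first by lia.
have Hs : (at_track (phase_of k) t && isBlank (tape s (lpos k))) = false.
  rewrite tape_left at_trackE; case: eqP => //= Eo.
  rewrite (left_cell_track _ Eo) tcell_blank; apply/negbTE; rewrite -ltnNge.
  by move: Hk Eo (off_lt4 t); rewrite /tgt; lia.
have -> : n.+1 = (n + 1)%N by lia.
apply: (@reach_trans _ _ _ _ (inl (q, MSeek, phase_of k.+1, None)) (lpos k.+1) (tape s)).
  apply: (@reach_move _ _ _ _ _ _ _ MoveL); last by rewrite /lpos /shift; lia.
  by rewrite /=; case: (act q) Ht => [t' b q'|t' k'|k'] //= [->]; rewrite Hs.
case: (ltngtP k.+1 (tgt s t)) => H; last 1 first.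
- by have -> : n = 0%N by [lia]; rewrite H; apply: reach_ext.
- by apply: IH; lia.
- by lia.
Qed.

Lemma reach_ret q s r k :
  reach (inl (q, MRet, phase_of k, r)) (lpos k) (tape s) k.+1 (resume q r) (-1) (tape s).
Proof.
elim: k => [|k IH].
  by apply: (@reach_move _ _ _ _ _ _ _ MoveR); [rewrite tape_left|].
rewrite -(addn1 k.+1).
apply: (@reach_trans _ _ _ _ (inl (q, MRet, phase_of k, r)) (lpos k) (tape s)) IH.
apply: (@reach_move _ _ _ _ _ _ _ MoveR); last by rewrite /lpos /shift; lia.
have := left_cell_sentinel s k.+1; rewrite -tape_left /= => ->.
by rewrite -[nextp _]/(phase_of k.+1) prevp_of.
Qed.

Lemma reach_home q s t : stack_track (act q) = Some t ->
  reach (inl (q, MHome, P0, None)) (-1) (tape s) 1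
        (inl (q, MSeek, phase_of 0, None)) (lpos 0) (tape s).
Proof.
move=> Ht; apply: (@reach_move _ _ _ _ _ _ _ MoveL) => //.
by rewrite /=; case: (act q) Ht.
Qed.

Lemma reach_write q m p r z g x' w g' :
  mdelta (inl (q, m, p, r)) (g z) = (x', w, Stay) ->
  (forall y, g' y = if y =? z then w else g y) ->
  reach (inl (q, m, p, r)) z g 1 x' z g'.
Proof.
move=> E Hg c Hc; have := rep_step Hc E Hg.
by rewrite /= Z.add_0_r.
Qed.

Lemma tape_put_push s t b y :
  tape (put s t (b :: get s t)) y = if y =? lpos (tgt s t) then bit b else tape s y.
Proof.
rewrite tape_put tcell_cons.
case: Z.eqb_spec => [->|N].
  have -> : (lpos (tgt s t) <? -1) = true by rewrite /lpos; lia.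
  have -> : Z.to_nat (-2 - lpos (tgt s t)) = tgt s t by rewrite /lpos; lia.
  have := off_lt4 t; rewrite /tgt => Ho.
  have -> : ((4 * size (get s t) + off t) %% 4 = off t)%N by lia.
  have -> : ((4 * size (get s t) + off t) %/ 4 = size (get s t))%N by lia.
  by rewrite !eqxx.
case: ifP => // /andP [H1 /eqP H2].
rewrite ifF.
  rewrite -(left_cell_track _ H2) -tape_left; congr (tape s _); rewrite /lpos; lia.
apply/eqP => H3; apply: N; rewrite /lpos /tgt; lia.
Qed.

(** The factor 8 is a round trip over a stack whose cells are four apart. *)
Lemma reach_push q s t b q' : act q = IPush t b q' ->
  exists2 n, (n <= 8 * (ssize s).+2)%N &
  reach (inl (q, MHome, P0, None)) (-1) (tape s) n (goto q') (-1)
        (tape (put s t (b :: get s t))).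
Proof.
move=> E; have Ht : stack_track (act q) = Some t by rewrite E.
exists ((tgt s t).+1 + 1 + (tgt s t - 0) + 1)%N.
  have : (size (get s t) <= ssize s)%N by rewrite /ssize; case: t {E Ht} => /=; lia.
  by move: (off_lt4 t); rewrite /tgt; lia.
apply: (reach_trans (reach_home Ht)).
apply: (reach_trans (reach_seek Ht (leq0n _))).
apply: reach_trans.
  apply: (@reach_write _ _ _ _ _ _ (inl (q, MRet, phase_of (tgt s t), None)) (bit b)
            (tape (put s t (b :: get s t)))); last exact: tape_put_push.
  rewrite /= E tape_left at_trackE.
  have := off_lt4 t => Ho.
  have Em : (tgt s t %% 4 = off t)%N by rewrite /tgt; lia.
  rewrite Em eqxx (left_cell_track _ Em) tcell_blank /=.
  by rewrite ifT // /tgt; lia.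
have -> : goto q' = resume q None by rewrite /resume E.
exact: reach_ret.
Qed.

(** Used with [k] one less than [off t], just right of the first free cell: [MBack] then stops on
    the top symbol or, on an empty stack ([j] = 0), at the sentinel. *)
Lemma reach_back q s t k' k : act q = IPop t k' -> (k < off t)%N ->
  forall j, let pos := (4 * j + k)%N in
  reach (inl (q, MBack, phase_of pos, None)) (lpos pos) (tape s)
        (if j == 0%N then k else (4 + k - off t)%N)
        (inl (q, MBack, phase_of (if j == 0%N then 0%N else (4 * j.-1 + off t)%N), None))
        (lpos (if j == 0%N then 0%N else (4 * j.-1 + off t)%N)) (tape s).
Proof.
move=> E Hk j; set dst := (if j == 0%N then 0%N else _).
move=> pos; have -> : (if j == 0%N then k else (4 + k - off t)%N) = (pos - dst)%N.
  rewrite /pos /dst; have := off_lt4 t; case: j {dst pos} => [|j] /=; lia.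
have Hd : (dst <= pos)%N.
  rewrite /pos /dst; have := off_lt4 t; case: j {dst pos} => [|j] /=; lia.
have Hm i : (dst < i <= pos)%N -> at_track (phase_of i) t = false /\ i != 0%N.
  move=> H; rewrite at_trackE; split; last by lia.
  by apply/eqP; move: H; rewrite /pos /dst; have := off_lt4 t; case: j {dst pos Hd} => [|j] /=; lia.
move: pos Hd Hm => pos; move En: (pos - dst)%N => n.
elim: n pos En => [|n IH] pos En Hd Hm.
  by have -> : pos = dst by [lia]; apply: reach_ext.
case: pos En Hd Hm => [|pos] En Hd Hm; first by lia.
have [] := Hm pos.+1; first by lia.
move=> H1 H2.
rewrite -(addn1 n).
apply: (@reach_trans _ _ _ _ (inl (q, MBack, phase_of pos, None)) (lpos pos) (tape s)).
  apply: (@reach_move _ _ _ _ _ _ _ MoveR); last by rewrite /lpos /shift; lia.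
  rewrite /mdelta E.
  have := left_cell_sentinel s pos.+1; rewrite -tape_left (negbTE H2) => ->.
  by rewrite H1 prevp_of.
by apply: IH; [lia | lia | move=> i Hi; apply: Hm; lia].
Qed.

Lemma tape_put_pop s t b l y : get s t = b :: l ->
  tape (put s t l) y = if y =? lpos (4 * size l + off t) then Blank else tape s y.
Proof.
move=> Es; rewrite tape_put.
case: Z.eqb_spec => [->|N].
  have -> : (lpos (4 * size l + off t) <? -1) = true by rewrite /lpos; lia.
  have -> : Z.to_nat (-2 - lpos (4 * size l + off t)) = (4 * size l + off t)%N by rewrite /lpos; lia.
  have := off_lt4 t => Ho.
  have -> : ((4 * size l + off t) %% 4 = off t)%N by lia.
  have -> : ((4 * size l + off t) %/ 4 = size l)%N by lia.
  by rewrite eqxx /= /tcell nth_default // size_map size_rev.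
case: ifP => // /andP [H1 /eqP H2].
have -> : tape s y = tcell (get s t) (Z.to_nat (-2 - y) %/ 4).
  rewrite -(left_cell_track _ H2) -tape_left; congr (tape s _); rewrite /lpos; lia.
rewrite Es tcell_cons ifF //.
apply/eqP => H3; apply: N; rewrite /lpos; lia.
Qed.

Lemma reach_pop q s t k : act q = IPop t k ->
  exists2 n, (n <= 8 * (ssize s).+2)%N &
  reach (inl (q, MHome, P0, None)) (-1) (tape s) n (goto (k (ohead (get s t)))) (-1)
        (tape (put s t (behead (get s t)))).
Proof.
move=> E; have Ht : stack_track (act q) = Some t by rewrite E.
have Ho := off_lt4 t; have Ho' : (0 < off t)%N by case: (t).
have Hs : (size (get s t) <= ssize s)%N by rewrite /ssize; case: t {E Ht Ho Ho'} => /=; lia.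
have Em : (tgt s t %% 4 = off t)%N by rewrite /tgt; lia.
have Step : reach (inl (q, MSeek, phase_of (tgt s t), None)) (lpos (tgt s t)) (tape s) 1
   (inl (q, MBack, phase_of (4 * size (get s t) + (off t).-1), None))
   (lpos (4 * size (get s t) + (off t).-1)) (tape s).
  apply: (@reach_move _ _ _ _ _ _ _ MoveR); last by rewrite /lpos /tgt /shift; lia.
  rewrite /mdelta E tape_left at_trackE Em eqxx (left_cell_track _ Em) tcell_blank /=.
  rewrite ifT; last by rewrite /tgt; lia.
  have -> : tgt s t = (4 * size (get s t) + (off t).-1).+1 by rewrite /tgt; lia.
  by rewrite prevp_of.
have Back := @reach_back q s t k (off t).-1 E ltac:(lia) (size (get s t)).
have Res r : goto (k r) = resume q r by rewrite /resume E.
case Es: (get s t) Hs Step Back => [|b l] /= Hs Step Back.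
  exists (1 + 1 + (off t).-1 + 1 + (tgt s t - 0) + 1)%N.
    by move: Hs; rewrite /tgt Es /=; lia.
  apply: (reach_trans (reach_home Ht)).
  apply: (reach_trans (reach_seek Ht (leq0n _))).
  apply: (reach_trans Step).
  apply: (reach_trans Back).
  apply: (@reach_trans _ _ _ _ (inl (q, MRet, phase_of 0, None)) (lpos 0) (tape s)).
    apply: (@reach_move _ _ _ _ _ _ _ Stay) => //.
    by rewrite /mdelta E tape_left.
  rewrite Res; have -> : put s t [::] = s by move: Es; case: (t); case: (s) => a b c i /= ->.
  exact: (@reach_ret q s None 0).
exists ((4 * size l + off t).+1 + 1 + (4 + (off t).-1 - off t) + 1 + (tgt s t - 0) + 1)%N.
  by move: Hs; rewrite /tgt Es /=; lia.
apply: (reach_trans (reach_home Ht)).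
apply: (reach_trans (reach_seek Ht (leq0n _))).
apply: (reach_trans Step).
apply: (reach_trans Back).
rewrite Res; apply: reach_trans (@reach_ret q (put s t l) (Some b) (4 * size l + off t)).
apply: (@reach_write _ _ _ _ _ _ _ Blank); last by move=> y; apply: tape_put_pop Es.
have Em' : ((4 * size l + off t) %% 4 = off t)%N by lia.
rewrite /mdelta E tape_left.
rewrite left_cell_sentinel at_trackE Em' eqxx ifF; last by lia.
rewrite (left_cell_track _ Em') Es tcell_cons.
have -> : ((4 * size l + off t) %/ 4 = size l)%N by lia.
by rewrite eqxx; case: (b).
Qed.

Lemma reach_in q s k' k : act q = IRead k' -> (k <= size (stI s))%N ->
  reach (inl (q, MIn, P0, None)) (Z.of_nat k) (tape s) (size (stI s) - k)%N
        (inl (q, MIn, P0, None)) (Z.of_nat (size (stI s))) (tape s).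
Proof.
move=> E; move En: (size (stI s) - k)%N => n.
elim: n k En => [|n IH] k En Hk.
  by apply: reach_ext => //; lia.
rewrite -(addn1 n).
apply: (@reach_trans _ _ _ _ (inl (q, MIn, P0, None)) (Z.of_nat k.+1) (tape s)).
  apply: (@reach_move _ _ _ _ _ _ _ MoveR); last by rewrite /shift; lia.
  by rewrite /mdelta tape_right tcell_blank ifF //; lia.
by apply: IH; lia.
Qed.

Lemma reach_inret q s r k : (k <= size (stI s))%N ->
  reach (inl (q, MInRet, P0, r)) (Z.of_nat k - 1) (tape s) k.+1 (resume q r) (-1) (tape s).
Proof.
elim: k => [|k IH] Hk.
  by apply: (@reach_move _ _ _ _ _ _ _ Stay).
rewrite -(addn1 k.+1).
apply: (@reach_trans _ _ _ _ (inl (q, MInRet, P0, r)) (Z.of_nat k - 1) (tape s)); last by apply: IH; lia.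
apply: (@reach_move _ _ _ _ _ _ _ MoveL); last by rewrite /shift; lia.
have -> : Z.of_nat k.+1 - 1 = Z.of_nat k by lia.
by rewrite /mdelta tape_right tcell_blank ifF //; lia.
Qed.

Lemma tape_put_input s b l y : stI s = b :: l ->
  tape (put_input s l) y = if y =? Z.of_nat (size l) then Blank else tape s y.
Proof.
move=> Es; rewrite /tape /put_input; cbn [stI]; rewrite Es.
case: (Z.eqb_spec y (Z.of_nat (size l))) => [->|N].
  have -> : (Z.of_nat (size l) >=? 0) = true by lia.
  by rewrite /tcell nth_default // size_map size_rev; lia.
case: (Z.geb_spec y 0) => H //.
rewrite tcell_cons ifF //; apply/eqP; lia.
Qed.

Lemma reach_read q s k : act q = IRead k ->
  exists2 n, (n <= 8 * (ssize s).+2)%N &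
  reach (inl (q, MHome, P0, None)) (-1) (tape s) n (goto (k (ohead (stI s)))) (-1)
        (tape (put_input s (behead (stI s)))).
Proof.
move=> E.
have Hs : (size (stI s) <= ssize s)%N by rewrite /ssize; lia.
have Res r : goto (k r) = resume q r by rewrite /resume E.
have Home : reach (inl (q, MHome, P0, None)) (-1) (tape s) 1
    (inl (q, MIn, P0, None)) (Z.of_nat 0) (tape s).
  by apply: (@reach_move _ _ _ _ _ _ _ MoveR) => //; rewrite /mdelta E.
have In := reach_in E (leq0n (size (stI s))).
have Take : reach (inl (q, MIn, P0, None)) (Z.of_nat (size (stI s))) (tape s) 1
   (inl (q, MTake, P0, None)) (Z.of_nat (size (stI s)) - 1) (tape s).
  apply: (@reach_move _ _ _ _ _ _ _ MoveL); last by rewrite /shift; lia.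
  by rewrite /mdelta tape_right tcell_blank leqnn.
rewrite Res; case Es: (stI s) Hs In Take => [|b l] Hs In Take.
  exists (1 + 1 + (0 - 0) + 1)%N; first by lia.
  apply: (reach_trans Home); apply: (reach_trans In); apply: (reach_trans Take).
  have -> : put_input s [::] = s by move: Es; case: (s) => a b c i /= ->.
  exact: (@reach_move _ _ _ _ _ _ _ Stay).
exists ((size l).+1 + 1 + 1 + ((size l).+1 - 0) + 1)%N; first by move: Hs => /=; lia.
apply: (reach_trans Home); apply: (reach_trans In); apply: (reach_trans Take).
have -> : Z.of_nat (size (b :: l)) - 1 = Z.of_nat (size l).
  by change (size (b :: l)) with (size l).+1; lia.
apply: reach_trans; last by apply: (@reach_inret q (put_input s l) (Some b) (size l)).
move=> c Hc; apply: (rep_step Hc (mv := MoveL) (w := Blank)); last by move=> y; apply: tape_put_input Es.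
by rewrite /mdelta tape_right Es tcell_cons eqxx; case: (b).
Qed.

Lemma reach_istep q s : let: (x, s') := istep (act q) s in
  exists2 n, (n <= 8 * (ssize s).+2)%N &
  reach (inl (q, MHome, P0, None)) (-1) (tape s) n (goto x) (-1) (tape s').
Proof.
case E: (act q) => [t b q'|t k|k] /=.
- exact: reach_push.
- exact: reach_pop.
- exact: reach_read.
Qed.

Definition sstep (x : (Q + bool) * store) : (Q + bool) * store :=
  match x with (inl q, s) => istep (act q) s | _ => x end.

Lemma ssize_istep (P : Type) (i : instr P) s : (ssize (istep i s).2 <= (ssize s).+1)%N.
Proof.
case: i => [t b q|t k|k] /=; rewrite /ssize; last by rewrite /= size_behead; lia.
  by case: t => /=; lia.
by case: t => /=; rewrite size_behead; lia.
Qed.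

(** An instruction costs a sweep linear in the store, which grows by at most one bit per
    instruction; the simulation is thus quadratic. *)
Lemma reach_sstep n x s x' s' : iter n sstep (x, s) = (x', s') ->
  exists2 k, (k <= n * (8 * (ssize s + n).+2))%N &
  reach (goto x) (-1) (tape s) k (goto x') (-1) (tape s').
Proof.
elim: n x s => [|n IH] x s.
  by case=> -> ->; exists 0%N => //; apply: reach_ext.
rewrite iterSr; case: x => [q|b] E; last first.
  have [k Hk R] := IH _ _ E; exists k => //.
  by apply: leq_trans Hk _; apply: leq_mul; lia.
have := reach_istep q s; move: E => /=.
have := ssize_istep (act q) s.
case: (istep (act q) s) => x1 s1 /= Hs /IH [k Hk R] [k1 Hk1 R1].
exists (k + k1)%N; last exact: reach_trans R1 R.
rewrite mulSn addnC; apply: leq_add; first by lia.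
by apply: leq_trans Hk _; apply: leq_mul; lia.
Qed.

Lemma run_halted n c b : cstate c = inr b :> mstate -> run n c = c.
Proof.
move=> E; elim: n => // n IH; rewrite /run iterS -/(run n c) IH /tm_step E.
by case: b {E}.
Qed.

(* The machine starts by writing the sentinel next to its home cell. *)
Lemma rep_init w :
  rep (run 3 (@tm_init machine (map bit w))) (goto (inl start)) (-1)
      (tape (Store [::] [::] [::] (rev w))).
Proof.
pose g z := if z >=? 0 then tcell (rev w) (Z.to_nat z) else Blank.
have R0 : rep (@tm_init machine (map bit w)) (inl (start, MInit0, P0, None)) 0 g.
  have Hr i : nth Blank (behead (map bit w)) i = g (0 + 1 + Z.of_nat i).
    rewrite nth_behead /g /tcell revK.
    have -> : (0 + 1 + Z.of_nat i >=? 0) = true by lia.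
    by congr (nth _ _ _); lia.
  have Hh : head Blank (map bit w) = g 0 by rewrite /g /tcell revK /= -nth0.
  have Hl i : Blank = g (0 - 1 - Z.of_nat i).
    by rewrite /g; have -> : (0 - 1 - Z.of_nat i >=? 0) = false by lia.
  case: w @g Hr Hh Hl => [|b w] g Hr Hh Hl; split; [by []| exact: Hh | | exact: Hr
    |by []| exact: Hh | | exact: Hr]; by move=> i; rewrite nth_nil; apply: Hl.
have R1 : rep (run 2 (@tm_init machine (map bit w))) (inl (start, MInit2, P0, None)) (-2) g.
  apply: (@reach_trans _ _ _ 1 (inl (start, MInit1, P0, None)) (-1) g 1) R0;
    by apply: (@reach_move _ _ _ _ _ _ _ MoveL).
rewrite /run iterS; apply: (rep_step R1 (mv := MoveR) (w := One)) => // y.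
rewrite /g /tape; cbn [stI]; case: (Z.geb_spec y 0) => H.
  by case: Z.eqb_spec => //; lia.
case: Z.eqb_spec => [->|N] //; case: Z.eqb_spec => [->|N'] //.
rewrite /left_cell /= /tcell /= !nth_nil.
have -> : (Z.to_nat (-2 - y) == 0%N) = false by apply/eqP; lia.
by case: (_ %% 4)%N => [|[|[|]]].
Qed.

(** The three extra steps write the sentinel; a halted machine no longer moves, so every larger [T]
    serves too. *)
Theorem machine_decides w b n s' T :
  iter n sstep (inl start, Store [::] [::] [::] (rev w)) = (inr b, s') ->
  (n * (8 * (size w + n).+2) + 3 <= T)%N ->
  decides_within machine (map bit w) b T.
Proof.
move=> /reach_sstep [k]; rewrite /ssize /= size_rev !add0n => Hk R HT.
have := R _ (rep_init w); rewrite /run -iterD => -[E _ _ _].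
have -> : T = (T - (k + 3) + (k + 3))%N by lia.
rewrite /decides_within iterD.
have := @run_halted (T - (k + 3)) _ _ E; rewrite /run => ->.
by rewrite E; case: b {E R}.
Qed.
End Machine.

(** * Stack programs on binary trees *)

(** The three branches are for [false], [true] and an empty stack, in this order. [CWhile] consumes
    the bit it tests, also when it exits, and an empty stack ends the loop as [false] does. *)
Inductive cmd :=
  | CSkip
  | CPush of track & bool
  | CPop of track & cmd & cmd & cmd
  | CRead of cmd & cmd & cmd
  | CSeq of cmd & cmd
  | CWhile of track & cmd.

Definition branch (T : Type) (r : option bool) (c0 c1 cE : T) : T :=
  match r with Some true => c1 | Some false => c0 | None => cE end.

Inductive exec : cmd -> store -> store -> nat -> Prop :=
  | ESkip s : exec CSkip s s 0
  | EPush t b s : exec (CPush t b) s (put s t (b :: get s t)) 1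
  | EPop t c0 c1 cE s s' n :
      exec (branch (ohead (get s t)) c0 c1 cE) (put s t (behead (get s t))) s' n ->
      exec (CPop t c0 c1 cE) s s' n.+1
  | ERead c0 c1 cE s s' n :
      exec (branch (ohead (stI s)) c0 c1 cE) (put_input s (behead (stI s))) s' n ->
      exec (CRead c0 c1 cE) s s' n.+1
  | ESeq c1 c2 s s1 s2 n1 n2 :
      exec c1 s s1 n1 -> exec c2 s1 s2 n2 -> exec (CSeq c1 c2) s s2 (n1 + n2)
  | EWhileT t c s s1 s2 n1 n2 :
      ohead (get s t) = Some true -> exec c (put s t (behead (get s t))) s1 n1 ->
      exec (CWhile t c) s1 s2 n2 -> exec (CWhile t c) s s2 (n1 + n2).+1
  | EWhileF t c s :
      ohead (get s t) <> Some true -> exec (CWhile t c) s (put s t (behead (get s t))) 1.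

(** Only stack instructions are control points: [CSkip] and sequencing cost no step, and [entry]
    resolves them to the next instruction or to the exit. *)
Fixpoint cstates (c : cmd) : finType :=
  match c with
  | CSkip => void
  | CPush _ _ => unit
  | CPop _ c0 c1 cE => (unit + (cstates c0 + (cstates c1 + cstates cE)))%type
  | CRead c0 c1 cE => (unit + (cstates c0 + (cstates c1 + cstates cE)))%type
  | CSeq c1 c2 => (cstates c1 + cstates c2)%type
  | CWhile _ c => (unit + cstates c)%type
  end.

Fixpoint entry (c : cmd) (R : Type) : (cstates c -> R) -> R -> R :=
  match c return (cstates c -> R) -> R -> R with
  | CSkip => fun _ k => k
  | CPush _ _ => fun emb _ => emb tt
  | CPop _ _ _ _ => fun emb _ => emb (inl tt)
  | CRead _ _ _ => fun emb _ => emb (inl tt)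
  | CSeq c1 c2 => fun emb k =>
      entry (fun q => emb (inl q)) (entry (fun q => emb (inr q)) k)
  | CWhile _ _ => fun emb _ => emb (inl tt)
  end.

(* [emb] injects the local control points in a larger set, [k] is the exit point. *)
Fixpoint cact (c : cmd) (R : Type) : (cstates c -> R) -> R -> cstates c -> instr R :=
  match c return (cstates c -> R) -> R -> cstates c -> instr R with
  | CSkip => fun _ _ q => match q with end
  | CPush t b => fun _ k _ => IPush t b k
  | CPop t c0 c1 cE => fun emb k q =>
      match q with
      | inl _ => IPop t (fun r => branch r (entry (fun q => emb (inr (inl q))) k)
                   (entry (fun q => emb (inr (inr (inl q)))) k)
                   (entry (fun q => emb (inr (inr (inr q)))) k))
      | inr (inl q) => cact (fun q => emb (inr (inl q))) k q
      | inr (inr (inl q)) => cact (fun q => emb (inr (inr (inl q)))) k q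
      | inr (inr (inr q)) => cact (fun q => emb (inr (inr (inr q)))) k q
      end
  | CRead c0 c1 cE => fun emb k q =>
      match q with
      | inl _ => IRead (fun r => branch r (entry (fun q => emb (inr (inl q))) k)
                   (entry (fun q => emb (inr (inr (inl q)))) k)
                   (entry (fun q => emb (inr (inr (inr q)))) k))
      | inr (inl q) => cact (fun q => emb (inr (inl q))) k q
      | inr (inr (inl q)) => cact (fun q => emb (inr (inr (inl q)))) k q
      | inr (inr (inr q)) => cact (fun q => emb (inr (inr (inr q)))) k q
      end
  | CSeq c1 c2 => fun emb k q =>
      match q with
      | inl q => cact (fun q => emb (inl q)) (entry (fun q => emb (inr q)) k) q
      | inr q => cact (fun q => emb (inr q)) k q
      end
  | CWhile t c => fun emb k q =>
      match q with
      | inl _ => IPop t (fun r => branch r k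
                   (entry (fun q => emb (inr q)) (emb (inl tt))) k)
      | inr q => cact (fun q => emb (inr q)) (emb (inl tt)) q
      end
  end.

(** The action [act] is only assumed to agree with the compiled code on the image of [emb], so that
    the induction applies to each subprogram in its surroundings. *)
Lemma exec_sstep (G : finType) (act : G -> instr (G + bool)) c s s' n :
  exec c s s' n ->
  forall (emb : cstates c -> G) (k : G + bool),
    (forall q, act (emb q) = cact (fun q => inl (emb q)) k q) ->
  iter n (sstep act) (entry (fun q => inl (emb q)) k, s) = (k, s').
Proof.
elim=> {c s s' n}.
- by [].
- by move=> t b s emb k H; rewrite /= (H tt).
- move=> t c0 c1 cE s s' n _ IH emb k H; rewrite iterSr /= (H (inl tt)) /=.
  by case: (ohead (get s t)) IH => [[]|] /= IH; apply: IH => q; rewrite H.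
- move=> c0 c1 cE s s' n _ IH emb k H; rewrite iterSr /= (H (inl tt)) /=.
  by case: (ohead (stI s)) IH => [[]|] /= IH; apply: IH => q; rewrite H.
- move=> c1 c2 s s1 s2 n1 n2 _ IH1 _ IH2 emb k H.
  rewrite addnC iterD /= (IH1 (fun q => emb (inl q))) => [|q]; last by rewrite H.
  by apply: (IH2 (fun q => emb (inr q))) => q; rewrite H.
- move=> t c s s1 s2 n1 n2 E _ IH1 _ IH2 emb k H.
  rewrite -addSn addnC iterD iterSr /= (H (inl tt)) /= E /=.
  rewrite (IH1 (fun q => emb (inr q))) => [|q]; last by rewrite H.
  exact: IH2.
- move=> t c s E emb k H; rewrite /= (H (inl tt)) /=.
  by case: (ohead _) E => [[]|].
Qed.

Section Program.
Variable c : cmd.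

Definition pstates : finType := (bool + cstates c)%type.

(* [inl true] is the entry point, [inl false] reads the verdict on top of the stack [TA]. *)
Definition pact (q : pstates) : instr (pstates + bool) :=
  match q with
  | inl true => IPush TC false (entry (fun q => inl (inr q)) (inl (inl false)))
  | inl false => IPop TA (fun r => inr (r == Some true))
  | inr q => cact (fun q => inl (inr q)) (inl (inl false)) q
  end.

Definition program_machine : TM := @machine pstates (inl true) pact.

(** Two instructions surround [c]: a push, which provides a start state even when [c] has no
    instruction, and the pop of the verdict. *)
Lemma program_machine_decides w b l B C I n T :
  exec c (Store [::] [::] [:: false] (rev w)) (Store (b :: l) B C I) n ->
  n.+2 * (8 * (size w + n.+2).+2) + 3 <= T ->
  decides_within program_machine (map bit w) b T.
Proof.
move=> E; apply: (@machine_decides _ (inl true) pact w b n.+2 (Store l B C I)).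
rewrite iterS iterSr [X in iter n _ X]/=.
rewrite (@exec_sstep _ pact _ _ _ _ E (fun q => inr q)) //=.
by case: (b).
Qed.
End Program.

Definition within (c : cmd) (s s' : store) (n : nat) : Prop :=
  exists2 t, t <= n & exec c s s' t.

Lemma within_le c s s' n n' : within c s s' n -> n <= n' -> within c s s' n'.
Proof. by case=> t Ht E H; exists t => //; apply: leq_trans H. Qed.

Lemma within_seq c1 c2 s s1 s2 n1 n2 :
  within c1 s s1 n1 -> within c2 s1 s2 n2 -> within (CSeq c1 c2) s s2 (n1 + n2).
Proof.
by case=> t1 H1 E1 [t2 H2 E2]; exists (t1 + t2); [apply: leq_add | apply: ESeq E1 E2].
Qed.

Lemma within_skip s : within CSkip s s 0.
Proof. by exists 0 => //; apply: ESkip. Qed.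

Lemma within_push t b s : within (CPush t b) s (put s t (b :: get s t)) 1.
Proof. by exists 1 => //; apply: EPush. Qed.

Lemma within_pop t c0 c1 cE s s' n :
  within (branch (ohead (get s t)) c0 c1 cE) (put s t (behead (get s t))) s' n ->
  within (CPop t c0 c1 cE) s s' n.+1.
Proof. by case=> k Hk E; exists k.+1 => //; apply: EPop. Qed.

Lemma within_read c0 c1 cE s s' n :
  within (branch (ohead (stI s)) c0 c1 cE) (put_input s (behead (stI s))) s' n ->
  within (CRead c0 c1 cE) s s' n.+1.
Proof. by case=> k Hk E; exists k.+1 => //; apply: ERead. Qed.

Lemma within_whileT t c s s1 s2 n1 n2 :
  ohead (get s t) = Some true -> within c (put s t (behead (get s t))) s1 n1 ->
  within (CWhile t c) s1 s2 n2 -> within (CWhile t c) s s2 (n1 + n2).+1.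
Proof.
move=> H [t1 H1 E1] [t2 H2 E2]; exists (t1 + t2).+1; first by rewrite ltnS leq_add.
exact: EWhileT E1 E2.
Qed.

Lemma within_whileF t c s : ohead (get s t) <> Some true ->
  within (CWhile t c) s (put s t (behead (get s t))) 1.
Proof. by move=> H; exists 1 => //; apply: EWhileF. Qed.

(** An instruction pushes at most one bit; later this bounds the size of every intermediate result
    by its cost. *)
Lemma exec_ssize c s s' n : exec c s s' n -> ssize s' <= ssize s + n.
Proof.
have P s0 t b : ssize (put s0 t (b :: get s0 t)) <= ssize s0 + 1.
  by rewrite /ssize; case: t => /=; lia.
have Q s0 t : ssize (put s0 t (behead (get s0 t))) <= ssize s0.
  by rewrite /ssize; case: t => /=; rewrite size_behead; lia.
have R s0 : ssize (put_input s0 (behead (stI s0))) <= ssize s0.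
  by rewrite /ssize /= size_behead; lia.
elim=> {c s s' n}.
- by move=> s; rewrite addn0.
- by move=> t b s; apply: P.
- by move=> t c0 c1 cE s s' n _; move: (Q s t); lia.
- by move=> c0 c1 cE s s' n _; move: (R s); lia.
- by move=> *; lia.
- by move=> t c s s1 s2 n1 n2 _ _ H1 _ H2; move: (Q s t); lia.
- by move=> t c s _; move: (Q s t); lia.
Qed.

(** * Programs on trees coded on a stack *)

Inductive tree := Lf | Nd of tree & tree.

(** Preorder code, which is self-delimiting: a tree can be read off the top of a stack whatever lies
    below it. *)
Fixpoint code (x : tree) : seq bool :=
  if x is Nd l r then true :: code l ++ code r else [:: false].

Definition csize (x : tree) : nat := size (code x).

Lemma csizeN l r : csize (Nd l r) = (csize l + csize r).+1.
Proof. by rewrite /csize /= size_cat. Qed.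

Lemma csize_gt0 x : 0 < csize x. Proof. by case: x. Qed.

(** The quantification over the rest of the store is a frame rule; it is what makes programs
    compose. *)
Definition computes (c : cmd) (x y : tree) (n : nat) : Prop :=
  forall A B C I, within c (Store (code x ++ A) B C I) (Store (code y ++ A) B C I) n.

Lemma computes_le c x y n n' : computes c x y n -> n <= n' -> computes c x y n'.
Proof. by move=> H Hn A B C I; apply: within_le Hn. Qed.

Lemma computes_size c x y n : computes c x y n -> csize y <= csize x + n.
Proof.
move=> /(_ [::] [::] [::] [::]) [t Ht] /exec_ssize.
by rewrite /ssize /= !cats0 !addn0 -!/(csize _); lia.
Qed.

(* A [true] flag precedes each symbol, so that a [false] below them delimits a block. *)
Definition flag (l : seq bool) : seq bool := flatten [seq [:: true; b] | b <- l].

Lemma flag_cat l l' : flag (l ++ l') = flag l ++ flag l'.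
Proof. by rewrite /flag map_cat flatten_cat. Qed.

Ltac wpush := apply: within_push.

(** The subtrees still to be read are counted in unary by the [true] bits on [TC]: the loop consumes
    one, and a node puts two back. *)
Definition drop_body := CPop TA CSkip (CSeq (CPush TC true) (CPush TC true)) CSkip.

(** Stated relative to an arbitrary continuation of the loop, so that the induction can chain the
    two subtrees of a node. *)
Lemma within_drop_loop x A B C I s' n :
  within (CWhile TC drop_body) (Store A B C I) s' n ->
  within (CWhile TC drop_body) (Store (code x ++ A) B (true :: C) I) s' (n + 4 * csize x).
Proof.
elim: x A C n => [|l IHl r IHr] A C n H.
  apply: within_le (within_whileT (n1 := 1) _ _ H) _ => //.
    by apply: within_pop => /=; apply: within_skip.
  by rewrite /csize /=; lia.
have H1 := IHl (code r ++ A) (true :: C) _ (IHr A C n H).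
rewrite /= -catA; apply: within_le (within_whileT (n1 := 3) _ _ H1) _ => //.
  apply: within_pop => /=.
  by apply: (within_seq (n1 := 1) (n2 := 1)); [wpush | wpush].
by rewrite csizeN; lia.
Qed.

Definition cdrop := CSeq (CPush TC false) (CSeq (CPush TC true) (CWhile TC drop_body)).

Lemma within_cdrop x A B C I :
  within cdrop (Store (code x ++ A) B C I) (Store A B C I) (4 * csize x + 3).
Proof.
have H : within (CWhile TC drop_body) (Store A B (false :: C) I) (Store A B C I) 1.
  exact: (@within_whileF TC drop_body (Store A B (false :: C) I)).
apply: within_le (within_seq (within_push _ _ _) (within_seq (within_push _ _ _) _)) _;
  first exact: within_drop_loop H.
lia.
Qed.

Definition ab_body :=
  CPop TA (CSeq (CPush TB false) (CPush TB true))
    (CSeq (CSeq (CPush TB true) (CPush TB true)) (CSeq (CPush TC true) (CPush TC true))) CSkip.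

Lemma within_ab_loop x A B C I s' n :
  within (CWhile TC ab_body) (Store A (flag (rev (code x)) ++ B) C I) s' n ->
  within (CWhile TC ab_body) (Store (code x ++ A) B (true :: C) I) s' (n + 6 * csize x).
Proof.
elim: x A B C n => [|l IHl r IHr] A B C n H.
  apply: within_le (within_whileT (n1 := 3) _ _ H) _ => //.
    apply: within_pop => /=.
    by apply: (within_seq (n1 := 1) (n2 := 1)); [wpush | wpush].
  by rewrite /csize /=; lia.
have E : flag (rev (code (Nd l r))) ++ B =
         flag (rev (code r)) ++ flag (rev (code l)) ++ true :: true :: B.
  by rewrite /= rev_cons rev_cat -cats1 !flag_cat -!catA.
rewrite E in H.
have H1 := IHl (code r ++ A) _ (true :: C) _ (IHr A _ C n H).
rewrite /= -catA; apply: within_le (within_whileT (n1 := 5) _ _ H1) _ => //.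
  apply: within_pop => /=.
  apply: (within_seq (n1 := 2) (n2 := 2));
    by apply: (within_seq (n1 := 1) (n2 := 1)); [wpush | wpush].
by rewrite csizeN; lia.
Qed.

Definition cab :=
  CSeq (CPush TB false) (CSeq (CPush TC false) (CSeq (CPush TC true) (CWhile TC ab_body))).

Lemma within_cab x A B C I :
  within cab (Store (code x ++ A) B C I)
    (Store A (flag (rev (code x)) ++ false :: B) C I) (6 * csize x + 4).
Proof.
pose s1 := Store A (flag (rev (code x)) ++ false :: B) (false :: C) I.
have H : within (CWhile TC ab_body) s1 (put s1 TC C) 1.
  exact: (@within_whileF TC ab_body s1).
apply: within_le
 (within_seq (within_push _ _ _) (within_seq (within_push _ _ _) (within_seq (within_push _ _ _) _))) _;
  first exact: within_ab_loop H.
lia.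
Qed.

Definition ba_body := CPop TB (CPush TA false) (CPush TA true) CSkip.

Definition cba := CWhile TB ba_body.

Lemma within_cba l A B C I :
  within cba (Store A (flag l ++ false :: B) C I) (Store (rev l ++ A) B C I) (3 * size l + 1).
Proof.
elim: l A => [|b l IH] A.
  exact: (@within_whileF TB ba_body (Store A (false :: B) C I)).
rewrite rev_cons cat_rcons.
apply: within_le (within_whileT (n1 := 2) _ _ (IH (b :: A))) _ => //.
  by apply: within_pop => /=; case: b {IH}; wpush.
by rewrite /=; lia.
Qed.

Definition bac_body :=
  CPop TB (CSeq (CPush TA false) (CSeq (CPush TC false) (CPush TC true)))
    (CSeq (CPush TA true) (CSeq (CPush TC true) (CPush TC true))) CSkip.

Lemma within_bac l A B C I :
  within (CWhile TB bac_body) (Store A (flag l ++ false :: B) C I)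
    (Store (rev l ++ A) B (flag (rev l) ++ C) I) (5 * size l + 1).
Proof.
elim: l A C => [|b l IH] A C.
  exact: (@within_whileF TB bac_body (Store A (false :: B) C I)).
rewrite rev_cons cat_rcons -cats1 flag_cat -catA.
apply: within_le (within_whileT (n1 := 4) _ _ (IH (b :: A) (true :: b :: C))) _ => //.
  by apply: within_pop => /=; case: b {IH};
    (apply: (within_seq (n1 := 1) (n2 := 2)); first wpush);
    apply: (within_seq (n1 := 1) (n2 := 1)); wpush.
by rewrite /=; lia.
Qed.

Definition cb_body :=
  CPop TC (CSeq (CPush TB false) (CPush TB true)) (CSeq (CPush TB true) (CPush TB true)) CSkip.

Lemma within_cb l A B C I :
  within (CWhile TC cb_body) (Store A B (flag l ++ false :: C) I)
    (Store A (flag (rev l) ++ B) C I) (4 * size l + 1).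
Proof.
elim: l B => [|b l IH] B.
  exact: (@within_whileF TC cb_body (Store A B (false :: C) I)).
rewrite rev_cons -cats1 flag_cat -catA.
apply: within_le (within_whileT (n1 := 3) _ _ (IH (true :: b :: B))) _ => //.
  by apply: within_pop => /=; case: b {IH};
    apply: (within_seq (n1 := 1) (n2 := 1)); wpush.
by rewrite /=; lia.
Qed.

(** Each move between stacks reverses a block. The block goes to [TB] and back to [TA] with a copy
    on [TC]; that copy makes a detour through [TB] to come out in the right order. *)
Definition cdup :=
  CSeq cab (CSeq (CPush TC false) (CSeq (CWhile TB bac_body)
    (CSeq (CPush TB false) (CSeq (CWhile TC cb_body) cba)))).

Lemma within_cdup x A B C I :
  within cdup (Store (code x ++ A) B C I) (Store (code x ++ code x ++ A) B C I)
    (18 * csize x + 9).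
Proof.
apply: within_le.
  apply: within_seq (within_cab _ _ _ _ _) _.
  apply: within_seq (within_push _ _ _) _ => /=.
  apply: within_seq (within_bac _ _ _ _ _) _; rewrite revK.
  apply: within_seq (within_push _ _ _) _ => /=.
  apply: within_seq (within_cb _ _ _ _ _) _.
  have := within_cba (rev (code x)) (code x ++ A) B C I; rewrite revK; exact.
by rewrite !size_rev -!/(csize _); lia.
Qed.

Definition cpair c1 c2 :=
  CSeq cdup (CSeq c1 (CSeq cab (CSeq c2 (CSeq cba (CPush TA true))))).

Lemma computes_pair c1 c2 x y1 y2 n1 n2 :
  computes c1 x y1 n1 -> computes c2 x y2 n2 ->
  computes (cpair c1 c2) x (Nd y1 y2) (30 * (csize x + n1 + n2 + 1)).
Proof.
move=> H1 H2 A B C I; have Hs := computes_size H1.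
apply: within_le.
  apply: within_seq (within_cdup _ _ _ _ _) _.
  apply: within_seq (H1 _ _ _ _) _.
  apply: within_seq (within_cab _ _ _ _ _) _.
  apply: within_seq (H2 _ _ _ _) _.
  apply: within_seq (within_cba _ _ _ _ _) _.
  have := within_push TA true (Store (code y1 ++ code y2 ++ A) B C I).
  by rewrite revK /= -catA; exact.
by rewrite !size_rev -!/(csize _); lia.
Qed.

Lemma computes_seq c1 c2 x y z n1 n2 :
  computes c1 x y n1 -> computes c2 y z n2 -> computes (CSeq c1 c2) x z (n1 + n2).
Proof. by move=> H1 H2 A B C I; apply: within_seq (H1 _ _ _ _) (H2 _ _ _ _). Qed.

Lemma computes_skip x : computes CSkip x x 0.
Proof. by move=> A B C I; apply: within_skip. Qed.

Definition tfst (x : tree) := if x is Nd l _ then l else Lf.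
Definition tsnd (x : tree) := if x is Nd _ r then r else Lf.

Definition cfst := CPop TA (CPush TA false) (CSeq cab (CSeq cdrop cba)) CSkip.
Definition csnd := CPop TA (CPush TA false) cdrop CSkip.

Lemma computes_fst x : computes cfst x (tfst x) (10 * csize x).
Proof.
move=> A B C I; case: x => [|l r].
  apply: within_le; first by apply: within_pop => /=; wpush.
  by rewrite /csize.
apply: within_le.
  apply: within_pop => /=; rewrite -catA.
  apply: (within_seq (within_cab _ _ _ _ _) (within_seq (within_cdrop _ _ _ _ _) _)).
  have := within_cba (rev (code l)) A B C I; rewrite revK; exact.
by rewrite !size_rev csizeN -!/(csize _); move: (csize_gt0 l) (csize_gt0 r); lia.
Qed.

Lemma computes_snd x : computes csnd x (tsnd x) (5 * csize x).
Proof.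
move=> A B C I; case: x => [|l r].
  apply: within_le; first by apply: within_pop => /=; wpush.
  by rewrite /csize.
apply: within_le.
  by apply: within_pop => /=; rewrite -catA; apply: within_cdrop.
by rewrite csizeN; lia.
Qed.

Definition cpushes (l : seq bool) : cmd := foldr (fun b c => CSeq c (CPush TA b)) CSkip l.

Lemma within_cpushes l A B C I :
  within (cpushes l) (Store A B C I) (Store (l ++ A) B C I) (size l).
Proof.
elim: l => [|b l IH] /=; first exact: within_skip.
by rewrite -addn1; apply: within_seq IH _; wpush.
Qed.

Definition cconst (y : tree) := CSeq cdrop (cpushes (code y)).

Lemma computes_const x y : computes (cconst y) x y (4 * csize x + 3 + csize y).
Proof.
by move=> A B C I; apply: within_seq (within_cdrop _ _ _ _ _) (within_cpushes _ _ _ _ _).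
Qed.

Definition tbool (b : bool) := if b then Nd Lf Lf else Lf.

(** The popped bit is the root of the code of the boolean; if it is [true], the two leaves of
    [tbool true] remain to be dropped. *)
Definition cif c c1 c2 :=
  CSeq cdup (CSeq c (CPop TA c2 (CSeq cdrop (CSeq cdrop c1)) CSkip)).

Lemma computes_if (b : bool) c c1 c2 x y n n' :
  computes c x (tbool b) n -> computes (if b then c1 else c2) x y n' ->
  computes (cif c c1 c2) x y (18 * csize x + n + n' + 30).
Proof.
move=> H H' A B C I.
apply: within_le.
  apply: (within_seq (within_cdup _ _ _ _ _) (within_seq (H _ _ _ _) _)).
  apply: (within_pop (n := 14 + n')) => /=; case: b H' {H} => H' /=.
    apply: within_le.
      apply: within_seq (@within_cdrop Lf _ _ _ _) (within_seq (@within_cdrop Lf _ _ _ _) _).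
      exact: H'.
    by rewrite /csize /=; lia.
  by apply: within_le; [exact: H' | lia].
by lia.
Qed.

Definition loop_body c :=
  CPop TA CSkip
    (CPop TA (CSeq (CSeq (CPush TA false) (CPush TA true)) (CPush TC false))
       (CSeq (CSeq (CPush TA true) (CPush TA true)) (CSeq c (CPush TC true))) CSkip) CSkip.

Definition cloop c := CSeq (CPush TC true) (CWhile TC (loop_body c)).

(* [cloop c] iterates [c] while the left component of the value is a node. *)
Lemma within_loop c (x : nat -> tree) n k A B C I :
  (forall i, i < k -> if x i is Nd (Nd _ _) _ then True else False) ->
  (forall i, i < k -> computes c (x i) (x i.+1) n) ->
  (exists r, x k = Nd Lf r) ->
  within (CWhile TC (loop_body c)) (Store (code (x 0) ++ A) B (true :: C) I)
     (Store (code (x k) ++ A) B C I) (k * (n + 6) + 8).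
Proof.
elim: k x => [|k IH] x H1 H2 H3.
  case: H3 => r /= ->.
  apply: within_le.
    apply: (@within_whileT TC _ _ (Store (code (Nd Lf r) ++ A) B (false :: C) I) _ 5) => //.
    + apply: within_pop => /=; apply: within_pop => /=.
      apply: (within_seq (n1 := 2) (n2 := 1)).
        by apply: (within_seq (n1 := 1) (n2 := 1)); wpush.
      by wpush.
    + exact: within_whileF.
  by lia.
have := H1 0 isT; have := H2 0 isT.
case Ex : (x 0) => [|[|l1 l2] r] // Hc _.
apply: within_le.
  apply: (@within_whileT TC _ _ (Store (code (x 1) ++ A) B (true :: C) I) _ (n + 5)) => //.
    apply: within_le.
      apply: within_pop => /=; apply: within_pop => /=.
      apply: (within_seq (n1 := 2)).
        by apply: (within_seq (n1 := 1) (n2 := 1)); wpush.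
      by apply: within_seq; [exact: Hc | wpush].
    by lia.
  by apply: (IH (fun i => x i.+1)) => // i Hi; [apply: H1 | apply: H2].
by lia.
Qed.

Lemma computes_loop c (x : nat -> tree) n k :
  (forall i, i < k -> if x i is Nd (Nd _ _) _ then True else False) ->
  (forall i, i < k -> computes c (x i) (x i.+1) n) ->
  (exists r, x k = Nd Lf r) ->
  computes (cloop c) (x 0) (x k) (k * (n + 6) + 9).
Proof.
move=> H1 H2 H3 A B C I.
apply: within_le.
  by apply: within_seq; [wpush | exact: within_loop H1 H2 H3].
lia.
Qed.

(** * Polynomial-time functions *)

Class data (T : Type) := enc : T -> tree.

Fixpoint enc_seq (T : Type) (e : T -> tree) (l : seq T) : tree :=
  if l is x :: l' then Nd (e x) (enc_seq e l') else Lf.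

#[export] Instance data_unit : data unit := fun _ => Lf.
#[export] Instance data_bool : data bool := tbool.
Fixpoint enc_nat (n : nat) : tree := if n is n'.+1 then Nd Lf (enc_nat n') else Lf.
#[export] Instance data_nat : data nat := enc_nat.
#[export] Instance data_seq T (_ : data T) : data (seq T) := enc_seq enc.
#[export] Instance data_prod T U (_ : data T) (_ : data U) : data (T * U) :=
  fun x => Nd (enc x.1) (enc x.2).

Definition dsize T {_ : data T} (x : T) : nat := csize (enc x).

Lemma dsize_pair T U {_ : data T} {_ : data U} (x : T * U) :
  dsize x = (dsize x.1 + dsize x.2).+1.
Proof. by case: x => x y; rewrite /dsize csizeN. Qed.

Lemma dsize_cons T {_ : data T} (x : T) (l : seq T) : dsize (x :: l) = (dsize x + dsize l).+1.
Proof. by rewrite /dsize csizeN. Qed.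

Lemma dsize_nil T {_ : data T} : dsize (@nil T) = 1. Proof. by []. Qed.

Lemma dsize_gt0 T {_ : data T} (x : T) : 0 < dsize x. Proof. exact: csize_gt0. Qed.

Lemma dsize_nat (n : nat) : dsize n = n.*2.+1.
Proof. by elim: n => // n IH; rewrite /dsize csizeN -/(enc n) -/(dsize n) IH. Qed.

Lemma enc_nseq (n : nat) : enc (nseq n tt) = enc n.
Proof. by elim: n => // n IH; exact: (congr1 (Nd Lf) IH). Qed.

Lemma dsize_bool (b : bool) : dsize b <= 3. Proof. by case: b. Qed.

Lemma dsize_cat T {_ : data T} (l l' : seq T) : (dsize (l ++ l')).+1 = dsize l + dsize l'.
Proof. by elim: l => //= x l IH; rewrite !dsize_cons; lia. Qed.

Lemma size_dsize T {_ : data T} (l : seq T) : size l <= dsize l.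
Proof. by elim: l => //= x l IH; rewrite dsize_cons; lia. Qed.

Lemma dsize_take T {_ : data T} i (l : seq T) : dsize (take i l) <= dsize l.
Proof.
pose proof (dsize_cat (take i l) (drop i l)) as H; rewrite cat_take_drop in H.
pose proof (dsize_gt0 (drop i l)); lia.
Qed.

Lemma dsize_drop T {_ : data T} i (l : seq T) : dsize (drop i l) <= dsize l.
Proof.
pose proof (dsize_cat (take i l) (drop i l)) as H; rewrite cat_take_drop in H.
pose proof (dsize_gt0 (take i l)); lia.
Qed.

(** Bases are at least 2, so that constant factors and sums are absorbed by the exponent. *)
Definition poly A (b n : A -> nat) : Prop := exists d, forall a, n a <= b a ^ d.


Lemma leq_exp_base m n e : m <= n -> m ^ e <= n ^ e.
Proof. by move=> H; case: e => // e; rewrite leq_exp2r. Qed.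

Section Poly.
Variables (A : Type) (b : A -> nat).
Hypothesis b_ge2 : forall a, 1 < b a.

Lemma poly_le n n' : poly b n' -> (forall a, n a <= n' a) -> poly b n.
Proof. by case=> d H H'; exists d => a; apply: leq_trans (H' a) (H a). Qed.

Lemma poly_const k : poly b (fun=> k).
Proof.
exists k => a; apply: ltnW; apply: leq_trans (ltn_expl k (ltnSn 1)) _.
exact: leq_exp_base.
Qed.

Lemma poly_self : poly b b.
Proof. by exists 1 => a; rewrite expn1. Qed.

Lemma poly_add n1 n2 : poly b n1 -> poly b n2 -> poly b (fun a => n1 a + n2 a).
Proof.
case=> d1 H1 [d2 H2]; exists (d1 + d2).+1 => a.
have Hb : 0 < b a by apply: ltnW.
rewrite expnS; apply: leq_trans (leq_mul (b_ge2 a) (leqnn _)).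
rewrite mul2n -addnn; apply: leq_add.
  by apply: leq_trans (H1 a) _; rewrite leq_pexp2l // leq_addr.
by apply: leq_trans (H2 a) _; rewrite leq_pexp2l // leq_addl.
Qed.

Lemma poly_mul n1 n2 : poly b n1 -> poly b n2 -> poly b (fun a => n1 a * n2 a).
Proof. by case=> d1 H1 [d2 H2]; exists (d1 + d2) => a; rewrite expnD leq_mul. Qed.

Lemma poly_exp n k : poly b n -> poly b (fun a => n a ^ k).
Proof. by case=> d H; exists (d * k) => a; rewrite expnM; apply: leq_exp_base. Qed.

Lemma poly_comp (A' : Type) (b' n' : A' -> nat) (h : A -> A') :
  poly b' n' -> poly b (fun a => b' (h a)) -> poly b (fun a => n' (h a)).
Proof. by case=> d H /(poly_exp d) H'; apply: poly_le H' _. Qed.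
End Poly.

Definition bud A {_ : data A} (beta : A -> nat) (a : A) : nat := beta a + dsize a + 2.

Lemma bud_ge2 A {_ : data A} (beta : A -> nat) a : 1 < bud beta a.
Proof. by rewrite /bud; lia. Qed.
#[export] Hint Resolve bud_ge2 : core.

Lemma poly_dsize A {dA : data A} (beta : A -> nat) : poly (bud beta) (fun a => dsize a).
Proof. by exists 1 => a; rewrite expn1 /bud; lia. Qed.

Lemma poly_beta A {dA : data A} (beta : A -> nat) : poly (bud beta) beta.
Proof. by exists 1 => a; rewrite expn1 /bud; lia. Qed.

Ltac poly_tac :=
  lazymatch goal with
  | |- poly _ (fun a => _ + _) => apply: poly_add; [by [] | poly_tac | poly_tac]
  | |- poly _ (fun a => _ * _) => apply: poly_mul; poly_tac
  | |- poly _ (fun a => _ ^ _) => apply: poly_exp; poly_tac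
  | |- _ => first [assumption | by apply: poly_const | apply: poly_dsize | apply: poly_beta]
  end.

(* [PT beta f]: the function [f] is computable in time polynomial in the size of its
   argument and in the budget [beta]. *)
Definition PT A B {_ : data A} {_ : data B} (beta : A -> nat) (f : A -> B) : Prop :=
  exists c n, poly (bud beta) n /\ forall a, computes c (enc a) (enc (f a)) (n a).

Section PTbase.
Context {A : Type} {dA : data A} (beta : A -> nat).

Lemma PT_poly_size B {dB : data B} (f : A -> B) :
  PT beta f -> poly (bud beta) (fun a => dsize (f a)).
Proof.
case=> c [n [Hn H]]; apply: (@poly_le _ _ _ (fun a => dsize a + n a)).
  by apply: poly_add => //; apply: poly_dsize.
by move=> a; apply: computes_size (H a).
Qed.

Lemma PT_ext B {dB : data B} (f g : A -> B) : f =1 g -> PT beta f -> PT beta g.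
Proof. by move=> E [c [n [Hn H]]]; exists c, n; split => // a; rewrite -E. Qed.

Lemma PT_enc B B' {dB : data B} {dB' : data B'} (f : A -> B) (g : A -> B') :
  (forall a, enc (f a) = enc (g a)) -> PT beta f -> PT beta g.
Proof. by move=> E [c [n [Hn H]]]; exists c, n; split => // a; rewrite -E. Qed.

Lemma PT_id : PT beta (fun a => a).
Proof. exists CSkip, (fun=> 0); split; [exact: poly_const | move=> a; exact: computes_skip]. Qed.

Lemma PT_const B {dB : data B} (y : B) : PT beta (fun=> y).
Proof.
exists (cconst (enc y)), (fun a => 4 * dsize a + 3 + dsize y); split.
  by poly_tac.
by move=> a; apply: computes_const.
Qed.

Lemma PT_pair B B' {dB : data B} {dB' : data B'} (f : A -> B) (g : A -> B') :
  PT beta f -> PT beta g -> PT beta (fun a => (f a, g a)).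
Proof.
move=> [c1 [n1 [Hn1 H1]]] [c2 [n2 [Hn2 H2]]].
exists (cpair c1 c2), (fun a => 30 * (dsize a + n1 a + n2 a + 1)); split.
  by poly_tac.
by move=> a; apply: computes_pair.
Qed.

Lemma PT_comp B C {dB : data B} {dC : data C} (gamma : B -> nat) (f : A -> B) (g : B -> C) :
  PT gamma g -> PT beta f -> poly (bud beta) (fun a => gamma (f a)) ->
  PT beta (fun a => g (f a)).
Proof.
move=> [c2 [n2 [Hn2 H2]]] Hf Hg; have Hs := PT_poly_size Hf.
case: Hf => [c1 [n1 [Hn1 H1]]].
exists (CSeq c1 c2), (fun a => n1 a + n2 (f a)); split.
  apply: poly_add => //.
  apply: (@poly_comp _ _ _ (bud gamma)) => //; rewrite {2}/bud.
  by poly_tac.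
by move=> a; apply: computes_seq.
Qed.

Lemma PT_comp0 B C {dB : data B} {dC : data C} (f : A -> B) (g : B -> C) :
  PT (fun=> 0) g -> PT beta f -> PT beta (fun a => g (f a)).
Proof. by move=> Hg Hf; apply: (PT_comp Hg Hf); apply: poly_const. Qed.

Lemma PT_tree B {dB : data B} (f : A -> B) c (phi : tree -> tree) k :
  (forall x, computes c x (phi x) (k * csize x)) ->
  (forall a, enc (f a) = phi (enc a)) -> PT beta f.
Proof.
move=> H E; exists c, (fun a => k * dsize a); split.
  by poly_tac.
by move=> a; rewrite E; apply: H.
Qed.

Lemma PT_if B {dB : data B} (p : A -> bool) (f g : A -> B) :
  PT beta p -> PT beta f -> PT beta g -> PT beta (fun a => if p a then f a else g a).
Proof.
move=> [c [n [Hn H]]] [c1 [n1 [Hn1 H1]]] [c2 [n2 [Hn2 H2]]].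
exists (cif c c1 c2), (fun a => 18 * dsize a + n a + (n1 a + n2 a) + 30); split.
  by poly_tac.
move=> a; apply: (@computes_if (p a)); first exact: H.
by case: (p a); [apply: computes_le (H1 a) _ | apply: computes_le (H2 a) _]; lia.
Qed.
End PTbase.

Lemma PT0_fst A B {dA : data A} {dB : data B} beta : PT beta (fun x : A * B => x.1).
Proof. exact: (@PT_tree _ _ _ _ _ _ _ _ _ computes_fst). Qed.

Lemma PT0_snd A B {dA : data A} {dB : data B} beta : PT beta (fun x : A * B => x.2).
Proof. exact: (@PT_tree _ _ _ _ _ _ _ _ _ computes_snd). Qed.

Section PTfold.
Context {A E X : Type} {dA : data A} {dE : data E} {dX : data X} (beta : A -> nat).

(** The loop state is [Nd rest (Nd acc env)]: the remaining list is the left component, the one that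
    [cloop] tests. *)
Definition fold_cmd (ch : cmd) : cmd :=
  cpair (CSeq cfst csnd)
   (cpair (CSeq (cpair (CSeq csnd csnd) (cpair (CSeq csnd cfst) (CSeq cfst cfst))) ch)
          (CSeq csnd csnd)).

Definition fold_cost (k n : nat) : nat :=
  30 * (k + 20 * k +
    30 * (k + (30 * (k + 10 * k + 30 * (k + 15 * k + 20 * k + 1) + 1) + n) + 10 * k + 1) + 1).

Lemma poly_fold_cost B (b k n : B -> nat) : (forall a, 1 < b a) ->
  poly b k -> poly b n -> poly b (fun a => fold_cost (k a) (n a)).
Proof. by move=> Hb Hk Hn; rewrite /fold_cost; poly_tac. Qed.

Lemma computes_fold_cmd ch l1 l2 acc env y n :
  computes ch (Nd env (Nd acc l1)) y n ->
  computes (fold_cmd ch) (Nd (Nd l1 l2) (Nd acc env)) (Nd l2 (Nd y env))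
    (fold_cost (csize (Nd (Nd l1 l2) (Nd acc env))) n).
Proof.
set x := Nd (Nd l1 l2) (Nd acc env) => H.
have Hss : computes (CSeq csnd csnd) x env (10 * csize x).
  apply: computes_le (computes_seq (computes_snd _) (computes_snd _)) _.
  by rewrite /x /= !csizeN; lia.
have Hsf : computes (CSeq csnd cfst) x acc (15 * csize x).
  apply: computes_le (computes_seq (computes_snd _) (computes_fst _)) _.
  by rewrite /x /= !csizeN; lia.
have Hff : computes (CSeq cfst cfst) x l1 (20 * csize x).
  apply: computes_le (computes_seq (computes_fst _) (computes_fst _)) _.
  by rewrite /x /= !csizeN; lia.
have Hfs : computes (CSeq cfst csnd) x l2 (20 * csize x).
  apply: computes_le (computes_seq (computes_fst _) (computes_snd _)) _.
  by rewrite /x /= !csizeN; lia.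
exact: (computes_pair Hfs
  (computes_pair (computes_seq (computes_pair Hss (computes_pair Hsf Hff)) H) Hss)).
Qed.

(** The accumulator must stay small along every prefix: a polynomial-time step that squares the
    size, say, cannot be repeated polynomially often. *)
Lemma PT_foldl (h : A -> X -> E -> X) (x0 : A -> X) (l : A -> seq E) (m : A -> nat) :
  PT beta l -> PT beta x0 ->
  PT (fun y : A * (X * E) => beta y.1) (fun y => h y.1 y.2.1 y.2.2) ->
  poly (bud beta) m ->
  (forall a i, dsize (foldl (h a) (x0 a) (take i (l a))) <= m a) ->
  PT beta (fun a => foldl (h a) (x0 a) (l a)).
Proof.
move=> Hl Hx [ch [nh [Hnh Hh]]] Hm Hb.
have Hz := PT_pair Hl (PT_pair Hx (PT_id beta)).
have Hls := PT_poly_size Hl.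
case: Hz => [cz [nz [Hnz Hz]]].
pose (st := fun a i =>
  Nd (enc (drop i (l a))) (Nd (enc (foldl (h a) (x0 a) (take i (l a)))) (enc a))).
have {Hnh} [d Hd] := Hnh.
(* Cost of one step: its argument consists of [a], the accumulator and a list element, of sizes at
   most [dsize a], [m a] and [dsize (l a)]. *)
pose (H := fun a => (beta a + (dsize a + m a + dsize (l a) + 2) + 2) ^ d).
have HpH : poly (bud beta) H.
  rewrite /H; by poly_tac.
pose (n := fun a => fold_cost (dsize (l a) + m a + dsize a + 2) (H a)).
exists (CSeq cz (CSeq (cloop (fold_cmd ch)) (CSeq csnd cfst))).
exists (fun a => nz a + ((dsize (l a) * (n a + 6) + 9) + 20 * (dsize (l a) + m a + dsize a + 2))).
split.
  
  have Hn : poly (bud beta) n by apply: poly_fold_cost => //; poly_tac.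
  by poly_tac.
move=> a; apply: computes_seq (Hz a) _.
have -> : enc (l a, (x0 a, a)) = st a 0 by rewrite /st drop0 take0.
pose proof (size_dsize (l a)) as Hk.
have Hst i : csize (st a i) <= dsize (l a) + m a + dsize a + 2.
  pose proof (dsize_drop i (l a)) as H1; move: H1 (Hb a i).
  by rewrite /st !csizeN /dsize; lia.
have Hend : computes (cloop (fold_cmd ch)) (st a 0) (st a (size (l a)))
             (dsize (l a) * (n a + 6) + 9).
  apply: computes_le (@computes_loop _ _ (n a) _ _ _ _) _.
  - move=> i Hi; rewrite /st; case El: (drop i (l a)) => [|e l'] //.
    by move: (size_drop i (l a)); rewrite El /=; lia.
  - move=> i Hi; case El: (drop i (l a)) => [|e l'].
      by move: (size_drop i (l a)); rewrite El /=; lia.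
    have Et : take i.+1 (l a) = rcons (take i (l a)) e.
      by rewrite -addn1 takeD El /= take0 cats1.
    have Ed : drop i.+1 (l a) = l' by rewrite -addn1 addnC -drop_drop El /= drop0.
    rewrite /st Et Ed El foldl_rcons.
    set acc := foldl _ _ _.
    apply: computes_le (computes_fold_cmd _ _) _.
    + exact: (Hh (a, (acc, e))).
    + have Hfc k k' j j' : k <= k' -> j <= j' -> fold_cost k j <= fold_cost k' j'.
        by rewrite /fold_cost; lia.
      apply: Hfc; first by have := Hst i; rewrite /st El.
      apply: leq_trans (Hd _) _; apply: leq_exp_base.
      rewrite /bud /= !dsize_pair /=.
      pose proof (dsize_drop i (l a)) as H1; move: H1 (Hb a i); rewrite El dsize_cons -/acc; lia.
  - by rewrite /st drop_size; eexists.
  - by rewrite leq_add2r leq_mul2r Hk orbT.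
apply: computes_seq Hend _.
have -> : enc (foldl (h a) (x0 a) (l a)) = tfst (tsnd (st a (size (l a)))).
  by rewrite /st take_size.
apply: computes_le (computes_seq (computes_snd _) (computes_fst _)) _.
by move: (Hst (size (l a))); rewrite /st csizeN /=; lia.
Qed.
End PTfold.

(** * Polynomial-time functions on lists and unary numbers *)

#[export] Instance data_tree : data tree := id.

(** [Lf] encodes both [[::]] and 0, so that one test serves for emptiness and for zero. *)
Definition is_leaf (x : tree) : bool := if x is Lf then true else false.

Definition cleaf :=
  CPop TA (cpushes (code (tbool true)))
    (CSeq cdrop (CSeq cdrop (cpushes (code (tbool false))))) CSkip.

Lemma computes_leaf x : computes cleaf x (tbool (is_leaf x)) (10 * csize x).
Proof.
move=> A B C I; case: x => [|l r].
  apply: within_le; first by apply: within_pop => /=; apply: (within_cpushes (code (tbool true))).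
  by [].
apply: within_le.
  apply: within_pop; rewrite [branch _ _ _ _]/= [put _ _ _]/= -catA.
  apply: within_seq (within_cdrop _ _ _ _ _) (within_seq (within_cdrop _ _ _ _ _) _).
  exact: (within_cpushes (code (tbool false))).
by move: (csize_gt0 l) (csize_gt0 r); rewrite csizeN /=; lia.
Qed.

Section Basics.
Context {A : Type} {dA : data A} (beta : A -> nat).

Lemma PT_fst B C {dB : data B} {dC : data C} (f : A -> B * C) :
  PT beta f -> PT beta (fun a => (f a).1).
Proof. by apply: PT_comp0; apply: PT0_fst. Qed.

Lemma PT_snd B C {dB : data B} {dC : data C} (f : A -> B * C) :
  PT beta f -> PT beta (fun a => (f a).2).
Proof. by apply: PT_comp0; apply: PT0_snd. Qed.

Lemma PT_cons B {dB : data B} (f : A -> B) (l : A -> seq B) :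
  PT beta f -> PT beta l -> PT beta (fun a => f a :: l a).
Proof. by move=> Hf Hl; apply: (PT_enc _ (PT_pair Hf Hl)). Qed.

Lemma PT_S (f : A -> nat) : PT beta f -> PT beta (fun a => (f a).+1).
Proof. by move=> Hf; apply: (PT_enc _ (PT_pair (PT_const beta tt) Hf)). Qed.

Lemma PT_tsnd B C {dB : data B} {dC : data C} (f : A -> B) (g : A -> C) :
  (forall a, enc (g a) = tsnd (enc (f a))) -> PT beta f -> PT beta g.
Proof.
move=> E Hf; have H0 : PT (fun=> 0) tsnd by apply: (PT_tree _ computes_snd).
by apply: (@PT_enc _ _ _ _ _ _ _ (fun a => tsnd (enc (f a)))) => //; apply: (PT_comp0 H0).
Qed.

Lemma PT_pred (f : A -> nat) : PT beta f -> PT beta (fun a => (f a).-1).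
Proof. by apply: PT_tsnd => a; case: (f a). Qed.

Lemma PT_behead B {dB : data B} (l : A -> seq B) :
  PT beta l -> PT beta (fun a => behead (l a)).
Proof. by apply: PT_tsnd => a; case: (l a). Qed.

Lemma PT_is_leaf B {dB : data B} (f : A -> B) :
  PT beta f -> PT beta (fun a => is_leaf (enc (f a))).
Proof.
have H0 : PT (fun=> 0) is_leaf by apply: (PT_tree _ computes_leaf).
by move=> Hf; apply: (PT_comp0 H0).
Qed.

Lemma PT_head B {dB : data B} (x : A -> B) (l : A -> seq B) :
  PT beta x -> PT beta l -> PT beta (fun a => head (x a) (l a)).
Proof.
move=> Hx Hl.
have H0 : PT (fun=> 0) tfst by apply: (PT_tree _ computes_fst).
apply: (@PT_enc _ _ _ _ _ _ _
  (fun a => if is_leaf (enc (l a)) then enc (x a) else tfst (enc (l a)))).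
  by move=> a; case: (l a).
apply: PT_if; first exact: PT_is_leaf.
  exact: Hx.
by apply: (PT_comp0 H0).
Qed.

Lemma PT_negb (f : A -> bool) : PT beta f -> PT beta (fun a => ~~ f a).
Proof. by move=> Hf; apply: (PT_if Hf); apply: PT_const. Qed.

Lemma PT_andb (f g : A -> bool) : PT beta f -> PT beta g -> PT beta (fun a => f a && g a).
Proof. by move=> Hf Hg; apply: (PT_if Hf) => //; apply: PT_const. Qed.

Lemma PT_orb (f g : A -> bool) : PT beta f -> PT beta g -> PT beta (fun a => f a || g a).
Proof. by move=> Hf Hg; apply: (PT_if Hf) => //; apply: PT_const. Qed.

Lemma poly_sum E {dE : data E} (g : A * E -> nat) (l : A -> seq E) :
  PT beta l -> poly (bud (fun y : A * E => beta y.1)) g ->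
  poly (bud beta) (fun a => sumn [seq g (a, e) | e <- l a]).
Proof.
move=> /PT_poly_size Hl [d Hd].
pose (n := fun a => dsize (l a) * (beta a + (dsize a + dsize (l a) + 1) + 2) ^ d).
apply: (@poly_le _ _ _ n).
  by rewrite /n; poly_tac.
move=> a; rewrite /n.
have: forall (s : seq E), dsize s <= dsize (l a) ->
  sumn [seq g (a, e) | e <- s] <= dsize s * (beta a + (dsize a + dsize (l a) + 1) + 2) ^ d.
  elim=> [|e s IH] //; rewrite dsize_cons /= => H.
  rewrite -addSn mulnDl; apply: leq_add; last by apply: IH; lia.
  rewrite mulSn; apply: leq_trans (leq_addr _ _); apply: leq_trans (Hd _) _.
  by apply: leq_exp_base; rewrite /bud dsize_pair /=; lia.
by apply.
Qed.

(** The usual way to meet the size condition of [PT_foldl]: the growth at each step does not depend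
    on the accumulator. *)
Lemma PT_foldl_add E X {dE : data E} {dX : data X} (h : A -> X -> E -> X) (x0 : A -> X)
    (l : A -> seq E) (g : A * E -> nat) :
  PT beta l -> PT beta x0 ->
  PT (fun y : A * (X * E) => beta y.1) (fun y => h y.1 y.2.1 y.2.2) ->
  poly (bud (fun y : A * E => beta y.1)) g ->
  (forall a x e, dsize (h a x e) <= dsize x + g (a, e)) ->
  PT beta (fun a => foldl (h a) (x0 a) (l a)).
Proof.
move=> Hl Hx Hh Hg H.
apply: (PT_foldl (m := fun a => dsize (x0 a) + sumn [seq g (a, e) | e <- l a])) => //.
  by apply: poly_add => //; [apply: PT_poly_size | apply: poly_sum].
have Hs a s x : dsize (foldl (h a) x s) <= dsize x + sumn [seq g (a, e) | e <- s].
  elim: s x => [|e s IH] x /=; first by rewrite addn0.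
  by apply: leq_trans (IH _) _; move: (H a x e); lia.
move=> a i; apply: leq_trans (Hs _ _ _) _; rewrite leq_add2l.
rewrite -{2}(cat_take_drop i (l a)) map_cat sumn_cat; lia.
Qed.

End Basics.

Lemma PT_rev A {dA : data A} (beta : A -> nat) B {dB : data B} (l : A -> seq B) : PT beta l -> PT beta (fun a => rev (l a)).
Proof.
move=> Hl; apply: (@PT_ext _ _ _ _ _ (fun a => foldl (fun s x => x :: s) [::] (l a))).
  by move=> a; rewrite /rev; elim: (l a) [::] => //=.
apply: (PT_foldl_add (h := (fun _ s x => x :: s))
          (g := (fun y => (dsize y.2).+1))) => //.
- exact: PT_const.
- by apply: PT_cons; [apply: PT_snd; apply: PT_snd; apply: PT_id
                     |apply: PT_fst; apply: PT_snd; apply: PT_id].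
- apply: (poly_le (poly_dsize _)) => y; rewrite dsize_pair; lia.
- by move=> a x e; rewrite dsize_cons /=; lia.
Qed.

Lemma PT_cat A {dA : data A} (beta : A -> nat) B {dB : data B} (l l' : A -> seq B) :
  PT beta l -> PT beta l' -> PT beta (fun a => l a ++ l' a).
Proof.
move=> /PT_rev Hl Hl'.
apply: (@PT_ext _ _ _ _ _ (fun a => foldl (fun s x => x :: s) (l' a) (rev (l a)))).
  by move=> a; rewrite foldl_rev; elim: (l a) => //= x s ->.
apply: (PT_foldl_add (h := (fun _ s x => x :: s))
          (g := (fun y => (dsize y.2).+1))) => //.
- by apply: PT_cons; [apply: PT_snd; apply: PT_snd; apply: PT_id
                     |apply: PT_fst; apply: PT_snd; apply: PT_id].
- apply: (poly_le (poly_dsize _)) => y; rewrite dsize_pair; lia.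
- by move=> a x e; rewrite dsize_cons /=; lia.
Qed.

Lemma PT_map A {dA : data A} (beta : A -> nat) B E {dB : data B} {dE : data E} (h : A -> E -> B) (l : A -> seq E) :
  PT beta l -> PT (fun y : A * E => beta y.1) (fun y => h y.1 y.2) ->
  PT beta (fun a => map (h a) (l a)).
Proof.
move=> Hl Hh.
apply: (@PT_ext _ _ _ _ _ (fun a => rev (foldl (fun s x => h a x :: s) [::] (l a)))).
  move=> a; rewrite -(revK (map _ _)); congr rev.
  have: forall s t, foldl (fun s x => h a x :: s) t s = rev (map (h a) s) ++ t.
    by elim=> //= x s IH t; rewrite IH rev_cons cat_rcons.
  by move=> ->; rewrite cats0.
apply: PT_rev.
apply: (PT_foldl_add (h := (fun a s x => h a x :: s))
          (g := (fun y => dsize (h y.1 y.2) + 1))) => //.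
- exact: PT_const.
- apply: PT_cons; last by apply: PT_fst; apply: PT_snd; apply: PT_id.
  apply: (@PT_comp _ _ _ _ _ _ _ _ (fun y : A * (seq B * E) => (y.1, y.2.2)) _ Hh).
    apply: PT_pair; first by apply: PT_fst; apply: PT_id.
    by apply: PT_snd; apply: PT_snd; apply: PT_id.
  exact: (@poly_beta _ _ (fun y : A * (seq B * E) => beta y.1)).
- by apply: poly_add => //; [apply: PT_poly_size | apply: poly_const].
- by move=> a x e; rewrite dsize_cons /=; lia.
Qed.

Lemma PT_filter A {dA : data A} (beta : A -> nat) E {dE : data E} (h : A -> E -> bool) (l : A -> seq E) :
  PT beta l -> PT (fun y : A * E => beta y.1) (fun y => h y.1 y.2) ->
  PT beta (fun a => filter (h a) (l a)).
Proof.
move=> Hl Hh.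
apply: (@PT_ext _ _ _ _ _
  (fun a => rev (foldl (fun s x => if h a x then x :: s else s) [::] (l a)))).
  move=> a; rewrite -(revK (filter _ _)); congr rev.
  have: forall s t, foldl (fun s x => if h a x then x :: s else s) t s =
                    rev (filter (h a) s) ++ t.
    by elim=> //= x s IH t; rewrite IH; case: ifP => //; rewrite rev_cons cat_rcons.
  by move=> ->; rewrite cats0.
apply: PT_rev.
apply: (PT_foldl_add (h := (fun a s x => if h a x then x :: s else s))
          (g := (fun y => (dsize y.2).+1))) => //.
- exact: PT_const.
- apply: PT_if; last by apply: PT_fst; apply: PT_snd; apply: PT_id.
    apply: (@PT_comp _ _ _ _ _ _ _ _ (fun y : A * (seq E * E) => (y.1, y.2.2)) _ Hh).
      apply: PT_pair; first by apply: PT_fst; apply: PT_id.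
      by apply: PT_snd; apply: PT_snd; apply: PT_id.
    exact: (@poly_beta _ _ (fun y : A * (seq E * E) => beta y.1)).
  by apply: PT_cons; [apply: PT_snd; apply: PT_snd; apply: PT_id
                     |apply: PT_fst; apply: PT_snd; apply: PT_id].
- apply: (poly_le (poly_dsize _)) => y; rewrite dsize_pair; lia.
- by move=> a x e; case: ifP => _; rewrite ?dsize_cons /=; lia.
Qed.

Lemma PT_size A {dA : data A} (beta : A -> nat) E {dE : data E} (l : A -> seq E) : PT beta l -> PT beta (fun a => size (l a)).
Proof.
move=> Hl; apply: (@PT_ext _ _ _ _ _ (fun a => foldl (fun s x => s.+1) 0 (l a))).
  move=> a; rewrite -[RHS]addn0; elim: (l a) 0 => //= x s IH k; by rewrite IH addnS.
apply: (PT_foldl_add (h := (fun a s x => s.+1))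
          (g := (fun y => 2))) => //.
- exact: PT_const.
- by apply: PT_S; apply: PT_fst; apply: PT_snd; apply: PT_id.
- exact: poly_const.
- by move=> a x e; rewrite !dsize_nat; lia.
Qed.

Lemma PT_has A {dA : data A} (beta : A -> nat) E {dE : data E} (h : A -> E -> bool) (l : A -> seq E) :
  PT beta l -> PT (fun y : A * E => beta y.1) (fun y => h y.1 y.2) ->
  PT beta (fun a => has (h a) (l a)).
Proof.
move=> Hl Hh; apply: (@PT_ext _ _ _ _ _ (fun a => ~~ is_leaf (enc (filter (h a) (l a))))).
  by move=> a; rewrite has_count -size_filter; case: (filter _ _).
by apply: PT_negb; apply: PT_is_leaf; apply: PT_filter.
Qed.

Lemma PT_all A {dA : data A} (beta : A -> nat) E {dE : data E} (h : A -> E -> bool) (l : A -> seq E) :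
  PT beta l -> PT (fun y : A * E => beta y.1) (fun y => h y.1 y.2) ->
  PT beta (fun a => all (h a) (l a)).
Proof.
move=> Hl Hh; apply: (@PT_ext _ _ _ _ _ (fun a => ~~ has (fun x => ~~ h a x) (l a))).
  by move=> a; rewrite -all_predC; apply: eq_all => x /=; rewrite negbK.
by apply: PT_negb; apply: (PT_has (h := fun a x => ~~ h a x)) => //; apply: PT_negb.
Qed.

Lemma PT_count A {dA : data A} (beta : A -> nat) E {dE : data E} (h : A -> E -> bool) (l : A -> seq E) :
  PT beta l -> PT (fun y : A * E => beta y.1) (fun y => h y.1 y.2) ->
  PT beta (fun a => count (h a) (l a)).
Proof.
move=> Hl Hh; apply: (@PT_ext _ _ _ _ _ (fun a => size (filter (h a) (l a)))).
  by move=> a; rewrite size_filter.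
by apply: PT_size; apply: PT_filter.
Qed.

Lemma PT_flatten A {dA : data A} (beta : A -> nat) E {dE : data E} (l : A -> seq (seq E)) :
  PT beta l -> PT beta (fun a => flatten (l a)).
Proof.
move=> Hl; apply: (@PT_ext _ _ _ _ _ (fun a => foldl cat [::] (l a))).
  move=> a; rewrite -[RHS]/([::] ++ flatten (l a)); elim: (l a) [::] => /= [|x s IH] t.
    by rewrite cats0.
  by rewrite IH catA.
apply: (PT_foldl_add (h := (fun _ => cat))
          (g := (fun y => (dsize y.2).+1))) => //.
- exact: PT_const.
- apply: PT_cat; first by apply: PT_fst; apply: PT_snd; apply: PT_id.
  by apply: PT_snd; apply: PT_snd; apply: PT_id.
- apply: (poly_le (poly_dsize _)) => y; rewrite dsize_pair; lia.
- by move=> a x e /=; pose proof (dsize_cat x e); lia.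
Qed.

(** A unary number and a list of units have the same encoding, which turns iteration into a fold. *)
Lemma PT_nseq A {dA : data A} (beta : A -> nat) (n : A -> nat) : PT beta n -> PT beta (fun a => nseq (n a) tt).
Proof. by apply: PT_enc => a; rewrite enc_nseq. Qed.

Lemma PT_iter A {dA : data A} (beta : A -> nat) X {dX : data X} (h : A -> X -> X) (x0 : A -> X) (n g : A -> nat) :
  PT beta n -> PT beta x0 ->
  PT (fun y : A * X => beta y.1) (fun y => h y.1 y.2) ->
  poly (bud beta) g -> (forall a x, dsize (h a x) <= dsize x + g a) ->
  PT beta (fun a => iter (n a) (h a) (x0 a)).
Proof.
move=> /PT_nseq Hn Hx Hh Hg H.
apply: (@PT_ext _ _ _ _ _ (fun a => foldl (fun x _ => h a x) (x0 a) (nseq (n a) tt))).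
  move=> a; elim: (n a) (x0 a) => // k IH x; by rewrite /= IH -iterS iterSr.
apply: (PT_foldl_add (h := (fun a x _ => h a x))
          (g := (fun y => g y.1))) => //.
  apply: (@PT_comp _ _ _ _ _ _ _ _ (fun y : A * (X * unit) => (y.1, y.2.1)) _ Hh).
    apply: PT_pair; first by apply: PT_fst; apply: PT_id.
    by apply: PT_fst; apply: PT_snd; apply: PT_id.
  exact: (@poly_beta _ _ (fun y : A * (X * unit) => beta y.1)).
apply: (@poly_comp _ _ _ (bud beta) g (fun y : A * unit => y.1)) => //.
rewrite {2}/bud; apply: (poly_le (poly_self _)) => y.
by rewrite /bud dsize_pair; lia.
Qed.

Lemma PT_add A {dA : data A} (beta : A -> nat) (m n : A -> nat) : PT beta m -> PT beta n -> PT beta (fun a => m a + n a).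
Proof.
move=> Hm Hn; apply: (@PT_ext _ _ _ _ _ (fun a => iter (m a) S (n a))).
  by move=> a; rewrite iter_succn addnC.
apply: (PT_iter (h := (fun _ => S)) (g := (fun=> 2))) => //.
- by apply: PT_S; apply: PT_snd; apply: PT_id.
- exact: poly_const.
- by move=> a x; rewrite !dsize_nat; lia.
Qed.

Lemma PT_sub A {dA : data A} (beta : A -> nat) (m n : A -> nat) : PT beta m -> PT beta n -> PT beta (fun a => m a - n a).
Proof.
move=> Hm Hn; apply: (@PT_ext _ _ _ _ _ (fun a => iter (n a) predn (m a))).
  by move=> a; rewrite iter_predn.
apply: (PT_iter (h := (fun _ => predn)) (g := (fun=> 0))) => //.
- by apply: PT_pred; apply: PT_snd; apply: PT_id.
- exact: poly_const.
- by move=> a x; rewrite !dsize_nat; lia.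
Qed.

Lemma PT_leq A {dA : data A} (beta : A -> nat) (m n : A -> nat) : PT beta m -> PT beta n -> PT beta (fun a => m a <= n a).
Proof.
move=> Hm Hn; apply: (@PT_ext _ _ _ _ _ (fun a => is_leaf (enc (m a - n a)))).
  by move=> a; rewrite -subn_eq0; case: (_ - _).
by apply: PT_is_leaf; apply: PT_sub.
Qed.

Lemma PT_eqn A {dA : data A} (beta : A -> nat) (m n : A -> nat) : PT beta m -> PT beta n -> PT beta (fun a => m a == n a).
Proof.
move=> Hm Hn; apply: (@PT_ext _ _ _ _ _ (fun a => (m a <= n a) && (n a <= m a))).
  by move=> a; rewrite eqn_leq.
by apply: PT_andb; apply: PT_leq.
Qed.

Lemma PT_drop A {dA : data A} (beta : A -> nat) E {dE : data E} (n : A -> nat) (l : A -> seq E) :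
  PT beta n -> PT beta l -> PT beta (fun a => drop (n a) (l a)).
Proof.
move=> Hn Hl; apply: (@PT_ext _ _ _ _ _ (fun a => iter (n a) behead (l a))).
  move=> a; elim: (n a) (l a) => [|k IH] s; first by rewrite drop0.
  by rewrite iterSr IH; case: s.
apply: (PT_iter (h := (fun _ => behead)) (g := (fun=> 0))) => //.
- by apply: PT_behead; apply: PT_snd; apply: PT_id.
- exact: poly_const.
- by move=> a [|x s] //; rewrite dsize_cons /=; lia.
Qed.

Lemma PT_nth A {dA : data A} (beta : A -> nat) E {dE : data E} x (n : A -> nat) (l : A -> seq E) :
  PT beta l -> PT beta n -> PT beta (fun a => nth x (l a) (n a)).
Proof.
move=> Hl Hn; apply: (@PT_ext _ _ _ _ _ (fun a => head x (drop (n a) (l a)))).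
  by move=> a; rewrite -nth0 nth_drop addn0.
by apply: PT_head; [apply: PT_const | apply: PT_drop].
Qed.

Lemma PT_take A {dA : data A} (beta : A -> nat) E {dE : data E} (n : A -> nat) (l : A -> seq E) :
  PT beta n -> PT beta l -> PT beta (fun a => take (n a) (l a)).
Proof.
move=> Hn Hl.
apply: (@PT_ext _ _ _ _ _ (fun a => rev (drop (size (l a) - n a) (rev (l a))))).
  by move=> a; rewrite -[in size _](revK (l a)) size_rev -take_rev revK.
by apply: PT_rev; apply: PT_drop; [apply: PT_sub => //; apply: PT_size | apply: PT_rev].
Qed.

Lemma PT_sumn A {dA : data A} (beta : A -> nat) (l : A -> seq nat) : PT beta l -> PT beta (fun a => sumn (l a)).
Proof.
move=> Hl; apply: (@PT_ext _ _ _ _ _ (fun a => foldl addn 0 (l a))).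
  by move=> a; rewrite (foldl_foldr addnA addnC).
apply: (PT_foldl_add (h := (fun _ => addn))
          (g := (fun y => (dsize y.2).+1))) => //.
- exact: PT_const.
- apply: PT_add; first by apply: PT_fst; apply: PT_snd; apply: PT_id.
  by apply: PT_snd; apply: PT_snd; apply: PT_id.
- apply: (poly_le (poly_dsize _)) => y; rewrite dsize_pair; lia.
- by move=> a x e /=; rewrite !dsize_nat; lia.
Qed.

Lemma PT_mul A {dA : data A} (beta : A -> nat) (m n : A -> nat) : PT beta m -> PT beta n -> PT beta (fun a => m a * n a).
Proof.
move=> Hm Hn; apply: (@PT_ext _ _ _ _ _ (fun a => iter (m a) (addn (n a)) 0)).
  by move=> a; rewrite iter_addn_0 mulnC.
apply: (PT_iter (h := (fun a => addn (n a))) (g := (fun a => dsize (n a)))) => //.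
- exact: PT_const.
- apply: PT_add; last by apply: PT_snd; apply: PT_id.
  apply: (@PT_comp _ _ _ _ _ _ _ _ (fun y : A * nat => y.1) _ Hn).
    by apply: PT_fst; apply: PT_id.
  exact: (@poly_beta _ _ (fun y : A * nat => beta y.1)).
- exact: PT_poly_size.
- by move=> a x; rewrite !dsize_nat; lia.
Qed.

Lemma PT_iota A {dA : data A} (beta : A -> nat) (n : A -> nat) : PT beta n -> PT beta (fun a => iota 0 (n a)).
Proof.
move=> Hn.
have E i : foldl (fun s _ => s ++ [:: size s]) [::] (nseq i tt) = iota 0 i.
  elim: i => // i IH; rewrite -addn1 nseqD foldl_cat IH /= size_iota.
  by rewrite addn1 -[i.+1]addn1 iotaD.
apply: (@PT_ext _ _ _ _ _ (fun a => foldl (fun s _ => s ++ [:: size s]) [::] (nseq (n a) tt))).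
  by move=> a.
apply: (@PT_foldl _ _ _ _ _ _ _ (fun _ s _ => s ++ [:: size s]) _ _
          (fun a => dsize (n a) * (dsize (n a) + 1) + 1)).
- exact: PT_nseq.
- exact: PT_const.
- have H : PT (fun y : A * (seq nat * unit) => beta y.1) (fun y => y.2.1).
    by apply: PT_fst; apply: PT_snd; apply: PT_id.
  apply: PT_cat => //; apply: PT_cons; last exact: PT_const.
  exact: PT_size.
- have H := PT_poly_size Hn; by poly_tac.
- move=> a i; have [k Hk ->] : exists2 k, k <= n a & take i (nseq (n a) tt) = nseq k tt.
    case: (leqP i (n a)) => Hi; first by exists i; rewrite ?take_nseq.
    by exists (n a); rewrite // take_oversize // size_nseq ltnW.
  rewrite E; have Hs m : dsize (iota 0 m) <= m * (m.*2 + 2) + 1.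
    elim: m => // m IH; rewrite -addn1 iotaD.
    pose proof (dsize_cat (iota 0 m) (iota (0 + m) 1)) as H; move: H.
    rewrite [iota (0 + m) 1]/= dsize_cons dsize_nat dsize_nil; nia.
  apply: leq_trans (Hs k) _; rewrite dsize_nat leq_add2r; apply: leq_mul; lia.
Qed.

(** * The algorithm *)

Definition adj (w : seq bool) (n i j : nat) : bool := nth false w (i * n + j).

Section Template.
Variables (D : rel nat) (S pw : seq nat) (m : nat) (par rk : seq nat).

(* Nodes [0 .. size S - 1] of a template are the players of [S], the favorite being node [0];
   nodes [size S .. m - 1] stand for players outside [S].  [par] and [rk] give the parents and the
   ranks, [pw] lists the powers of two, and [cnt i] is the number of players assigned to node [i]:
   for a player of [S] these are the roots of its children outside the template, whose
   ranks are [pures i] in decreasing order. *)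
Definition has_child (i j : nat) : bool :=
  has (fun z => (nth 0 par z == i) && (nth 0 rk z == j)) (behead (iota 0 m)).

Definition pures (i : nat) : seq nat :=
  [seq j <- rev (iota 0 (nth 0 rk i)) | ~~ has_child i j].

(** The number of players outside [S] for which node [i] makes room. A child of rank j that a player
    of [S] has outside the template heads 2^j of them; a placed node outside [S] counts itself and
    the subtrees at its free ranks. *)
Definition node_weight (cnt : nat -> nat) (i : nat) : nat :=
  if i < size S then sumn [seq nth 0 pw j | j <- take (cnt i) (pures i)]
  else if cnt i == 0 then 0 else (sumn [seq nth 0 pw j | j <- pures i]).+1.

Definition weight (cnt : nat -> nat) : nat := sumn [seq node_weight cnt i | i <- iota 0 m].

(** A parent outside [S] is only required to be placed already: players come strongest first, so it
    beats [t]. The parent or children of the node that are in [S] are compared with [t] directly. *)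
Definition legit (cnt : nat -> nat) (t i : nat) : bool :=
  if i < size S then D (nth 0 S i) t && (cnt i < size (pures i))
  else [&& cnt i == 0,
           (if nth 0 par i < size S then D (nth 0 S (nth 0 par i)) t
            else cnt (nth 0 par i) == 1) &
           all (fun z => ~~ (nth 0 par z == i) || D t (nth 0 S z)) (behead (iota 0 (size S)))].

Definition bump (x y : seq nat) (i : nat) : bool :=
  all (fun j => nth 0 y j == nth 0 x j + (if j == i then 1 else 0)) (iota 0 m).

Definition same (x y : seq nat) : bool := all (fun j => nth 0 y j == nth 0 x j) (iota 0 m).

(** [same] is the move of a filler, which changes no counter: whether it fits is a matter of
    capacity alone. After the move [k] + 1 players are placed, and the capacity must cover them
    all. *)
Definition dstep (t k : nat) (x y : seq nat) : bool :=
  (same x y || has (fun i => legit (nth 0 x) t i && bump x y i) (iota 0 m)) && (k < weight (nth 0 y)).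

Definition zeros (x : seq nat) : bool := all (fun j => nth 0 x j == 0) (iota 0 m).

Definition dp (U : seq (seq nat)) (T : seq nat) : seq (seq nat) * nat :=
  foldl (fun X t => ([seq y <- U | has (fun x => dstep t X.2 x y) X.1], X.2.+1))
    ([seq x <- U | zeros x], 0) T.

Definition final (x : seq nat) : bool :=
  all (fun i => nth 0 x i == 1) (drop (size S) (iota 0 m)).

(** Node 0 has no parent, hence the uses of [behead]. Only arcs between two players of [S] can be
    tested before the placement. *)
Definition valid_node (i : nat) : bool :=
  [&& nth 0 par i < m, nth 0 rk i < nth 0 rk (nth 0 par i),
      all (fun j => (i == j) || ~~ ((nth 0 par i == nth 0 par j) && (nth 0 rk i == nth 0 rk j)))
          (behead (iota 0 m)) &
      ~~ ((i < size S) && (nth 0 par i < size S)) || D (nth 0 S (nth 0 par i)) (nth 0 S i)].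

Definition valid : bool :=
  (nth 0 rk 0 == (size pw).-1) && all valid_node (behead (iota 0 m)).

Definition accept (U : seq (seq nat)) (T : seq nat) : bool := valid && has final (dp U T).1.
End Template.

(** Parents, ranks and states are all drawn from the one universe [U], so that trying every template
    costs only a power of the number of states. *)
Definition decide (D : rel nat) (S T pw : seq nat) (U : seq (seq nat)) : bool :=
  has (fun m => (size S <= m) &&
         has (fun par => has (fun rk => accept D S pw m par rk U T) U) U)
      (iota 0 (5 * size S).+1).

Definition memn (x : nat) (s : seq nat) : bool := has (fun y => y == x) s.

(** The matrix and the indicator of the favorite take n * n + n bits, a length that determines n. *)
Definition order_of (w : seq bool) : nat :=
  head 0 [seq n <- iota 0 (size w).+1 | n * n + n == size w].

Definition favorite (w : seq bool) (n : nat) : nat :=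
  head 0 [seq i <- iota 0 n | nth false w (n * n + i)].

Definition core_step (D : rel nat) (v : nat) (S : seq nat) (e : nat * nat) : seq nat :=
  if [&& D v e.1, D e.1 e.2, D e.2 v, ~~ memn e.1 S & ~~ memn e.2 S]
  then S ++ [:: e.1; e.2] else S.

Definition core_set (D : rel nat) (n v : nat) : seq nat :=
  foldl (core_step D v) [:: v] (flatten [seq [seq (b, a) | a <- iota 0 n] | b <- iota 0 n]).

Definition rest (n : nat) (S : seq nat) : seq nat := [seq u <- iota 0 n | ~~ memn u S].

(** A counting sort: in a transitive tournament the number of players who beat [u] is the position
    of [u], the strongest coming first. *)
Definition ranked (D : rel nat) (R : seq nat) : seq nat :=
  flatten [seq [seq u <- R | count (fun x => D x u) R == i] | i <- iota 0 (size R)].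

Definition powers_step (n : nat) (L : seq nat) : seq nat :=
  if head 0 L + head 0 L <= n then (head 0 L + head 0 L) :: L else L.

Definition powers (n : nat) : seq nat := rev (foldl (fun L _ => powers_step n L) [:: 1] (iota 0 n)).

Definition univ (k q : nat) : seq (seq nat) :=
  iter k (fun L => flatten [seq [seq a :: x | a <- iota 0 q] | x <- L]) [:: [::]].

(** Exceeds every entry to be guessed: node indices, which are below [5 * size S], ranks, which are
    below [size pw], and counters, which are bounded by a rank or by 1. *)
Definition radix (S pw : seq nat) : nat := (5 * size S + size pw).+1.

Definition solve (w : seq bool) (n : nat) (S : seq nat) : bool :=
  decide (adj w n) S (ranked (adj w n) (rest n S)) (powers n)
    (univ (5 * size S) (radix S (powers n))).

Definition core_of (w : seq bool) : seq nat :=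
  core_set (adj w (order_of w)) (order_of w) (favorite w (order_of w)).

Definition alg (w : seq bool) : bool := solve w (order_of w) (core_of w).

Definition budget (w : seq bool) : nat :=
  radix (core_of w) (powers (order_of w)) ^ (5 * size (core_of w)).

(** * The algorithm runs in time polynomial in its budget *)

Ltac pt_hook := fail.

Ltac pt :=
  lazymatch goal with
  | H : PT _ ?f |- PT _ ?f => exact H
  | |- PT _ id => apply: PT_id
  | |- PT _ fst => apply: PT0_fst
  | |- PT _ snd => apply: PT0_snd
  | |- PT _ size => by apply: PT_size; apply: PT_id
  | |- PT _ (iota 0) => by apply: PT_iota; apply: PT_id
  | |- PT _ (fun _ => ?c) => apply: PT_const
  | |- PT _ (fun a => a) => apply: PT_id
  | |- PT _ (fun a => fst _) => apply: PT_fst; pt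
  | |- PT _ (fun a => snd _) => apply: PT_snd; pt
  | |- PT _ (fun a => (_, _)) => apply: PT_pair; pt
  | |- PT _ (fun a => nth _ _ _) => apply: PT_nth; pt
  | |- PT _ (fun a => S _) => apply: PT_S; pt
  | |- PT _ (fun a => _.-1) => apply: PT_pred; pt
  | |- PT _ (fun a => _ + _) => apply: PT_add; pt
  | |- PT _ (fun a => _ * _) => apply: PT_mul; pt
  | |- PT _ (fun a => _ - _) => apply: PT_sub; pt
  | |- PT _ (fun a => _ <= _) => apply: PT_leq; pt
  | |- PT _ (fun a => _ == _) => apply: PT_eqn; pt
  | |- PT _ (fun a => _ && _) => apply: PT_andb; pt
  | |- PT _ (fun a => _ || _) => apply: PT_orb; pt
  | |- PT _ (fun a => ~~ _) => apply: PT_negb; pt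
  | |- PT _ (fun a => if _ then _ else _) => apply: PT_if; pt
  | |- PT _ (fun a => _ :: _) => apply: PT_cons; pt
  | |- PT _ (fun a => _ ++ _) => apply: PT_cat; pt
  | |- PT _ (fun a => behead _) => apply: PT_behead; pt
  | |- PT _ (fun a => head _ _) => apply: PT_head; pt
  | |- PT _ (fun a => rev _) => apply: PT_rev; pt
  | |- PT _ (fun a => size _) => apply: PT_size; pt
  | |- PT _ (fun a => sumn _) => apply: PT_sumn; pt
  | |- PT _ (fun a => flatten _) => apply: PT_flatten; pt
  | |- PT _ (fun a => take _ _) => apply: PT_take; pt
  | |- PT _ (fun a => drop _ _) => apply: PT_drop; pt
  | |- PT _ (fun a => iota 0 _) => apply: PT_iota; pt
  | |- PT _ (fun a => has _ _) => apply: PT_has; pt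
  | |- PT _ (fun a => all _ _) => apply: PT_all; pt
  | |- PT _ (fun a => count _ _) => apply: PT_count; pt
  | |- PT _ (fun a => map _ _) => apply: PT_map; pt
  | |- PT _ (fun a => filter _ _) => apply: PT_filter; pt
  | |- _ => first [assumption | pt_hook; pt]
  end.


Lemma PT_lift A B C {dA : data A} {dB : data B} {dC : data C} beta (f : A -> C) :
  PT beta f -> PT (fun y : A * B => beta y.1) (fun y => f y.1).
Proof.
move=> Hf; apply: (@PT_comp _ _ _ _ _ _ _ _ (fun y : A * B => y.1) _ Hf).
  by apply: PT_fst; apply: PT_id.
exact: (@poly_beta _ _ (fun y : A * B => beta y.1)).
Qed.

(* To lift [H : PT _ g], where [g] takes a tuple, to arbitrary polynomial-time arguments. *)
Ltac pt_args H t := move=> *; apply: (PT_comp0 (f := t) H); pt.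

Lemma PT_adj0 :
  PT (fun=> 0) (fun x : (seq bool * nat) * (nat * nat) => adj x.1.1 x.1.2 x.2.1 x.2.2).
Proof. by rewrite /adj; pt. Qed.

Lemma PT_adj A {dA : data A} beta (w : A -> seq bool) (n i j : A -> nat) :
  PT beta w -> PT beta n -> PT beta i -> PT beta j ->
  PT beta (fun a => adj (w a) (n a) (i a) (j a)).
Proof. pt_args PT_adj0 (fun a => ((w a, n a), (i a, j a))). Qed.

Ltac pt_hook ::= first [apply: PT_adj].

Definition skel := (nat * (seq nat * seq nat))%type.

Lemma PT_pures0 : PT (fun=> 0) (fun x : skel * nat => pures x.1.1 x.1.2.1 x.1.2.2 x.2).
Proof. by rewrite /pures /has_child; pt. Qed.

Lemma PT_pures A {dA : data A} beta (m : A -> nat) (par rk : A -> seq nat) (i : A -> nat) :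
  PT beta m -> PT beta par -> PT beta rk -> PT beta i ->
  PT beta (fun a => pures (m a) (par a) (rk a) (i a)).
Proof. pt_args PT_pures0 (fun a => ((m a, (par a, rk a)), i a)). Qed.

Ltac pt_hook ::= first [apply: PT_adj | apply: PT_pures].

Lemma PT_weight0 :
  PT (fun=> 0) (fun x : (seq nat * seq nat) * (skel * seq nat) =>
    weight x.1.1 x.1.2 x.2.1.1 x.2.1.2.1 x.2.1.2.2 (nth 0 x.2.2)).
Proof. by rewrite /weight /node_weight; pt. Qed.

Lemma PT_weight A {dA : data A} beta (S pw : A -> seq nat) (m : A -> nat)
    (par rk : A -> seq nat) (cnt : A -> seq nat) :
  PT beta S -> PT beta pw -> PT beta m -> PT beta par -> PT beta rk -> PT beta cnt ->
  PT beta (fun a => weight (S a) (pw a) (m a) (par a) (rk a) (nth 0 (cnt a))).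
Proof. pt_args PT_weight0 (fun a => ((S a, pw a), ((m a, (par a, rk a)), cnt a))). Qed.

Lemma PT_legit0 :
  PT (fun=> 0) (fun x : ((seq bool * nat) * seq nat) * (skel * (seq nat * (nat * nat))) =>
    legit (adj x.1.1.1 x.1.1.2) x.1.2 x.2.1.1 x.2.1.2.1 x.2.1.2.2
      (nth 0 x.2.2.1) x.2.2.2.1 x.2.2.2.2).
Proof. by rewrite /legit; pt. Qed.

Lemma PT_legit A {dA : data A} beta (w : A -> seq bool) (n : A -> nat) (S : A -> seq nat)
    (m : A -> nat) (par rk : A -> seq nat) (cnt : A -> seq nat) (t i : A -> nat) :
  PT beta w -> PT beta n -> PT beta S -> PT beta m -> PT beta par -> PT beta rk ->
  PT beta cnt -> PT beta t -> PT beta i ->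
  PT beta (fun a => legit (adj (w a) (n a)) (S a) (m a) (par a) (rk a) (nth 0 (cnt a)) (t a) (i a)).
Proof.
pt_args PT_legit0
  (fun a => (((w a, n a), S a), ((m a, (par a, rk a)), (cnt a, (t a, i a))))).
Qed.

Ltac pt_hook ::= first [apply: PT_adj | apply: PT_pures | apply: PT_weight | apply: PT_legit].

Definition templ := (((seq bool * nat) * (seq nat * seq nat)) * skel)%type.

Lemma PT_dstep0 :
  PT (fun=> 0) (fun x : templ * ((nat * nat) * (seq nat * seq nat)) =>
    dstep (adj x.1.1.1.1 x.1.1.1.2) x.1.1.2.1 x.1.1.2.2 x.1.2.1 x.1.2.2.1 x.1.2.2.2
      x.2.1.1 x.2.1.2 x.2.2.1 x.2.2.2).
Proof. by rewrite /dstep /same /bump; pt. Qed.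

Lemma PT_dstep A {dA : data A} beta (w : A -> seq bool) (n : A -> nat) (S pw : A -> seq nat)
    (m : A -> nat) (par rk : A -> seq nat) (t k : A -> nat) (x y : A -> seq nat) :
  PT beta w -> PT beta n -> PT beta S -> PT beta pw -> PT beta m -> PT beta par ->
  PT beta rk -> PT beta t -> PT beta k -> PT beta x -> PT beta y ->
  PT beta (fun a => dstep (adj (w a) (n a)) (S a) (pw a) (m a) (par a) (rk a)
                      (t a) (k a) (x a) (y a)).
Proof.
pt_args PT_dstep0 (fun a =>
  ((((w a, n a), (S a, pw a)), (m a, (par a, rk a))), ((t a, k a), (x a, y a)))).
Qed.

Ltac pt_hook ::= first [apply: PT_adj | apply: PT_pures | apply: PT_dstep].

Lemma dsize_filter T {dT : data T} (p : pred T) (s : seq T) : dsize (filter p s) <= dsize s.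
Proof. by elim: s => //= x s IH; case: (p x); rewrite !dsize_cons; lia. Qed.

Lemma PT_dp0 :
  PT (fun=> 0) (fun x : templ * (seq (seq nat) * seq nat) =>
    dp (adj x.1.1.1.1 x.1.1.1.2) x.1.1.2.1 x.1.1.2.2 x.1.2.1 x.1.2.2.1 x.1.2.2.2 x.2.1 x.2.2).
Proof.
rewrite /dp.
(* The accumulator is always a sublist of the universe with a counter bounded by the number of
   players, so it cannot grow from step to step. *)
apply: (PT_foldl (m := fun x : templ * (seq (seq nat) * seq nat) => 3 * dsize x)).
- by pt.
- by rewrite /zeros; pt.
- by pt.
- by poly_tac.
- move=> x i; set f := (fun X t => _); set s := take i _.
  have H2 : forall X s, (foldl f X s).2 = X.2 + size s.
    by move=> X; elim/last_ind=> [|s' e IH]; rewrite ?addn0 // foldl_rcons /= IH size_rcons addnS.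
  have H1 : exists p, (foldl f ([seq z <- x.2.1 | zeros x.1.2.1 z], 0) s).1 = filter p x.2.1.
    by case/lastP: s => [|s' e]; [eexists | rewrite foldl_rcons; eexists].
  have [p Hp] := H1; rewrite dsize_pair H2 Hp dsize_nat /=.
  pose proof (dsize_filter p x.2.1) as F1.
  pose proof (size_dsize s) as F2; pose proof (dsize_take i x.2.2) as F3.
  by move: F1 F2 F3; rewrite -/s !dsize_pair; lia.
Qed.

Lemma PT_dp A {dA : data A} beta (w : A -> seq bool) (n : A -> nat) (S pw : A -> seq nat)
    (m : A -> nat) (par rk : A -> seq nat) (U : A -> seq (seq nat)) (T : A -> seq nat) :
  PT beta w -> PT beta n -> PT beta S -> PT beta pw -> PT beta m -> PT beta par ->
  PT beta rk -> PT beta U -> PT beta T ->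
  PT beta (fun a => dp (adj (w a) (n a)) (S a) (pw a) (m a) (par a) (rk a) (U a) (T a)).
Proof.
pt_args PT_dp0 (fun a => ((((w a, n a), (S a, pw a)), (m a, (par a, rk a))), (U a, T a))).
Qed.

Ltac pt_hook ::= first [apply: PT_adj | apply: PT_dp].

Lemma PT_valid0 :
  PT (fun=> 0) (fun x : templ =>
    valid (adj x.1.1.1 x.1.1.2) x.1.2.1 x.1.2.2 x.2.1 x.2.2.1 x.2.2.2).
Proof. by rewrite /valid /valid_node; pt. Qed.

Lemma PT_valid A {dA : data A} beta (w : A -> seq bool) (n : A -> nat) (S pw : A -> seq nat)
    (m : A -> nat) (par rk : A -> seq nat) :
  PT beta w -> PT beta n -> PT beta S -> PT beta pw -> PT beta m -> PT beta par ->
  PT beta rk ->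
  PT beta (fun a => valid (adj (w a) (n a)) (S a) (pw a) (m a) (par a) (rk a)).
Proof.
pt_args PT_valid0 (fun a => (((w a, n a), (S a, pw a)), (m a, (par a, rk a)))).
Qed.

Ltac pt_hook ::= first [apply: PT_adj | apply: PT_dp | apply: PT_valid].

Lemma PT_decide0 :
  PT (fun=> 0) (fun x : ((seq bool * nat) * (seq nat * seq nat)) * (seq (seq nat) * seq nat) =>
    decide (adj x.1.1.1 x.1.1.2) x.1.2.1 x.2.2 x.1.2.2 x.2.1).
Proof. by rewrite /decide /accept /final; pt. Qed.

Lemma PT_decide A {dA : data A} beta (w : A -> seq bool) (n : A -> nat) (S pw : A -> seq nat)
    (U : A -> seq (seq nat)) (T : A -> seq nat) :
  PT beta w -> PT beta n -> PT beta S -> PT beta pw -> PT beta U -> PT beta T ->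
  PT beta (fun a => decide (adj (w a) (n a)) (S a) (T a) (pw a) (U a)).
Proof. pt_args PT_decide0 (fun a => (((w a, n a), (S a, pw a)), (U a, T a))). Qed.

Lemma PT_order0 : PT (fun=> 0) order_of.
Proof. by rewrite /order_of; pt. Qed.

Lemma PT_favorite0 : PT (fun=> 0) (fun x : seq bool * nat => favorite x.1 x.2).
Proof. by rewrite /favorite; pt. Qed.

Lemma PT_core_set0 :
  PT (fun=> 0) (fun x : (seq bool * nat) * nat => core_set (adj x.1.1 x.1.2) x.1.2 x.2).
Proof.
rewrite /core_set.
apply: (PT_foldl_add (h := fun x : (seq bool * nat) * nat => core_step (adj x.1.1 x.1.2) x.2)
          (g := fun y => dsize y.2 + 1)).
- by pt.
- by pt.
- by rewrite /core_step /memn; pt.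
- apply: (poly_le (poly_dsize _)) => y; rewrite [X in _ <= X]dsize_pair; lia.
- move=> a x e; rewrite /core_step; case: ifP => _; last by lia.
  pose proof (dsize_cat x [:: e.1; e.2]) as H; move: H.
  by rewrite !dsize_cons dsize_nil dsize_pair /=; lia.
Qed.

Lemma PT_ranked0 :
  PT (fun=> 0) (fun x : (seq bool * nat) * seq nat => ranked (adj x.1.1 x.1.2) (rest x.1.2 x.2)).
Proof. by rewrite /ranked /rest /memn; pt. Qed.

Lemma PT_powers0 : PT (fun=> 0) powers.
Proof.
rewrite /powers; apply: PT_rev.
apply: (PT_foldl_add (h := fun n L (_ : nat) => powers_step n L) (g := fun y => dsize y)).
- by pt.
- by pt.
- by rewrite /powers_step; pt.
- exact: poly_dsize.
- move=> a x e; rewrite /powers_step; case: ifP => H; last by lia.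
  by rewrite dsize_cons dsize_pair !dsize_nat /=; lia.
Qed.

Lemma dsize_seq_le (M N : nat) (L : seq (seq nat)) :
  (forall x : seq nat, x \in L -> dsize x <= M) -> size L <= N -> dsize L <= N * (M + 1) + 1.
Proof.
move=> H HN; apply: leq_trans (_ : size L * (M + 1) + 1 <= _); last first.
  by rewrite leq_add2r leq_mul2r HN orbT.
elim: L H {HN} => // x L IH H; rewrite dsize_cons /= mulSn.
have H1 := H x (mem_head _ _).
have H2 : dsize L <= size L * (M + 1) + 1.
  by apply: IH => y Hy; apply: H; rewrite in_cons Hy orbT.
lia.
Qed.

Lemma univP k q x : (x \in univ k q) = (size x == k) && all (fun a => a < q) x.
Proof.
elim: k x => [|k IH] x; first by rewrite inE; case: x.
apply/flattenP/idP => [[s /mapP [y Hy ->] /mapP [a]]|].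
  rewrite mem_iota /= add0n => Ha -> /=; rewrite Ha eqSS.
  by move: Hy; rewrite -/(univ k q) IH => /andP [-> ->].
case: x => [|a x] //=; rewrite eqSS andbCA => /andP [Ha Hx].
exists [seq b :: x | b <- iota 0 q]; last by apply: map_f; rewrite mem_iota.
by apply/mapP; exists x => //; rewrite -/(univ k q) IH.
Qed.

Lemma size_univ k q : size (univ k q) = q ^ k.
Proof.
elim: k => // k IH; rewrite /univ iterS -/(univ k q) size_flatten /shape -map_comp.
have E : map (size \o (fun x => [seq a :: x | a <- iota 0 q])) (univ k q) = nseq (size (univ k q)) q.
  by elim: (univ k q) => //= x L ->; rewrite size_map size_iota.
by rewrite E sumn_nseq IH expnS.
Qed.

(** The one place where the output can be exponential in the input: its length [q a ^ k a] has to be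
    paid for by the budget. *)
Lemma PT_univ A {dA : data A} beta (k q : A -> nat) :
  PT beta k -> PT beta q -> (forall a, 0 < q a) -> poly (bud beta) (fun a => q a ^ k a) ->
  PT beta (fun a => univ (k a) (q a)).
Proof.
move=> Hk Hq Hq0 Hp.
have E q' i : foldl (fun L (_ : unit) => flatten [seq [seq a :: x | a <- iota 0 q'] | x <- L])
     [:: [::]] (nseq i tt) = univ i q'.
  elim: i => // i IH; rewrite -addn1 nseqD foldl_cat IH.
  by rewrite addn1 /univ iterS.
apply: (@PT_ext _ _ _ _ _ (fun a =>
  foldl (fun L (_ : unit) => flatten [seq [seq b :: x | b <- iota 0 (q a)] | x <- L])
     [:: [::]] (nseq (k a) tt))) => //.
apply: (PT_foldl (m := fun a => q a ^ k a * ((k a * (2 * q a + 2) + 1) + 1) + 1)).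
- exact: PT_nseq.
- exact: PT_const.
- have H : PT (fun y : A * (seq (seq nat) * unit) => beta y.1) (fun y => q y.1).
    exact: PT_lift.
  apply: PT_flatten; apply: PT_map; first by pt.
  apply: PT_map; last by pt.
  by apply: PT_iota; exact: (PT_lift H).
- have H1 := PT_poly_size Hk; have H2 := PT_poly_size Hq.
  have H3 : poly (bud beta) k by apply: (poly_le H1) => a; rewrite dsize_nat; lia.
  have H4 : poly (bud beta) q by apply: (poly_le H2) => a; rewrite dsize_nat; lia.
  apply: poly_add => //; last by poly_tac.
  by apply: poly_mul => //; poly_tac.
- move=> a i; have [j Hj ->] : exists2 j, j <= k a & take i (nseq (k a) tt) = nseq j tt.
    case: (leqP i (k a)) => Hi; first by exists i; rewrite ?take_nseq.
    by exists (k a); rewrite // take_oversize // size_nseq ltnW.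
  rewrite E; apply: dsize_seq_le; last by rewrite size_univ leq_pexp2l.
  move=> x; rewrite univP => /andP [/eqP Hs Hx].
  apply: leq_trans (_ : size x * (2 * q a + 2) + 1 <= _); last first.
    by rewrite leq_add2r leq_mul2r Hs Hj orbT.
  elim: x Hx {Hs} => // b x IH /= /andP [Hb Hx]; rewrite dsize_cons dsize_nat mulSn.
  have := IH Hx; lia.
Qed.

Lemma PT_alg : PT budget alg.
Proof.
have Hn : PT budget order_of by exact: (PT_comp0 PT_order0 (PT_id _)).
have Hid : PT budget (fun w : seq bool => w) by apply: PT_id.
have Hv : PT budget (fun w => favorite w (order_of w)).
  by apply: (PT_comp0 (f := fun w => (w, order_of w)) PT_favorite0); pt.
have HS : PT budget core_of.
  by apply: (PT_comp0 (f := fun w => ((w, order_of w), favorite w (order_of w))) PT_core_set0); pt.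
have HT : PT budget (fun w => ranked (adj w (order_of w)) (rest (order_of w) (core_of w))).
  by apply: (PT_comp0 (f := fun w => ((w, order_of w), core_of w)) PT_ranked0); pt.
have Hp : PT budget (fun w => powers (order_of w)).
  exact: (PT_comp0 PT_powers0 Hn).
apply: PT_decide => //; apply: PT_univ => //.
- by pt.
- by rewrite /radix; pt.
- exact: poly_beta.
Qed.

(** * From polynomial-time functions to Turing machines *)

(** Putting [true] and the code of a bit in front of the code of a list conses the bit; the input
    stack delivers the last bit first, so the list comes out in order. *)
Definition load_bit (b : bool) := CSeq (cpushes (true :: code (tbool b))) (CPush TC true).

Definition load_body := CRead (load_bit false) (load_bit true) (CPush TC false).

Definition cload := CSeq (CPush TA false) (CSeq (CPush TC true) (CWhile TC load_body)).

Lemma within_load_loop (w l : seq bool) B C :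
  within (CWhile TC load_body) (Store (code (enc l)) B (true :: C) w)
    (Store (code (enc (rev w ++ l))) B C [::]) (8 * size w + 4).
Proof.
elim: w l => [|b w IH] l.
  apply: within_le.
    apply: (@within_whileT TC _ _ (Store (code (enc l)) B (false :: C) [::]) _ 2) => //.
      by apply: within_read => /=; apply: within_push.
    exact: within_whileF.
  by [].
rewrite rev_cons cat_rcons; apply: within_le.
  apply: (@within_whileT TC _ _ (Store (code (enc (b :: l))) B (true :: C) w) _ 6) => //.
    apply: within_read; rewrite [branch _ _ _ _]/= [put _ _ _]/= [put_input _ _]/=.
    have H : within (load_bit b) (Store (code (enc l)) B C w)
               (Store (code (enc (b :: l))) B (true :: C) w) 5.
      apply: within_le; first by apply: within_seq (within_cpushes _ _ _ _ _) (within_push _ _ _).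
      by case: (b).
    by case: (b) H.
by rewrite /=; lia.
Qed.

Lemma within_cload (w : seq bool) B C :
  within cload (Store [::] B C (rev w)) (Store (code (enc w)) B C [::]) (8 * size w + 6).
Proof.
apply: within_le.
  apply: within_seq (within_push _ _ _) (within_seq (within_push _ _ _) _).
  have := @within_load_loop (rev w) [::] B C; rewrite revK cats0; exact.
by rewrite size_rev; lia.
Qed.

Lemma dsize_bits (w : seq bool) : dsize w <= 4 * size w + 1.
Proof.
elim: w => // b w IH; rewrite dsize_cons /=; pose proof (dsize_bool b); lia.
Qed.

Theorem PT_decidable (beta : seq bool -> nat) (f : seq bool -> bool) : PT beta f ->
  exists (M : TM) (d : nat), forall w T, (beta w + size w + 2) ^ d <= T ->
    decides_within M (map bit w) (f w) T.
Proof.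
move=> [c [n [Hn H]]]; exists (program_machine (CSeq cload c)).
pose (b := fun w : seq bool => beta w + size w + 2).
have Hb w : 1 < b w by rewrite /b; lia.
have Hsz : poly b (fun w => size w) by exists 1 => w; rewrite expn1 /b; lia.
have {}Hn : poly b n.
  apply: (@poly_comp _ b _ (bud beta) n id) => //.
  apply: (@poly_le _ _ _ (fun w => 4 * b w)).
    by apply: poly_mul; [apply: poly_const | apply: poly_self].
  by move=> w; have := dsize_bits w; rewrite /bud /b /=; lia.
pose N w := 8 * size w + 6 + n w.
have HN : poly b N by rewrite /N; poly_tac.
have [d Hd] : poly b (fun w => (2 + N w) * (8 * (size w + N w + 4)) + 3) by poly_tac.
exists d => w T HT.
have [t Ht E] : within (CSeq cload c) (Store [::] [::] [:: false] (rev w))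
    (Store (code (tbool (f w))) [::] [:: false] [::]) (N w).
  apply: within_seq; first exact: within_cload.
  by have := H w [::] [::] [:: false] [::]; rewrite !cats0; exact.
(* The root bit of [tbool (f w)] is the verdict; its two leaves, if any, stay below. *)
have {}E : exists l, exec (CSeq cload c) (Store [::] [::] [:: false] (rev w))
    (Store (f w :: l) [::] [:: false] [::]) t.
  by move: E; case: (f w) => E; [exists [:: false; false] | exists [::]].
case: E => l E; apply: (program_machine_decides E).
apply: leq_trans HT; apply: leq_trans (Hd w); rewrite leq_add2r; apply: leq_mul; lia.
Qed.

(** * Seedings and binomial arborescences *)

(* [par u] is the player who beats [u] and [rk u] the number of matches won by [u]. *)
Definition bin_arb (V : eqType) (D : rel V) (l : seq V) (v : V) (p : nat)
    (par : V -> V) (rk : V -> nat) : Prop :=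
  [/\ v \in l, rk v = p,
      (forall u, u \in l -> u != v -> [/\ par u \in l, D (par u) u & rk u < rk (par u)]) &
      (forall u u', u \in l -> u' \in l -> u != v -> u' != v ->
         par u = par u' -> rk u = rk u' -> u = u')].

(** Ranks grow strictly towards parents and are bounded on the finite list [l], so the chain of
    parents from [u] must end in [v]. *)
Lemma arb_rk_lt (V : eqType) (D : rel V) (l : seq V) v p par rk u :
  bin_arb D l v p par rk -> u \in l -> u != v -> rk u < p.
Proof.
case=> Hv Hp H1 _.
have [B Hb] : exists B, forall x, x \in l -> rk x <= B.
  by exists (\max_(x <- l) rk x) => x Hx; rewrite (big_rem x) //= leq_maxl.
move: {2}(B - rk u) (leqnn (B - rk u)) => k; elim: k u => [|k IH] u Hk Hu Nu.
  have [Q1 Q2 Q3] := H1 _ Hu Nu; have := Hb _ Q1; lia.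
have [Q1 Q2 Q3] := H1 _ Hu Nu.
case: (eqVneq (par u) v) => [E|N]; first by rewrite -Hp -E.
have Hk' : B - rk (par u) <= k by have := Hb _ Q1; lia.
exact: ltn_trans Q3 (IH _ Hk' Q1 N).
Qed.

Section Knockout.
Variables (V : finType) (D : rel V).
Hypothesis tourD : is_tournament D.

Lemma ko_size k (s : seq V) : size s = k.*2 -> size (ko_round D s) = k.
Proof. by elim: k s => [|k IH] [|a [|b t]] //= [] /IH ->. Qed.

Lemma ko_sub (s : seq V) : {subset ko_round D s <= s}.
Proof.
move En: (size s) => n; elim: n {-2}n (leqnn n) s En => [|n IH] m Hm [|a [|b t]] //= En x;
  try by move: Hm; rewrite -En.
rewrite inE => /orP [/eqP ->|]; first by case: ifP; rewrite !inE eqxx ?orbT.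
have Ht : size t <= n by lia.
by move/(IH _ Ht t erefl) => H; rewrite !inE H !orbT.
Qed.

Lemma ko_opponent k (s : seq V) : size s = k.*2 -> uniq s ->
  uniq (ko_round D s) /\ exists opp : V -> V,
    (forall u, u \in s -> u \notin ko_round D s ->
       opp u \in ko_round D s /\ D (opp u) u) /\
    (forall u u', u \in s -> u' \in s -> u \notin ko_round D s -> u' \notin ko_round D s ->
       opp u = opp u' -> u = u').
Proof.
elim: k s => [|k IH] s.
  by case: s => // _ _; split => //; exists id; split.
case: s => [|a [|b t]] // [Ht] /=; rewrite inE negb_or => /andP[/andP[Hab Hat] /andP[Hbt Ut]].
have [U [opp [H1 H2]]] := IH t Ht Ut.
set x := (if D a b then a else b).
pose y := (if D a b then b else a).
have Hxy : D x y.
  rewrite /x /y; case: ifP => // E.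
  by case: tourD => _ /(_ a b Hab); rewrite E.
have Nxy : x != y by rewrite /x /y; case: ifP => // _; rewrite eq_sym.
have Nxt : x \notin t by rewrite /x; case: ifP.
have Nyt : y \notin t by rewrite /y; case: ifP.
have Nxk : x \notin ko_round D t by apply: contra Nxt; apply: ko_sub.
have mem u : (u \in [:: a, b & t]) = [|| u == x, u == y | u \in t].
  by rewrite !inE /x /y; case: ifP => // _; rewrite orbCA.
split; first by rewrite Nxk.
exists (fun u => if u == y then x else opp u); split.
  move=> u; rewrite mem => /or3P [/eqP ->|/eqP ->|Hu]; rewrite inE negb_or ?eqxx //.
    by move=> _; rewrite inE eqxx.
  case/andP=> _ Hk; case: eqP => [->|_]; first by rewrite inE eqxx.
  by have [Q1 Q2] := H1 _ Hu Hk; rewrite inE Q1 orbT.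
move=> u u'; rewrite !mem => Hu Hu'; rewrite !inE !negb_or.
case/andP=> Nux Nuk /andP [Nux' Nuk'].
rewrite (negbTE Nux) /= in Hu; rewrite (negbTE Nux') /= in Hu'.
case/orP: Hu => [/eqP ->|Hu]; case/orP: Hu' => [/eqP ->|Hu'] //.
- rewrite eqxx; case: eqP => [->|_] // E.
  by have [Ho _] := H1 _ Hu' Nuk'; rewrite -E (negbTE Nxk) in Ho.
- rewrite eqxx; case: eqP => [->|_] // E.
  by have [Ho _] := H1 _ Hu Nuk; rewrite E (negbTE Nxk) in Ho.
case: eqP => [E|_]; first by rewrite -E Hu in Nyt.
case: eqP => [E|_]; first by rewrite -E Hu' in Nyt.
exact: H2.
Qed.

(** The losers of the opening round hang with rank 0 below their opponents; the later rounds give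
    the arborescence of the winners, with all ranks raised by one. *)
Lemma arb_of_seeding p (s : seq V) v : uniq s -> size s = 2 ^ p ->
  head v (iter p (ko_round D) s) = v -> exists par rk, bin_arb D s v p par rk.
Proof.
elim: p s => [|p IH] s Us Hs Hv.
  rewrite expn0 in Hs.
  case: s Us Hs Hv => [|x [|y s]] //= _ _ <- {v}.
  exists id, (fun=> 0); split; [by rewrite mem_head | by [] | |].
    by move=> u; rewrite inE => ->.
  by move=> u u'; rewrite !inE => /eqP -> /eqP ->.
have Hs' : size s = (2 ^ p).*2 by rewrite Hs expnS mul2n.
rewrite iterSr in Hv.
have [U [opp [H1 H2]]] := ko_opponent Hs' Us.
have [par [rk [Pv Prk P1 P2]]] := IH _ U (ko_size Hs') Hv.
exists (fun u => if u \in ko_round D s then par u else opp u),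
       (fun u => if u \in ko_round D s then (rk u).+1 else 0).
split.
- exact: ko_sub Pv.
- by rewrite Pv Prk.
- move=> u Hu Nuv; case: ifPn => Hk.
    by have [Q1 Q2 Q3] := P1 _ Hk Nuv; rewrite Q1; split => //; apply: ko_sub.
  by have [Q1 Q2] := H1 _ Hu Hk; rewrite Q1; split => //; apply: ko_sub.
- move=> u u' Hu Hu' Nu Nu'; case: ifPn => Hk; case: ifPn => Hk' //.
    by move=> E [E']; apply: P2.
  by move=> E _; apply: H2.
Qed.


Lemma arb_contract (l : seq V) v p par rk : bin_arb D l v p.+1 par rk ->
  bin_arb D [seq u <- l | 0 < rk u] v p par (fun u => (rk u).-1).
Proof.
case=> Hv Hp H1 H2; split.
- by rewrite mem_filter Hv Hp.
- by rewrite Hp.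
- move=> u; rewrite mem_filter => /andP [Hr Hu] Nu.
  have [Q1 Q2 Q3] := H1 _ Hu Nu; rewrite mem_filter Q1; split => //; lia.
- move=> u u'; rewrite !mem_filter => /andP [Hr Hu] /andP [Hr' Hu'] Nu Nu' E E'.
  apply: H2 => //; lia.
Qed.

Lemma arb_leaves (l : seq V) v p par rk : uniq l -> bin_arb D l v p.+1 par rk ->
  uniq (map par [seq u <- l | rk u == 0]) /\
  {subset map par [seq u <- l | rk u == 0] <= [seq u <- l | 0 < rk u]}.
Proof.
move=> Ul [Hv Hp H1 H2].
have Nv u : rk u == 0 -> u != v by apply: contraL => /eqP ->; rewrite Hp.
split.
  rewrite map_inj_in_uniq ?filter_uniq // => u u'.
  rewrite !mem_filter => /andP [Hr Hu] /andP [Hr' Hu'] E.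
  by apply: H2 => //; [apply: Nv | apply: Nv | rewrite (eqP Hr) (eqP Hr')].
move=> x /mapP [u]; rewrite mem_filter => /andP [Hr Hu] ->.
by have [Q1 Q2 Q3] := H1 _ Hu (Nv _ Hr); rewrite mem_filter Q1 andbT; lia.
Qed.

Lemma size_leaves (l : seq V) (rk : V -> nat) :
  size l = size [seq u <- l | rk u == 0] + size [seq u <- l | 0 < rk u].
Proof.
rewrite !size_filter -(count_predC (fun u => rk u == 0)); congr (_ + _).
by apply: eq_count => u /=; rewrite lt0n.
Qed.

(** Siblings have distinct ranks, so the nodes of rank 0 inject into their parents, which are among
    the others: removing them leaves at least half of the nodes. *)
Lemma arb_size (l : seq V) v p par rk : uniq l -> bin_arb D l v p par rk -> size l <= 2 ^ p.
Proof.
elim: p l rk => [|p IH] l rk Ul arb.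
  have H u : u \in l -> u == v.
    by move=> Hu; apply: contraT => N; have := arb_rk_lt arb Hu N.
  by apply: (@uniq_leq_size _ l [:: v]) => // u /H; rewrite inE.
have [U S] := arb_leaves Ul arb.
have H0 := uniq_leq_size U S; rewrite size_map in H0.
have H1 := IH _ _ (filter_uniq _ Ul) (arb_contract arb).
rewrite (size_leaves l rk) expnS mul2n -addnn; exact: leq_add (leq_trans H0 H1) H1.
Qed.

Lemma ko_expand (s : seq V) (f : V -> V) : {in s, forall x, D x (f x)} ->
  ko_round D (flatten [seq [:: x; f x] | x <- s]) = s.
Proof.
elim: s => //= x s IH H; rewrite H ?mem_head // IH // => y Hy.
by apply: H; rewrite in_cons Hy orbT.
Qed.

Lemma perm_expand (s : seq V) (f : V -> V) :
  perm_eq (flatten [seq [:: x; f x] | x <- s]) (s ++ map f s).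
Proof.
elim: s => //= x s IH; rewrite perm_cons perm_sym -cat_rcons perm_catC.
rewrite -cats1 catA perm_catC /= perm_cons perm_sym; apply: perm_trans IH _.
by rewrite perm_catC.
Qed.

(** With exactly 2^p nodes that injection is a bijection: every other node has one child of rank 0,
    its opponent in the opening round. *)
Lemma seeding_of_arb p (l : seq V) v par rk : uniq l -> size l = 2 ^ p ->
  bin_arb D l v p par rk -> exists s, perm_eq s l /\ iter p (ko_round D) s = [:: v].
Proof.
elim: p l rk => [|p IH] l rk Ul Hl arb.
  case: arb => Hv _ _ _; exists l; split => //.
  by case: l Hl Hv {Ul} => [|x [|y l]] //= _; rewrite inE => /eqP ->.
have [U S] := arb_leaves Ul arb.
have H0 := uniq_leq_size U S; rewrite size_map in H0.
have H1 := arb_size (filter_uniq (fun u => 0 < rk u) Ul) (arb_contract arb).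
have Hz := size_leaves l rk; rewrite Hl expnS in Hz.
set l0 := [seq u <- l | rk u == 0] in U S H0 Hz.
set l1 := [seq u <- l | 0 < rk u] in S H0 H1 Hz.
have E1 : size l1 = 2 ^ p.
  apply/eqP; rewrite eqn_leq H1 /=; rewrite mul2n -addnn in Hz.
  rewrite leqNgt; apply/negP => Hlt.
  have := leq_ltn_trans H0 Hlt => Hlt0.
  by have := leq_add Hlt0 (ltnW Hlt); rewrite addSn -Hz ltnn.
have E0 : size l1 <= size l0.
  by move: Hz; rewrite E1 mul2n -addnn => /addIn ->.
have [s [Ps Hs]] := IH l1 _ (filter_uniq _ Ul) E1 (arb_contract arb).
have Pp : perm_eq (map par l0) l1.
  apply: uniq_perm => //; first exact: filter_uniq.
  have [_] := uniq_min_size U S ltac:(rewrite size_map; exact: E0); exact.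
(* The inverse of [par] from [l1] to [l0]. *)
pose child x := nth x l0 (index x (map par l0)).
have Hc u : u \in l0 -> child (par u) = u.
  move=> Hu; rewrite /child.
  have -> : index (par u) (map par l0) = index u l0.
    rewrite -{1}(nth_index u Hu) -(nth_map u (par u)) ?index_mem //.
    by rewrite index_uniq // size_map index_mem.
  exact: nth_index.
have Hm : map child (map par l0) = l0.
  by rewrite -map_comp -[RHS]map_id; apply/eq_in_map => u Hu; apply: Hc.
exists (flatten [seq [:: x; child x] | x <- s]); split.
  apply: perm_trans (perm_expand _ _) _.
  apply: (@perm_trans _ (l1 ++ l0)).
    apply: perm_cat => //; rewrite -Hm; apply: perm_map.
    by apply: perm_trans Ps _; rewrite perm_sym.
  rewrite perm_catC /l0 /l1 perm_sym -(perm_filterC (fun u => rk u == 0) l) perm_cat2l.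
  by apply/permP => a; rewrite (eq_filter (a2 := fun u => 0 < rk u)) // => u /=; rewrite lt0n.
rewrite iterSr ko_expand // => x Hx.
have : x \in map par l0 by rewrite (perm_mem Pp) -(perm_mem Ps).
case/mapP=> u Hu ->; rewrite Hc //.
case: arb => _ Hp Q _; move: Hu; rewrite mem_filter => /andP [Hr Hu].
have Nu : u != v by apply: contraTneq Hr => ->; rewrite Hp.
by have [] := Q u Hu Nu.
Qed.

End Knockout.

Lemma TFP_yesP p (D : rel 'I_(2 ^ p)) v : is_tournament D ->
  TFP_yes D v <-> exists par rk, bin_arb D (enum 'I_(2 ^ p)) v p par rk.
Proof.
move=> tourD; split.
  case=> s [Ps /eqP Hs].
  have [] := arb_of_seeding tourD _ _ Hs.
  - by rewrite (perm_uniq Ps) enum_uniq.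
  - by rewrite (perm_size Ps) size_enum_ord.
  move=> par [rk [H0 H1 H2 H3]]; exists par, rk; split => //.
  - by rewrite mem_enum.
  - move=> u _ Nu; rewrite mem_enum; have [|_ -> ->] := H2 u _ Nu => //.
    by rewrite (perm_mem Ps) mem_enum.
  - by move=> u u' _ _; apply: H3; rewrite (perm_mem Ps) mem_enum.
case=> par [rk arb].
have [s [Ps Hs]] := seeding_of_arb (enum_uniq _) (size_enum_ord _) arb.
by exists s; split => //; rewrite /champion Hs.
Qed.

(** * Small skeletons *)

Section Skeleton.
Variables (V : finType) (D : rel V) (v : V) (p : nat) (S : {set V}).
Hypothesis tourD : is_tournament D.
Hypothesis vS : v \in S.
Hypothesis transD : forall a b c, a \notin S -> b \notin S -> c \notin S ->
  D a b -> D b c -> D a c.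

Definition arbor (par : V -> V) (rk : V -> nat) : Prop :=
  [/\ rk v = p, (forall u, u != v -> D (par u) u /\ rk u < rk (par u)) &
      (forall x y, x != v -> y != v -> par x = par y -> rk x = rk y -> x = y)].

Definition pclosed (par : V -> V) (M : {set V}) : Prop :=
  forall u, u \in M -> u != v -> par u \in M.

Lemma notS_neq_v x : x \notin S -> x != v.
Proof. by apply: contraNneq => ->. Qed.

(* [t] leaves the skeleton: its unique child [t'] there is attached to the parent [u] of [t],
   and the subtree that occupied that place, if any, goes below [t] or above it. *)
Lemma shorten par rk (M : {set V}) u t t' :
  arbor par rk -> S \subset M -> pclosed par M ->
  t \in M -> t \notin S -> par t = u -> u \notin S -> t' \in M -> t' \notin S -> par t' = t ->
  (forall x, x \in M -> x != v -> par x = t -> x = t') ->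
  (forall c, c \in M -> c != v -> par c = u -> rk c <> rk t') ->
  exists par' rk', arbor par' rk' /\ pclosed par' (M :\ t).
Proof.
move=> [Hp H1 H2] SM Mc tM tS Eu uS t'M t'S Et' Ht Hc.
have tv := notS_neq_v tS; have uv := notS_neq_v uS; have t'v := notS_neq_v t'S.
have [Dut rtu] := H1 t tv; rewrite Eu in Dut rtu.
have [Dtt' rt't] := H1 t' t'v; rewrite Et' in Dtt' rt't.
have Dut' : D u t' by apply: transD Dut Dtt'.
have Nut : u != t by apply: contraTneq rtu => ->; rewrite ltnn.
have Ntt' : t' != t by apply: contraTneq rt't => ->; rewrite ltnn.
have Nut' : u != t' by apply: contraTneq rtu => ->; rewrite -leqNgt ltnW.
have uM : u \in M by rewrite -Eu; apply: Mc.
have Closed par' : par' t' = u ->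
    (forall x, x \in M -> x != t -> x != t' -> x != v -> par' x = par x) -> pclosed par' (M :\ t).
  move=> E0 E x; rewrite in_setD1 => /andP [Nx xM] xv.
  case: (eqVneq x t') => [->|Nx']; first by rewrite E0 in_setD1 Nut.
  rewrite E // in_setD1 Mc // andbT; apply: contraNneq Nx' => E'.
  by apply/eqP; apply: Ht.
(* The only obstacle to attaching [t'] to [u] is a child [c] of [u] with the same rank; by
   hypothesis it is outside [M]. *)
case: (pickP [pred c | [&& c != v, par c == u & rk c == rk t']]) => [c /= /and3P [cv /eqP Ec /eqP Er]|N].
  have cM : c \notin M by apply/negP => cM; apply: (Hc c).
  have cS : c \notin S by apply: contra cM; apply: (subsetP SM).
  have Nct : c != t by apply: contraNneq cM => ->.
  have Nct' : c != t' by apply: contraNneq cM => ->.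
  have [Duc rcu] := H1 c cv; rewrite Ec in Duc rcu.
  have Nuc : u != c by apply: contraTneq rcu => ->; rewrite ltnn.
  (* If [t] beats [c], then [c] and [t'], of equal rank, exchange their parents. *)
  have [Dtc|NDtc] := boolP (D t c).
    exists (fun x => if x == t' then u else if x == c then t else par x), rk; split; last first.
      apply: Closed => [|x xM _ Nx' xv]; first by rewrite eqxx.
      by rewrite (negbTE Nx') ifF //; apply: contraNF cM => /eqP <-.
    split => //.
      move=> x xv; case: eqP => [->|_]; first by split => //; apply: ltn_trans rtu.
      case: eqP => [->|_]; first by rewrite Er.
      exact: H1.
    move=> x y xv yv.
    case: (eqVneq x t') => [->|Nx]; case: (eqVneq y t') => [->|Ny] //.
    - case: (eqVneq y c) => [->|Nyc] E E'; first by rewrite E eqxx in Nut.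
      by case/eqP: Nyc; apply: H2 => //; rewrite ?Ec ?Er.
    - case: (eqVneq x c) => [->|Nxc] E E'; first by rewrite E eqxx in Nut.
      by case/eqP: Nxc; apply: H2 => //; rewrite ?Ec ?Er.
    - case: (eqVneq x c) => [->|Nxc]; case: (eqVneq y c) => [->|Nyc] //.
      + by move=> E E'; case/eqP: Ny; apply: H2; rewrite // -?E' ?Er -?E ?Et'.
      + by move=> E E'; case/eqP: Nx; apply: H2; rewrite // ?E' ?Er ?E ?Et'.
      + exact: H2.
  have Dct : D c t.
    by case: tourD => _ /(_ c t Nct); rewrite (negbTE NDtc) addbF.
  (* Here [c] takes the slot of [t], [t'] that of [c], and [t] becomes the child of [c] of rank
     [rk t']. The children of [t] of larger rank move up to [c]: they are outside [M], hence outside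
     [S], and [c] beats them by transitivity. *)
  pose up x := (par x == t) && (rk t' < rk x).
  exists (fun x => if x == t' then u else if x == t then c else if up x then c else par x).
  exists (fun x => if x == c then rk t else if x == t then rk t' else rk x).
  split; last first.
    apply: Closed => [|x xM Nx Nx' xv]; first by rewrite eqxx.
    rewrite (negbTE Nx') (negbTE Nx) ifF //; apply: contraNF Nx' => /andP [/eqP E _].
    by apply/eqP; apply: Ht.
  have upc : up c = false by rewrite /up Ec (negbTE Nut).
  have upt' : up t' = false by rewrite /up ltnn andbF.
  have upS x : up x -> x != v -> x != t' -> x \notin S.
    case/andP=> /eqP E _ xv Nx; apply: contra Nx => xS.
    by apply/eqP; apply: Ht => //; apply: (subsetP SM).
  split; first by rewrite !(eq_sym v) (negbTE cv) (negbTE tv).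
    move=> x xv; case: (eqVneq x t') => [->|Nx'].
      rewrite (eq_sym t') (negbTE Nct') (negbTE Ntt') (negbTE Nuc) (negbTE Nut).
      by split => //; apply: ltn_trans rtu.
    case: (eqVneq x t) => [->|Nx].
      by rewrite (eq_sym t) (negbTE Nct) eqxx.
    case: ifP => [Hu|Hu].
      rewrite eqxx; have /andP [/eqP E Hr] := Hu.
      have [Q1 Q2] := H1 x xv; rewrite E in Q1 Q2.
      have Nxc : x != c by apply: contraTneq Hu => ->; rewrite upc.
      by rewrite (negbTE Nxc); split => //; apply: transD Dct Q1 => //; apply: upS.
    have [Q1 Q2] := H1 x xv; split => //.
    case: (eqVneq x c) => [->|Nxc]; first by rewrite Ec (negbTE Nuc) (negbTE Nut).
    case: eqP => [E|_]; first by rewrite E Er in Q2; apply: ltn_trans rt't.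
    case: eqP => // E; rewrite ltn_neqAle leqNgt.
    move: Hu; rewrite /up E eqxx /= => ->; rewrite andbT.
    by apply: contraNneq Nx' => Ex; apply/eqP; apply: H2; rewrite // Et'.
  pose P x := if x == t' then u else if x == t then c else if up x then c else par x.
  pose R x := if x == c then rk t else if x == t then rk t' else rk x.
  suff: forall x y, x != v -> y != v -> P x = P y -> R x = R y -> x = y by [].
  have F1 y : y != v -> par y = u -> rk y = rk t' -> y = c.
    by move=> yv E E'; apply: H2; rewrite // ?Ec ?Er.
  have F2 y : y != v -> par y = u -> rk y = rk t -> y = t.
    by move=> yv E E'; apply: H2; rewrite // ?Eu.
  have F3 y : y != v -> par y = c -> rk y < rk t'.
    by move=> yv E; have [_] := H1 y yv; rewrite E Er.
  have K x : x != v ->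
      [\/ [/\ x = t', P x = u & R x = rk t'], [/\ x = t, P x = c & R x = rk t'],
          [/\ par x = t, rk t' < rk x, P x = c & R x = rk x] |
          [/\ x = c, P x = u & R x = rk t] \/
          [/\ x <> t, x <> c, P x = par x & R x = rk x]].
    move=> xv; rewrite /P /R.
    case: (eqVneq x t') => [->|Nx'].
      by apply: Or41; rewrite (eq_sym t') (negbTE Nct') (negbTE Ntt').
    case: (eqVneq x t) => [->|Nx].
      by apply: Or42; rewrite (eq_sym t) (negbTE Nct).
    case: (eqVneq x c) => [->|Nxc].
      by apply: Or44; left; rewrite upc.
    case: ifP => Hu; first by apply: Or43; case/andP: Hu => /eqP.
    by apply: Or44; right; split => //; apply/eqP.
  move: P R K => P R K x y xv yv.
  have Nuc' : u <> c by apply/eqP.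
  have Nrk : rk t' <> rk t by move=> E; move: rt't; rewrite E ltnn.
  case: (K x xv) => [[X -> ->]|[X -> ->]|[X1 X2 -> ->]|[[X -> ->]|[X1 X2 -> ->]]];
    case: (K y yv) => [[Y -> ->]|[Y -> ->]|[Y1 Y2 -> ->]|[[Y -> ->]|[Y1 Y2 -> ->]]] E E'.
  - by rewrite X Y.
  - by case: Nuc'.
  - by case: Nuc'.
  - by case: Nrk.
  - by case: Y2; apply: F1.
  - by case: Nuc'.
  - by rewrite X Y.
  - by move: Y2; rewrite -E' ltnn.
  - by case: Nuc'.
  - by have := F3 y yv (esym E); rewrite -E' ltnn.
  - by case: Nuc'.
  - by move: X2; rewrite E' ltnn.
  - by apply: H2; rewrite // X1 Y1.
  - by case: Nuc'.
  - by have := F3 y yv (esym E); rewrite -E' ltnNge (ltnW X2).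
  - by case: Nrk.
  - by case: Nuc'.
  - by case: Nuc'.
  - by rewrite X Y.
  - by case: Y1; apply: F2.
  - by case: X2; apply: F1.
  - by have := F3 x xv E; rewrite E' ltnn.
  - by have := F3 x xv E; rewrite E' ltnNge (ltnW Y2).
  - by case: X1; apply: F2.
  - exact: H2.
(* The slot of rank [rk t'] below [u] is free. *)
exists (fun x => if x == t' then u else par x), rk; split; last first.
  by apply: Closed => [|x _ _ Nx' _]; rewrite ?eqxx // (negbTE Nx').
split => //.
  move=> x xv; case: eqP => [->|_]; first by split => //; apply: ltn_trans rtu.
  exact: H1.
move=> x y xv yv; case: (eqVneq x t') => [->|Nx]; case: (eqVneq y t') => [->|Ny] // E E'.
- by have := N y; rewrite /= yv -E E' !eqxx.
- by have := N x; rewrite /= xv E E' !eqxx.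
- exact: H2.
Qed.

Section Count.
Variables (par : V -> V) (rk : V -> nat) (M : {set V}).
Hypothesis arb : arbor par rk.
Hypothesis SM : S \subset M.
Hypothesis Mc : pclosed par M.

Definition kids (x : V) : {set V} := [set y in M :\ v | par y == x].

Lemma card_kids (X : {set V}) :
  #|[set y in M :\ v | par y \in X]| = \sum_(x in X) #|kids x|.
Proof.
rewrite -sum1_card (partition_big par (mem X)) /=; last by move=> y; rewrite inE => /andP [].
apply: eq_bigr => x xX; rewrite -sum1_card; apply: eq_bigl => y.
rewrite !inE; case: (eqVneq (par y) x) => [->|_]; last by rewrite !andbF.
by rewrite xX !andbT.
Qed.

(* The skeleton nodes outside [S] have, in a skeleton that cannot be shortened, either several
   children, or a child in [S], or a parent with several children or in [S]. *)
Lemma skeleton_card :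
  (forall t, t \in M -> t \notin S -> 0 < #|kids t|) ->
  (forall t t', t \in M -> t \notin S -> par t \notin S -> kids t = [set t'] -> t' \notin S ->
     1 < #|kids (par t)|) ->
  #|M| <= 5 * #|S|.
Proof.
move=> Hpos Hun.
pose B := [set x in M :\: S | 1 < #|kids x|].
pose U := [set x in M :\: S | #|kids x| == 1].
pose Y := [set y in M :\ v | par y \notin U].
have vM : v \in M by apply: (subsetP SM).
have HM : #|M| = #|S| + #|B| + #|U|.
  have -> : M = S :|: (B :|: U).
    apply/setP => x; rewrite !inE; case: (boolP (x \in S)) => [/(subsetP SM) ->|xS] //=.
    case: (boolP (x \in M)) => //= xM; have := Hpos x xM xS.
    by case: (#|kids x|) => [|[|k]].
  rewrite cardsU disjoint_setI0 ?cards0 ?subn0; last first.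
    rewrite -setI_eq0; apply/eqP/setP => x; rewrite !inE.
    by case: (x \in S); rewrite //= ?andbF.
  rewrite -addnA cardsU disjoint_setI0 ?cards0 ?subn0 // -setI_eq0.
  apply/eqP/setP => x; rewrite !inE; apply/negbTE/negP.
  by case/andP=> /andP [_ H1] /andP [_ /eqP H2]; rewrite H2 in H1.
(* Count the nodes other than [v] by their parents: each node of [U] contributes one child. *)
have HY : #|M| = (#|Y| + #|U|).+1.
  rewrite (cardsD1 v M) vM add1n; congr _.+1.
  rewrite -(cardsID [set y | par y \notin U] (M :\ v)); congr (_ + _).
    by apply: eq_card => y; rewrite !inE.
  have -> : (M :\ v) :\: [set y | par y \notin U] = [set y in M :\ v | par y \in U].
    by apply/setP => y; rewrite !inE negbK andbC.
  rewrite card_kids -sum1_card; apply: eq_bigr => x; rewrite inE => /andP [_ /eqP //].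
have HB : 2 * #|B| <= #|Y|.
  apply: leq_trans (_ : #|[set y in M :\ v | par y \in B]| <= _); last first.
    apply: subset_leq_card; apply/subsetP => y; rewrite !inE => /andP [-> /=].
    by case/andP=> -> /=; case: (#|kids (par y)|) => [|[|k]].
  rewrite card_kids mulnC -sum_nat_const; apply: leq_sum => x; rewrite inE => /andP [_ //].
(* A unary node with its child in [S] is charged to that child. Any other has, by [Hun], a parent in
   [S] or with several children, so it belongs to [Y]. *)
have HU : #|U| <= #|Y| + #|S|.
  pose US := [set x in U | x \in par @: S].
  pose UT := [set x in U | x \notin par @: S].
  have -> : U = US :|: UT.
    by apply/setP => x; rewrite !inE; case: (x \in par @: S); rewrite ?andbT ?andbF ?orbF.
  apply: leq_trans (leq_card_setU _ _) _; rewrite addnC; apply: leq_add; last first.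
    apply: leq_trans (leq_imset_card par S); apply: subset_leq_card.
    by apply/subsetP => x; rewrite inE => /andP [].
  apply: subset_leq_card; apply/subsetP => t; rewrite !inE.
  case/andP=> /andP [/andP [tS tM] /cards1P [t' Et]] tI.
  rewrite tM (notS_neq_v tS) /=; apply/negP => /andP [/andP [uS uM] /eqP Hu].
  have Ht' : t' \in kids t by rewrite Et set11.
  move: Ht'; rewrite !inE => /andP [/andP [t'v t'M] /eqP Ept].
  have t'S : t' \notin S.
    by apply: contra tI => t'S; apply/imsetP; exists t'.
  by have := Hun t t' tM tS uS Et t'S; rewrite Hu.
have : 0 < #|S| by apply/card_gt0P; exists v.
(* Origin of the 5: [HM] and [HY] give |Y| + 1 = |S| + |B|, so |Y| <= 2 |S| - 2 by [HB] and |U| <= 3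
   |S| - 2 by [HU], whence |M| = |Y| + |U| + 1 <= 5 |S| - 3. *)
lia.
Qed.
End Count.

Lemma skeleton_reduce par rk (M : {set V}) :
  arbor par rk -> S \subset M -> pclosed par M -> 5 * #|S| < #|M| ->
  exists par' rk' (M' : {set V}),
    [/\ arbor par' rk', S \subset M', pclosed par' M' & #|M'| < #|M|].
Proof.
move=> arb SM Mc HM.
have Small t : t \in M -> t \notin S -> S \subset M :\ t /\ #|M :\ t| < #|M|.
  move=> tM tS; split; last by rewrite [X in _ < X](cardsD1 t) tM.
  apply/subsetP => x xS; rewrite in_setD1 (subsetP SM) // andbT.
  by apply: contraNneq tS => <-.
case: (pickP [pred t | [&& t \in M, t \notin S & #|kids par M t| == 0]]) =>
    [t /and3P [tM tS /eqP/cards0_eq H0]|N0].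
  (* A node outside [S] without children in [M] merely leaves the template; the arborescence does
     not change. *)
  have [S1 S2] := Small t tM tS.
  exists par, rk, (M :\ t); split => // x; rewrite in_setD1 => /andP [Nx xM] xv.
  rewrite in_setD1 Mc // andbT; apply/negP => /eqP E.
  by move/setP/(_ x): H0; rewrite !inE xM xv E eqxx.
case: (pickP [pred tt : V * V | [&& tt.1 \in M, tt.1 \notin S, par tt.1 \notin S,
     kids par M tt.1 == [set tt.2], tt.2 \notin S & #|kids par M (par tt.1)| <= 1]])
   => [[t t'] /and5P [/= tM tS uS /eqP Et /andP [t'S Hu]]|N1].
  have [S1 S2] := Small t tM tS.
  have Kin x : x \in M -> x != v -> x \in kids par M (par x) by move=> xM xv; rewrite !inE xM xv eqxx.
  have : t' \in kids par M t by rewrite Et set11.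
  rewrite !inE => /andP [/andP [t'v t'M] /eqP Ept].
  have [par' [rk' [A1 A2]]] : exists par' rk', arbor par' rk' /\ pclosed par' (M :\ t).
    apply: (@shorten par rk M (par t) t t') => //.
      by move=> x xM xv E; have := Kin x xM xv; rewrite E Et => /set1P.
    move=> c cM cv Ec Er.
    have Ect : c = t.
      have tv := notS_neq_v tS.
      have tK := Kin t tM tv; have cK := Kin c cM cv; rewrite Ec in cK.
      by have/card_le1_eqP H := Hu; apply: H.
    case: arb => _ H1 _; have [_] := H1 t' t'v.
    by rewrite Ept -Ect Er ltnn.
  by exists par', rk', (M :\ t).
exfalso; move: HM; rewrite ltnNge => /negP; apply; apply: (@skeleton_card par M) => //.
  by move=> t tM tS; have := N0 t; rewrite /= tM tS /= lt0n => ->.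
move=> t t' tM tS uS Et t'S; have := N1 (t, t').
by rewrite /= tM tS uS t'S Et eqxx /= leqNgt => /negbFE.
Qed.

Lemma arbor_skeleton par rk : arbor par rk ->
  exists par' rk' (M : {set V}),
    [/\ arbor par' rk', S \subset M, pclosed par' M & #|M| <= 5 * #|S|].
Proof.
move=> arb.
suff: forall k par rk (M : {set V}), #|M| <= k -> arbor par rk -> S \subset M -> pclosed par M ->
   exists par' rk' (M : {set V}),
    [/\ arbor par' rk', S \subset M, pclosed par' M & #|M| <= 5 * #|S|].
  by move/(_ _ par rk [set: V] (leqnn _)); apply => // u; rewrite inE.
elim=> [|k IH] {arb par rk} par rk M HM arb SM Mc.
  by exists par, rk, M; split => //; apply: leq_trans HM _.
case: (leqP #|M| (5 * #|S|)) => H; first by exists par, rk, M.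
have [par' [rk' [M' [A1 A2 A3 A4]]]] := skeleton_reduce arb SM Mc H.
by apply: (IH par' rk' M') => //; rewrite -ltnS; apply: leq_trans A4 HM.
Qed.
End Skeleton.

(** * Runs of the placement procedure *)

Section Runs.
Variables (D : rel nat) (S pw : seq nat) (m : nat) (par rk : seq nat).
Hypothesis S_gt0 : 0 < size S.
Hypothesis S_le_m : size S <= m.
Hypothesis tmpl_valid : valid D S pw m par rk.

Lemma behead_iota i k : (i \in behead (iota 0 k)) = (0 < i < k).
Proof. by case: k => [|k]; rewrite ?mem_iota ?add1n //; case: i. Qed.

Lemma valid_nodeP i : 0 < i < m -> valid_node D S m par rk i.
Proof. by case/andP: tmpl_valid => _ /allP H Hi; apply: H; rewrite behead_iota. Qed.

Lemma par_lt i : 0 < i < m -> nth 0 par i < m.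
Proof. by case/valid_nodeP/and4P. Qed.

Lemma rk_lt i : 0 < i < m -> nth 0 rk i < nth 0 rk (nth 0 par i).
Proof. by case/valid_nodeP/and4P. Qed.

Lemma node_inj i j : 0 < i < m -> 0 < j < m -> nth 0 par i = nth 0 par j ->
  nth 0 rk i = nth 0 rk j -> i = j.
Proof.
move=> Hi Hj E1 E2; have /and4P [_ _ /allP H _] := valid_nodeP Hi.
by have := H j; rewrite behead_iota Hj E1 E2 !eqxx orbF => /(_ isT) /eqP.
Qed.

Lemma valid_arc i : 0 < i < size S -> nth 0 par i < size S ->
  D (nth 0 S (nth 0 par i)) (nth 0 S i).
Proof.
move=> Hi Hp; have Hm : 0 < i < m by lia.
have /and4P [_ _ _] := valid_nodeP Hm.
by have -> : i < size S by [lia]; rewrite Hp.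
Qed.

Definition cntof (a : seq (option nat)) (i : nat) : nat := count_mem (Some i) a.

Lemma cntof_rcons a x i : cntof (rcons a x) i = cntof a i + (if x == Some i then 1 else 0).
Proof. by rewrite /cntof -cats1 count_cat /= addn0; case: (x == _). Qed.

Lemma weight_ext c c' : (forall j, j < m -> c j = c' j) ->
  weight S pw m par rk c = weight S pw m par rk c'.
Proof.
move=> H; congr sumn; apply/eq_in_map => i; rewrite mem_iota add0n => /andP [_ Hi].
by rewrite /node_weight H.
Qed.

Lemma legit_ext c c' t i : i < m -> (forall j, j < m -> c j = c' j) ->
  legit D S m par rk c t i = legit D S m par rk c' t i.
Proof.
move=> Hi H; rewrite /legit; case: ifP => Hs; first by rewrite H.
rewrite H //; case: ifP => Hp //; rewrite H //; apply: par_lt; lia.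
Qed.

Definition legit_opt (a : seq (option nat)) (t : nat) (x : option nat) : bool :=
  if x is Some i then (i < m) && legit D S m par rk (cntof a) t i else true.

(* A run assigns each player outside [S] to a node of the template ([Some i]) or makes it a
   filler ([None]). *)
Definition okrun (T : seq nat) (a : seq (option nat)) : Prop :=
  size a = size T /\ forall k, k < size T ->
    legit_opt (take k a) (nth 0 T k) (nth None a k) /\
    k < weight S pw m par rk (cntof (take k.+1 a)).

Lemma okrun_rcons T t a x : okrun (rcons T t) (rcons a x) <->
  [/\ okrun T a, legit_opt a t x & size T < weight S pw m par rk (cntof (rcons a x))].
Proof.
split.
  case; rewrite !size_rcons => [[Ea] H]; split.
  - split=> // k Hk; have [] := H k; first by apply: ltnW.
    rewrite !nth_rcons Ea Hk -cats1 !takel_cat ?Ea ?(ltnW Hk) //.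
  - have [] := H (size T) (ltnSn _).
    by rewrite !nth_rcons Ea ltnn eqxx -cats1 takel_cat ?Ea // take_oversize // Ea.
  - have [_] := H (size T) (ltnSn _).
    by rewrite take_oversize // size_rcons Ea.
case=> -[Ea H] H1 H2; split; first by rewrite !size_rcons Ea.
move=> k; rewrite size_rcons ltnS leq_eqVlt => /orP [/eqP ->|Hk].
  rewrite !nth_rcons Ea ltnn eqxx -cats1 takel_cat ?Ea // take_oversize ?Ea //.
  by rewrite cats1 take_oversize // size_rcons Ea.
have [] := H k Hk.
by rewrite !nth_rcons Ea Hk -cats1 !takel_cat ?Ea ?(ltnW Hk).
Qed.

Lemma okrun0 : okrun [::] [::]. Proof. by []. Qed.

Lemma dp_rcons U T t :
  dp D S pw m par rk U (rcons T t) =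
  ([seq y <- U | has (fun x => dstep D S pw m par rk t (size T) x y) (dp D S pw m par rk U T).1],
   (size T).+1).
Proof.
have H2 T' : (dp D S pw m par rk U T').2 = size T'.
  by elim/last_ind: T' => [|T' t' IH] //; rewrite /dp foldl_rcons /= -/(dp _ _ _ _ _ _ _ _) IH size_rcons.
by rewrite {1}/dp foldl_rcons -/(dp _ _ _ _ _ _ _ _) H2.
Qed.

(** A state forgets which player went where; tracing its transitions back recovers one such run. *)
Lemma dp_sound U T y : y \in (dp D S pw m par rk U T).1 ->
  exists a, okrun T a /\ forall j, j < m -> nth 0 y j = cntof a j.
Proof.
elim/last_ind: T y => [|T t IH] y.
  rewrite mem_filter => /andP [/allP H _]; exists [::]; split => // j Hj.
  by apply/eqP; apply: H; rewrite mem_iota.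
rewrite dp_rcons mem_filter => /andP [/hasP [x Hx /andP [Hstep Hw]] _].
have [a [Ha Ea]] := IH x Hx.
have [z [Hz Ez]] : exists z, legit_opt a t z /\ forall j, j < m -> nth 0 y j = cntof (rcons a z) j.
  case/orP: Hstep => [/allP H|/hasP [i]].
    exists None; split => // j Hj; rewrite cntof_rcons addn0 -Ea //.
    by apply/eqP; apply: H; rewrite mem_iota.
  rewrite mem_iota add0n => /andP [_ Hi] /andP [Hl /allP Hb].
  exists (Some i); split; first by rewrite /= Hi -(@legit_ext (nth 0 x)).
  move=> j Hj; rewrite cntof_rcons -Ea // (inj_eq Some_inj) (eq_sym i).
  by apply/eqP; apply: Hb; rewrite mem_iota.
exists (rcons a z); split => //; apply/okrun_rcons; split => //.
by rewrite -(weight_ext Ez).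
Qed.

Lemma size_pures i : size (pures m par rk i) <= nth 0 rk i.
Proof. by rewrite size_filter; apply: leq_trans (count_size _ _) _; rewrite size_rev size_iota. Qed.

(** Keeps the states inside the universe: a player of [S] has at most as many free slots as its
    rank, and a node outside [S] receives at most one player. *)
Lemma cntof_bound q T a i : 1 < q -> (forall i, nth 0 rk i < q) -> okrun T a -> cntof a i < q.
Proof.
move=> Hq Hr; elim/last_ind: T a => [|T t IH] a; first by case=> /size0nil ->; rewrite /cntof /=; lia.
case/lastP: a => [|a x]; first by case; rewrite size_rcons.
case/okrun_rcons=> Ha Hx _; rewrite cntof_rcons; have := IH a Ha.
case: eqP => [E|_]; last by lia.
move: Hx; rewrite E /= /legit => /andP [_]; case: ifP => _.
  by case/andP=> _; have := size_pures i; have := Hr i; lia.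
by case/and3P=> /eqP -> _ _; lia.
Qed.

Lemma dp_complete L q T a : m <= L -> 1 < q -> (forall i, nth 0 rk i < q) -> okrun T a ->
  mkseq (cntof a) L \in (dp D S pw m par rk (univ L q) T).1.
Proof.
move=> HL Hq Hr.
have HU a' T' : okrun T' a' -> mkseq (cntof a') L \in univ L q.
  move=> Ha; rewrite univP size_mkseq eqxx /=; apply/allP => x /mapP [i _ ->].
  exact: cntof_bound Ha.
have Hn a' j : j < m -> nth 0 (mkseq (cntof a') L) j = cntof a' j.
  by move=> Hj; rewrite nth_mkseq //; lia.
elim/last_ind: T a => [|T t IH] a.
  case=> /size0nil -> _; rewrite mem_filter (HU [::] [::] okrun0) andbT.
  by apply/allP => j; rewrite mem_iota => /andP [_ Hj]; rewrite Hn.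
case/lastP: a => [|a x]; first by case; rewrite size_rcons.
move=> Hax; have /okrun_rcons [Ha Hx Hw] := Hax.
rewrite dp_rcons mem_filter (HU _ _ Hax) andbT.
apply/hasP; exists (mkseq (cntof a) L); first exact: IH.
rewrite /dstep (@weight_ext _ (cntof (rcons a x))) ?Hw ?andbT; last by move=> j Hj; apply: Hn.
case: x Hx {Hax Hw} => [i|] Hx; last first.
  apply/orP; left; apply/allP => j; rewrite mem_iota => /andP [_ Hj].
  by rewrite !Hn // cntof_rcons addn0.
have /andP [Hi Hl] := Hx.
apply/orP; right; apply/hasP; exists i; first by rewrite mem_iota.
rewrite (@legit_ext _ (cntof a)) // ?Hl /=; last by move=> j Hj; apply: Hn.
apply/allP => j; rewrite mem_iota => /andP [_ Hj].
by rewrite !Hn // cntof_rcons (inj_eq Some_inj) (eq_sym i).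
Qed.
End Runs.

(** * Soundness *)

Lemma sum_pow2 r : (\sum_(j <- iota 0 r) 2 ^ j).+1 = 2 ^ r.
Proof.
elim: r => [|r IH]; first by rewrite big_nil.
by rewrite -(addn1 r) iotaD big_cat big_seq1 add0n -addSn IH expnD expn1 muln2 addnn.
Qed.

Lemma weight_bump S pw m par rk c c' i : i < m ->
  (forall j, j < m -> j != i -> c' j = c j) ->
  weight S pw m par rk c' + node_weight S pw m par rk c i =
  weight S pw m par rk c + node_weight S pw m par rk c' i.
Proof.
move=> Hi H; rewrite /weight !sumnE !big_map.
have Hm : i \in iota 0 m by rewrite mem_iota.
rewrite !(bigD1_seq i) ?iota_uniq //=.
have -> : \sum_(j <- iota 0 m | j != i) node_weight S pw m par rk c' j =
          \sum_(j <- iota 0 m | j != i) node_weight S pw m par rk c j.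
  rewrite big_seq_cond [RHS]big_seq_cond; apply: eq_bigr => j.
  by rewrite mem_iota => /andP [/andP [_ Hj] Nj]; rewrite /node_weight H.
lia.
Qed.

(** * Slots for the players of a run *)

Section Slots.
Variables (D : rel nat) (S pw : seq nat) (m : nat) (par rk : seq nat).
Hypothesis S_gt0 : 0 < size S.
Hypothesis S_le_m : size S <= m.
Hypothesis tmpl_valid : valid D S pw m par rk.
Hypothesis pw_le : forall j, nth 0 pw j <= 2 ^ j.

Notation pur := (pures m par rk).
Notation wt := (weight S pw m par rk).
Notation s := (size S).

Lemma pures_uniq i : uniq (pur i).
Proof. by rewrite filter_uniq // rev_uniq iota_uniq. Qed.

Lemma mem_pures i j : (j \in pur i) = ~~ has_child m par rk i j && (j < nth 0 rk i).
Proof. by rewrite mem_filter mem_rev mem_iota. Qed.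

Lemma sum_pw_le (l : seq nat) : sumn [seq nth 0 pw j | j <- l] <= \sum_(j <- l) 2 ^ j.
Proof. by rewrite sumnE big_map; apply: leq_sum. Qed.

Variable vt : nat -> nat.

(** A slot is a pair of a parent and a rank. A filler hangs below an earlier player, at a rank not
    reserved for a template child; [vt] stands for the player of a template node, known only at the
    end of the run. *)
Definition slot_ok (T : seq nat) (a : seq (option nat)) (sl : seq (nat * nat)) (k : nat) : Prop :=
  match nth None a k with
  | None => exists k', [/\ k' < k, (nth (0, 0) sl k).1 = nth 0 T k',
       (nth (0, 0) sl k).2 < (nth (0, 0) sl k').2 &
       forall i, nth None a k' = Some i -> s <= i -> (nth (0, 0) sl k).2 \in pur i]
  | Some i => nth (0, 0) sl k =
       if i < s then (nth 0 S i, nth 0 (pur i) (cntof (take k a) i))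
       else (vt (nth 0 par i), nth 0 rk i)
  end.

Definition free_ok (T : seq nat) (a : seq (option nat)) (sl : seq (nat * nat))
    (x : nat * nat) : Prop :=
  exists k', [/\ k' < size T, x.1 = nth 0 T k', x.2 < (nth (0, 0) sl k').2 &
     forall i, nth None a k' = Some i -> s <= i -> x.2 \in pur i].

Definition fillers (a : seq (option nat)) (sl : seq (nat * nat)) : seq (nat * nat) :=
  [seq x.2 | x <- zip a sl & x.1 == None].

(** [sl] lists the slots taken and [Av] those open to fillers. By the last clause the capacity is
    covered by the players placed and the volume of the open slots. *)
Definition inv (T : seq nat) (a : seq (option nat)) (sl Av : seq (nat * nat)) : Prop :=
  [/\ size sl = size T, (forall k, k < size T -> slot_ok T a sl k),
      (forall x, x \in Av ++ fillers a sl -> free_ok T a sl x),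
      uniq (Av ++ fillers a sl) &
      wt (cntof a) <= \sum_(x <- Av) 2 ^ x.2 + size T].

Lemma fillers_rcons a x sl y : size a = size sl ->
  fillers (rcons a x) (rcons sl y) =
  if x == None then rcons (fillers a sl) y else fillers a sl.
Proof.
move=> E; rewrite /fillers zip_rcons // filter_rcons /=.
by case: ifP => // _; rewrite map_rcons.
Qed.

Lemma free_ok_rcons T t a z sl y x : size a = size T -> size sl = size T ->
  free_ok T a sl x -> free_ok (rcons T t) (rcons a z) (rcons sl y) x.
Proof.
move=> Ea Es [k' [H1 H2 H3 H4]]; exists k'.
rewrite size_rcons !nth_rcons Ea Es H1; split => //; lia.
Qed.

Lemma slot_ok_rcons T t a z sl y k : size a = size T -> size sl = size T -> k < size T ->
  slot_ok T a sl k -> slot_ok (rcons T t) (rcons a z) (rcons sl y) k.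
Proof.
move=> Ea Es Hk; rewrite /slot_ok nth_rcons Ea Hk.
case: (nth None a k) => [i|].
  by rewrite nth_rcons Es Hk -cats1 takel_cat // Ea ltnW.
case=> k' [H1 H2 H3 H4]; exists k'; have Hk' := ltn_trans H1 Hk.
by rewrite !nth_rcons Es Ea Hk Hk'; split.
Qed.

(* Extending a run by the player [t] with slot [y], which opens the slots [(t, j)], [j] in [R]. *)
Lemma inv_extend T t a z sl Av Av' y R :
  size a = size T -> uniq (rcons T t) -> inv T a sl Av -> uniq R ->
  slot_ok (rcons T t) (rcons a z) (rcons sl y) (size T) ->
  (forall j, j \in R -> j < y.2) ->
  (forall i j, z = Some i -> s <= i -> j \in R -> j \in pur i) ->
  perm_eq Av (if z == None then y :: Av' else Av') ->
  wt (cntof (rcons a z)) <= \sum_(j <- R) 2 ^ j + \sum_(x <- Av') 2 ^ x.2 + (size T).+1 ->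
  inv (rcons T t) (rcons a z) (rcons sl y) ([seq (t, j) | j <- R] ++ Av').
Proof.
move=> Ea UT [Es I1 I2 I3 I4] UR Hs HR HRp Hp Hw.
have Ft : t \notin T by move: UT; rewrite rcons_uniq => /andP [].
have Eas : size a = size sl by rewrite Ea Es.
pose F' := fillers (rcons a z) (rcons sl y).
have Pp : perm_eq (Av' ++ F') (Av ++ fillers a sl).
  rewrite /F' fillers_rcons //; case: (z == None) Hp => Hp.
    rewrite -cats1 catA perm_catC /= perm_sym -cat_cons; exact: perm_cat.
  by apply: perm_cat => //; rewrite perm_sym.
have Old x : x \in Av' ++ F' -> free_ok T a sl x by rewrite (perm_mem Pp); apply: I2.
split; rewrite -/F'.
- by rewrite !size_rcons Es.
- move=> k; rewrite size_rcons ltnS leq_eqVlt => /orP [/eqP -> //|Hk].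
  by apply: slot_ok_rcons => //; apply: I1.
- move=> x; rewrite -catA mem_cat => /orP [|/Old]; last exact: free_ok_rcons.
  case/mapP=> j Hj ->; exists (size T).
  rewrite size_rcons !nth_rcons Ea Es ltnn eqxx; split => //=; first exact: HR.
  by move=> i Ei Hi; apply: (HRp i).
- rewrite -catA cat_uniq (perm_uniq Pp) I3 andbT map_inj_uniq ?UR; last by move=> j j' [].
  rewrite /=; apply/hasPn => x Hx; apply/negP => /mapP [j _ Ex].
  have [k' [H1 H2 _ _]] := Old x Hx.
  have Et : x.1 = t by rewrite Ex.
  by move: Ft; rewrite -Et H2 mem_nth.
- rewrite size_rcons big_cat big_map /=; exact: Hw.
Qed.

(** Each player placed at rank r opens slots of volume at most 2^r - 1, and exactly that when none
    is reserved for the template; so a filler turns one unit of free volume into a placed player,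
    whichever open slot it takes. *)
Lemma inv_exists T a : uniq T -> okrun D S pw m par rk T a -> exists sl Av, inv T a sl Av.
Proof.
elim/last_ind: T a => [|T t IH] a UT.
  case=> /size0nil -> _; exists [::], [::]; split => //.
  rewrite big_nil addn0 /weight sumnE big_map big1 // => i _.
  by rewrite /node_weight /= take0; case: ifP.
case/lastP: a => [|a z]; first by case; rewrite size_rcons.
case/okrun_rcons=> Ha Hz Hw.
have UT' : uniq T by move: UT; rewrite rcons_uniq => /andP [].
have [sl [Av I]] := IH a UT' Ha.
have Ea : size a = size T by case: Ha.
have Es : size sl = size T by case: I.
have I5 : wt (cntof a) <= \sum_(x <- Av) 2 ^ x.2 + size T by case: I.
have Ntha w : nth None (rcons a w) (size T) = w by rewrite nth_rcons Ea ltnn eqxx.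
have Nths y : nth (0, 0) (rcons sl y) (size T) = y by rewrite nth_rcons Es ltnn eqxx.
have Tka w : take (size T) (rcons a w) = a by rewrite -cats1 takel_cat -Ea // take_size.
case: z Hz Hw => [i|_ Hw].
  move=> /andP [Hi Hl] _.
  have Hb := @weight_bump S pw m par rk (cntof a) (cntof (rcons a (Some i))) i Hi.
  have {}Hb := Hb ltac:(by move=> j _ Nj; rewrite cntof_rcons (inj_eq Some_inj) eq_sym (negbTE Nj) addn0).
  have Ci : cntof (rcons a (Some i)) i = (cntof a i).+1 by rewrite cntof_rcons eqxx addn1.
  move: Hl; rewrite /legit; case: ifP => Hs.
    case/andP=> _ Hc; set r := nth 0 (pur i) (cntof a i).
    exists (rcons sl (nth 0 S i, r)), ([seq (t, j) | j <- iota 0 r] ++ Av).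
    apply: (inv_extend Ea UT I) => //.
    - exact: iota_uniq.
    - by rewrite /slot_ok Ntha Nths Hs Tka.
    - by move=> j; rewrite mem_iota.
    - by move=> i' j [<-]; rewrite leqNgt Hs.
    - have := sum_pow2 r; have := pw_le r.
      move: Hb; rewrite /node_weight Hs Ci (take_nth 0 Hc) map_rcons sumn_rcons -/r.
      move: I5 (\sum_(j <- iota 0 r) _) (2 ^ r) (sumn _) => *; lia.
  have Hs' : s <= i by rewrite leqNgt Hs.
  case/and3P=> /eqP Hc _ _.
  exists (rcons sl (vt (nth 0 par i), nth 0 rk i)), ([seq (t, j) | j <- pur i] ++ Av).
  apply: (inv_extend Ea UT I) => //.
  - exact: pures_uniq.
  - by rewrite /slot_ok Ntha Nths Hs.
  - by move=> j; rewrite mem_pures => /andP [].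
  - by move=> i' j [<-].
  - have := sum_pw_le (pur i); move: Hb; rewrite /node_weight Hs Ci Hc /=.
    move: I5; set A := \sum_(x <- Av) _; set B := \sum_(j <- pur i) _.
    move: A B (wt _) (wt _) (sumn _) (size T) => A B w w' k j; clear; lia.
have Hw' : size T < wt (cntof a).
  by rewrite -(@weight_ext S pw m par rk (cntof (rcons a None))) // => j _; rewrite cntof_rcons addn0.
(* Without an open slot the capacity would be at most [size T], contrary to the counting condition
   of the run. *)
case: Av I I5 => [|y Av] I I5; first by move: I5; rewrite big_nil; lia.
exists (rcons sl y), ([seq (t, j) | j <- iota 0 y.2] ++ Av).
have [_ _ /(_ y) Hy _ _] := I.
have [k' [H1 H2 H3 H4]] := Hy ltac:(by rewrite mem_head).
apply: (inv_extend Ea UT I) => //.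
- exact: iota_uniq.
- rewrite /slot_ok Ntha Nths; exists k'; rewrite !nth_rcons Es Ea H1; split => //.
- by move=> j; rewrite mem_iota.
- rewrite (@weight_ext S pw m par rk _ (cntof a)) => [|j _]; last by rewrite cntof_rcons addn0.
  have := sum_pow2 y.2; move: I5; rewrite big_cons.
  by move: (\sum_(j <- iota 0 y.2) _) (2 ^ y.2) => *; lia.
Qed.
End Slots.

(** * The arborescence of a run *)

Section Placement.
Variables (D : rel nat) (S T pw : seq nat) (m : nat) (par rk : seq nat) (a : seq (option nat)).
Hypothesis S_gt0 : 0 < size S.
Hypothesis S_le_m : size S <= m.
Hypothesis tmpl_valid : valid D S pw m par rk.
Hypothesis pw_le : forall j, nth 0 pw j <= 2 ^ j.
Hypothesis uST : uniq (S ++ T).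
Hypothesis sortT : forall i j, i < j -> j < size T -> D (nth 0 T i) (nth 0 T j).
Hypothesis run_a : okrun D S pw m par rk T a.
Hypothesis final_a : forall i, size S <= i < m -> cntof a i = 1.

Notation s := (size S).
Notation pur := (pures m par rk).

Definition pos (i : nat) : nat := index (Some i) a.
Definition vert (i : nat) : nat := if i < s then nth 0 S i else nth 0 T (pos i).

Let size_a : size a = size T. Proof. by case: run_a. Qed.
Let uS : uniq S. Proof. by move: uST; rewrite cat_uniq => /and3P []. Qed.
Let uT : uniq T. Proof. by move: uST; rewrite cat_uniq => /and3P []. Qed.
Let notST x : x \in T -> x \notin S.
Proof. by move=> xT; move: uST; rewrite cat_uniq => /and3P [_ /hasPn H _]; apply: H. Qed.

Lemma pos_lt i : s <= i < m -> pos i < size T.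
Proof. by move=> Hi; rewrite -size_a index_mem -has_pred1 has_count -/(cntof a i) (final_a Hi). Qed.

Lemma nth_pos i : s <= i < m -> nth None a (pos i) = Some i.
Proof. by move=> Hi; rewrite nth_index // -index_mem size_a; apply: pos_lt. Qed.

Lemma legit_at k i : k < size T -> nth None a k = Some i ->
  i < m /\ legit D S m par rk (cntof (take k a)) (nth 0 T k) i.
Proof. by case: run_a => _ H Hk Ei; have [] := H k Hk; rewrite Ei /= => /andP []. Qed.

Lemma pos_eq k i : k < size T -> nth None a k = Some i -> s <= i -> pos i = k.
Proof.
move=> Hk Ei Hi; have [_] := legit_at Hk Ei.
rewrite /legit ltnNge Hi /= => /and3P [/eqP H0 _ _].
have Nt : Some i \notin take k a by rewrite -has_pred1 has_count -/(cntof (take k a) i) H0.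
rewrite /pos -{1}(cat_take_drop k a) index_cat (negbTE Nt) size_takel ?size_a ?(ltnW Hk) //.
by rewrite (drop_nth None) ?size_a // Ei /= eqxx addn0.
Qed.

Lemma vert_mem i : i < m -> vert i \in S ++ T.
Proof.
move=> Hi; rewrite mem_cat /vert; case: ltnP => Hs; first by rewrite mem_nth.
by rewrite mem_nth ?orbT // pos_lt // Hs.
Qed.

Lemma vert_S i x : i < m -> x < s -> vert i = nth 0 S x -> i = x.
Proof.
move=> Hi Hx; rewrite /vert; case: ltnP => Hs.
  by move/eqP; rewrite nth_uniq // => /eqP.
move=> E; have := @notST (nth 0 T (pos i)); rewrite mem_nth; last by rewrite pos_lt ?Hs.
by rewrite E mem_nth // => /(_ isT).
Qed.

Lemma vert_T i k : i < m -> k < size T -> vert i = nth 0 T k -> s <= i /\ nth None a k = Some i.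
Proof.
move=> Hi Hk; rewrite /vert; case: ltnP => Hs E.
  by have := @notST (nth 0 T k); rewrite -E mem_nth // E mem_nth // => /(_ isT).
have Hp : pos i < size T by rewrite pos_lt ?Hs.
split => //; move/eqP: E; rewrite nth_uniq // => /eqP <-.
by rewrite nth_pos ?Hs.
Qed.

Lemma vert_inj i j : i < m -> j < m -> vert i = vert j -> i = j.
Proof.
move=> Hi Hj; case: (ltnP j s) => Hs E.
  by apply: vert_S; rewrite // E /vert Hs.
have Hp : pos j < size T by rewrite pos_lt ?Hs.
have Ev : vert i = nth 0 T (pos j) by rewrite E /vert ltnNge Hs.
have [_] := vert_T Hi Hp Ev.
by rewrite nth_pos ?Hs // => -[].
Qed.

(** Players get distinct slots because the ranks in [pures] avoid those of template children, the
    counter of a player of [S] grows with each child it receives, and the slots of fillers form a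
    duplicate-free list. *)
Theorem arb_of_run :
  exists Par Rk, bin_arb D (S ++ T) (nth 0 S 0) (size pw).-1 Par Rk.
Proof.
have [sl [Av [Es I1 I2 I3 _]]] := inv_exists S_gt0 S_le_m tmpl_valid pw_le vert uT run_a.
pose slot u := if u \in S then (vert (nth 0 par (index u S)), nth 0 rk (index u S))
               else nth (0, 0) sl (index u T).
have slotS i : i < s -> slot (nth 0 S i) = (vert (nth 0 par i), nth 0 rk i).
  by move=> Hi; rewrite /slot mem_nth // index_uniq.
have slotT k : k < size T -> slot (nth 0 T k) = nth (0, 0) sl k.
  by move=> Hk; rewrite /slot (negbTE (notST (mem_nth _ Hk))) index_uniq.
have slotN i : 0 < i < m -> slot (vert i) = (vert (nth 0 par i), nth 0 rk i).
  case/andP=> H0 Hi; rewrite /vert; case: ltnP => Hs; first exact: slotS.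
  have Hp : pos i < size T by rewrite pos_lt ?Hs.
  rewrite slotT //; have := I1 _ Hp; rewrite /slot_ok nth_pos ?Hs //.
  by rewrite ltnNge Hs.
have rkV i : i < m -> (slot (vert i)).2 = nth 0 rk i.
  case: (posnP i) => [-> _|H0 Hi]; last by rewrite slotN // H0.
  by rewrite /vert S_gt0 slotS.
(* The players other than the favorite are template nodes ([isN]), children of a player of [S]
   outside the template ([isR]), or fillers ([isF]). *)
pose isN u := exists i, [/\ 0 < i < m, u = vert i & slot u = (vert (nth 0 par i), nth 0 rk i)].
pose isR u := exists k i, [/\ k < size T, u = nth 0 T k, nth None a k = Some i /\ i < s,
   cntof (take k a) i < size (pur i) &
   slot u = (nth 0 S i, nth 0 (pur i) (cntof (take k a) i))].
pose isF u := exists k, [/\ k < size T, u = nth 0 T k, nth None a k = None & slot u = nth (0, 0) sl k].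
have classify u : u \in S ++ T -> u != nth 0 S 0 -> [\/ isN u, isR u | isF u].
  rewrite mem_cat => /orP [uinS|uinT] Nu.
    apply: Or31; exists (index u S); have Hi : index u S < s by rewrite index_mem.
    have H0 : 0 < index u S by rewrite lt0n; apply: contra Nu => /eqP <-; rewrite nth_index.
    have Ev : vert (index u S) = u by rewrite /vert Hi nth_index.
    split; rewrite ?Ev ?H0 //=; first by apply: leq_trans Hi _.
    by rewrite -{1}Ev slotN // H0 (leq_trans Hi).
  have Hk : index u T < size T by rewrite index_mem.
  have Eu : u = nth 0 T (index u T) by rewrite nth_index.
  have Esl : slot u = nth (0, 0) sl (index u T) by rewrite {1}Eu slotT.
  case Ea : (nth None a (index u T)) => [i|]; last first.
    by apply: Or33; exists (index u T).
  have [Hi Hl] := legit_at Hk Ea; have := I1 _ Hk; rewrite /slot_ok Ea -Esl.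
  case: ltnP => Hs El.
    apply: Or32; exists (index u T), i; split => //.
    by move: Hl; rewrite /legit Hs => /andP [].
  apply: Or31; exists i; split => //; first by rewrite Hi (leq_trans S_gt0).
  by rewrite /vert ltnNge Hs /= (pos_eq Hk Ea Hs) -Eu.
have rkT k : k < size T -> (slot (nth 0 T k)).2 = (nth (0, 0) sl k).2 by move=> Hk; rewrite slotT.
exists (fun u => (slot u).1), (fun u => (slot u).2); split.
- by rewrite mem_cat mem_nth.
- by rewrite slotS //=; case/andP: tmpl_valid => /eqP.
- move=> u Hu Nu; case: (classify u Hu Nu).
  + case=> i [Hi Ei ->] /=; rewrite rkV ?(par_lt tmpl_valid Hi) //.
    split; [by rewrite vert_mem // (par_lt tmpl_valid Hi) | | exact: (rk_lt tmpl_valid Hi)].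
    have Hpi := par_lt tmpl_valid Hi.
    rewrite Ei; case: (ltnP i s) => Hs.
      rewrite {2}/vert Hs; case: (ltnP (nth 0 par i) s) => Hp.
        rewrite /vert Hp; apply: (valid_arc S_gt0 S_le_m tmpl_valid) => //; lia.
      have Hq : pos (nth 0 par i) < size T by rewrite pos_lt ?Hp.
      have Hr : s <= nth 0 par i < m by rewrite Hp Hpi.
      have [_] := legit_at Hq (nth_pos Hr).
      have Hn : (nth 0 par i < s) = false by rewrite ltnNge Hp.
      rewrite /legit Hn /vert Hn => /and3P [_ _ /allP /(_ i)].
      by rewrite behead_iota eqxx /=; apply; rewrite Hs; case/andP: Hi => ->.
    have Hq : pos i < size T by rewrite pos_lt ?Hs //; lia.
    have Hr : s <= i < m by rewrite Hs; case/andP: Hi.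
    have [_] := legit_at Hq (nth_pos Hr).
    have Hn : (i < s) = false by rewrite ltnNge Hs.
    rewrite /legit {2}/vert Hn => /and3P [_ Hl _].
    move: Hl; case: ltnP => Hp; first by rewrite /vert Hp.
    have Hpn : (nth 0 par i < s) = false by rewrite ltnNge Hp.
    move=> /eqP Hc; rewrite /vert Hpn; apply: sortT => //.
    (* The parent was placed before [pos i], so it precedes in the sorted list [T]. *)
    have : Some (nth 0 par i) \in take (pos i) a by rewrite -has_pred1 has_count -/(cntof _ _) Hc.
    exact: index_ltn.
  + case=> k [i [Hk Eu [Ei Hi] Hc ->]] /=.
    rewrite slotS //= mem_cat mem_nth //; split => //.
      by have [_] := legit_at Hk Ei; rewrite Eu /legit Hi => /andP [].
    by have := mem_nth 0 Hc; rewrite mem_pures => /andP [].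
  + case=> k [Hk Eu Ea Esl]; have := I1 k Hk; rewrite /slot_ok Ea -Esl.
    case=> k' [H1 H2 H3 _]; have Hk' := ltn_trans H1 Hk.
    rewrite H2 slotT // mem_cat mem_nth ?orbT //; split => //.
    by rewrite Eu; apply: sortT.
- move=> u u' Hu Hu' Nu Nu' E1 E2.
  have {E1 E2} E : slot u = slot u' by rewrite [slot u]surjective_pairing E1 E2 -surjective_pairing.
  have NR x y : isN x -> isR y -> slot x = slot y -> False.
    case=> i [Hi _ ->] [k [j [_ _ [_ Hj] Hc ->]]] [E1 E2].
    have Epar := vert_S (par_lt tmpl_valid Hi) Hj E1.
    have := mem_nth 0 Hc; rewrite -E2 mem_pures => /andP [/negP Hn _]; apply: Hn.
    by apply/hasP; exists i; rewrite ?behead_iota // Epar !eqxx.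
  have NF x y : isN x -> isF y -> slot x = slot y -> False.
    case=> i [Hi _ ->] [k [Hk _ Ea Esl]] E0.
    have := I1 k Hk; rewrite /slot_ok Ea -Esl -E0 /= => -[k' [H1 H2 _ H4]].
    have [Hs Ek'] := vert_T (par_lt tmpl_valid Hi) (ltn_trans H1 Hk) H2.
    have := H4 _ Ek' Hs; rewrite mem_pures => /andP [/negP Hn _]; apply: Hn.
    by apply/hasP; exists i; rewrite ?behead_iota // !eqxx.
  have RF x y : isR x -> isF y -> slot x = slot y -> False.
    case=> k [i [_ _ [_ Hi] _ ->]] [k' [Hk _ Ea Esl]] E0.
    have := I1 k' Hk; rewrite /slot_ok Ea -Esl -E0 /= => -[k'' [H1 H2 _ _]].
    have H3 := ltn_trans H1 Hk.
    by have := notST (mem_nth 0 H3); rewrite -H2 mem_nth.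
  case: (classify u Hu Nu) => Cu; case: (classify u' Hu' Nu') => Cu'.
  + case: Cu E => i [Hi -> ->]; case: Cu' => j [Hj -> ->] [E1 E2].
    by rewrite (node_inj tmpl_valid Hi Hj (vert_inj (par_lt tmpl_valid Hi) (par_lt tmpl_valid Hj) E1) E2).
  + by case: (NR u u').
  + by case: (NF u u').
  + by case: (NR u' u).
  + case: Cu E => k [i [Hk -> [Ei Hi] Hc ->]]; case: Cu' => k' [j [Hk' -> [Ej Hj] Hc' ->]] [E1 E2].
    have Eij : i = j by apply/eqP; rewrite -(nth_uniq 0 Hi Hj uS) E1.
    subst j; move/eqP: E2; rewrite nth_uniq ?pures_uniq // => /eqP E2.
    have lt_cnt k1 k2 : k1 < k2 -> k2 < size T -> nth None a k1 = Some i ->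
        cntof (take k1 a) i < cntof (take k2 a) i.
      move=> H12 H2 E; have H1 : k1 < size a by rewrite size_a; apply: ltn_trans H12 H2.
      have H3 : cntof (take k1.+1 a) i <= cntof (take k2 a) i.
        by rewrite -(subnKC H12) takeD /cntof count_cat leq_addr.
      by apply: leq_trans H3; rewrite (take_nth None H1) E cntof_rcons eqxx addn1.
    by case: (ltngtP k k') => [H|H|-> //]; [have := lt_cnt _ _ H Hk' Ei | have := lt_cnt _ _ H Hk Ej];
       rewrite E2 ltnn.
  + by case: (RF u u').
  + by case: (NF u' u).
  + by case: (RF u' u).
  + case: Cu E => k [Hk -> Ea ->]; case: Cu' => k' [Hk' -> Ea' ->] E.
    have uF : uniq (fillers a sl) by move: I3; rewrite cat_uniq => /and3P [].
    have Es' : size a = size sl by rewrite size_a Es.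
    have Fsplit b l b' l' : size b = size l -> size b' = size l' ->
        fillers (b ++ b') (l ++ l') = fillers b l ++ fillers b' l'.
      by move=> H1 H2; rewrite /fillers zip_cat // filter_cat map_cat.
    have Ftake j : j < size T -> nth None a j = None ->
        fillers a sl = fillers (take j a) (take j sl) ++
                       nth (0, 0) sl j :: fillers (drop j.+1 a) (drop j.+1 sl).
      move=> Hj Ej; rewrite -{1}(cat_take_drop j a) -{1}(cat_take_drop j sl).
      rewrite Fsplit ?size_take ?size_drop ?Es' //; congr (_ ++ _).
      rewrite (drop_nth None) ?size_a // (drop_nth (0, 0)) ?Es //.
      by rewrite /fillers /= Ej eqxx.
    have Fmem j l : j < l -> l < size T -> nth None a j = None -> nth None a l = None ->
        nth (0, 0) sl j = nth (0, 0) sl l -> False.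
      move=> Hjl Hl Ej El Ejl.
      have Hj := ltn_trans Hjl Hl.
      have : nth (0, 0) sl j \in fillers (take l a) (take l sl).
        have -> : fillers (take l a) (take l sl) =
           fillers (take j (take l a)) (take j (take l sl)) ++
           nth (0, 0) sl j :: fillers (drop j.+1 (take l a)) (drop j.+1 (take l sl)).
          rewrite -{1}(cat_take_drop j (take l a)) -{1}(cat_take_drop j (take l sl)).
          rewrite Fsplit ?size_take ?size_drop ?size_take ?Es' //; congr (_ ++ _).
          have sa : j < size (take l a) by rewrite size_takel // size_a ltnW.
          have ss : j < size (take l sl) by rewrite size_takel // Es ltnW.
          rewrite (drop_nth None sa) (drop_nth (0, 0) ss) !nth_take //.
          by rewrite /fillers /= Ej eqxx.
        by rewrite mem_cat mem_head orbT.
      rewrite Ejl => Hin; move: uF; rewrite (Ftake l Hl El) cat_uniq => /and3P [_ /hasPn H _].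
      by have := H _ (mem_head _ _); rewrite /= Hin.
    case: (ltngtP k k') => [H|H|-> //].
      by case: (Fmem _ _ H Hk' Ea Ea' E).
    by case: (Fmem _ _ H Hk Ea' Ea (esym E)).
Qed.
End Placement.

(** * Completeness *)

Lemma leq_sum_subset (I : eqType) (f : I -> nat) (l1 l2 : seq I) :
  uniq l1 -> {subset l1 <= l2} -> \sum_(x <- l1) f x <= \sum_(x <- l2) f x.
Proof.
elim: l1 l2 => [|x l1 IH] l2 /=; first by rewrite big_nil.
case/andP=> Nx U H; have xl2 : x \in l2 by apply: H; rewrite mem_head.
rewrite big_cons (big_rem x xl2) /= leq_add2l; apply: IH => // y Hy.
have : y \in l2 by apply: H; rewrite in_cons Hy orbT.
rewrite (perm_mem (perm_to_rem xl2)) in_cons => /orP [/eqP E|] //.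
by rewrite -E Hy in Nx.
Qed.

(** The reason why filling the largest slots first loses nothing: on a decreasing list, a prefix
    dominates every selection of the same size. *)
Lemma leq_sum_top (l r : seq nat) : sorted gtn l -> uniq r -> {subset r <= l} ->
  \sum_(j <- r) 2 ^ j <= \sum_(j <- take (size r) l) 2 ^ j.
Proof.
elim: l r => [|x l IH] r Hs U H.
  by case: r U H => [|y r] _ H; rewrite ?big_nil //; have := H y (mem_head _ _).
have Hl : sorted gtn l by apply: path_sorted Hs.
have Hx : all (gtn x) l.
  by apply: order_path_min Hs => a b c; rewrite /gtn /=; lia.
have [xr|Nxr] := boolP (x \in r).
  have Er := size_rem xr; have Hr : 0 < size r by case: (r) xr.
  rewrite (big_rem x xr) /=; have -> : size r = (size (rem x r)).+1 by rewrite Er prednK.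
  rewrite /= big_cons leq_add2l; apply: IH => //; first exact: rem_uniq.
  move=> y; rewrite mem_rem_uniq // inE => /andP [Ny /H].
  by rewrite in_cons (negbTE Ny).
have Hsub : {subset r <= l}.
  move=> y Hy; have := H y Hy; rewrite in_cons => /orP [/eqP E|] //.
  by rewrite -E Hy in Nxr.
case: r U H Nxr Hsub => [|y r] /=; first by rewrite !big_nil.
case/andP=> _ U H Nxr Hsub; rewrite !big_cons; apply: leq_add.
  rewrite leq_pexp2l //; have /allP /(_ y) := Hx; rewrite Hsub ?mem_head // => /(_ isT).
  by rewrite /gtn /=; lia.
by apply: IH => // z Hz; apply: Hsub; rewrite in_cons Hz orbT.
Qed.

Section Complete.
Variables (D : rel nat) (S T N : seq nat) (p L : nat) (Par : nat -> nat) (Rk : nat -> nat).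
Hypothesis S_gt0 : 0 < size S.
Hypothesis uST : uniq (S ++ T).
Hypothesis uN : uniq N.
Hypothesis NT : {subset N <= T}.
Hypothesis idxT : forall x y, x \in T -> y \in T -> D x y -> index x T < index y T.
Hypothesis arb : bin_arb D (S ++ T) (nth 0 S 0) p Par Rk.

Notation v := (nth 0 S 0).
Notation s := (size S).
Notation nodes := (S ++ N).
Notation m := (size (S ++ N)).

Hypothesis closedN : forall u, u \in nodes -> u != v -> Par u \in nodes.
Hypothesis mL : m <= L.

Definition tpar : seq nat := mkseq (fun i => index (Par (nth 0 nodes i)) nodes) L.
(** The default 0 beyond [m] keeps all entries below the radix, so that the padded vector lies in
    the universe. *)
Definition trk : seq nat := mkseq (fun i => if i < m then Rk (nth 0 nodes i) else 0) L.
Definition pow2s : seq nat := [seq 2 ^ i | i <- iota 0 p.+1].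

Let uS : uniq S. Proof. by move: uST; rewrite cat_uniq => /and3P []. Qed.
Let uT : uniq T. Proof. by move: uST; rewrite cat_uniq => /and3P []. Qed.
Let notST x : x \in T -> x \notin S.
Proof. by move=> xT; move: uST; rewrite cat_uniq => /and3P [_ /hasPn H _]; apply: H. Qed.
Let uNodes : uniq nodes.
Proof.
rewrite cat_uniq uS uN andbT /=; apply/hasPn => x /NT; exact: notST.
Qed.
Let vS : v \in S. Proof. by rewrite mem_nth. Qed.
Let vnodes : nth 0 nodes 0 = v. Proof. by rewrite nth_cat S_gt0. Qed.
Let nodesST : {subset nodes <= S ++ T}.
Proof. by move=> x; rewrite !mem_cat => /orP [->//|/NT ->]; rewrite orbT. Qed.
Let T_neq_v x : x \in T -> x != v.
Proof. by move/notST; apply: contraNneq => ->. Qed.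
Let m_gt0 : 0 < m. Proof. by rewrite size_cat addn_gt0 S_gt0. Qed.

Lemma nth_tpar i : i < m -> nth 0 tpar i = index (Par (nth 0 nodes i)) nodes.
Proof. by move=> Hi; rewrite nth_mkseq // (leq_trans Hi). Qed.

Lemma nth_trk i : i < m -> nth 0 trk i = Rk (nth 0 nodes i).
Proof. by move=> Hi; rewrite nth_mkseq ?Hi // (leq_trans Hi). Qed.

Lemma node_neq_v i : 0 < i < m -> nth 0 nodes i != v.
Proof. by case/andP=> H0 Hi; rewrite -vnodes nth_uniq // -lt0n. Qed.

Lemma par_node i : 0 < i < m -> Par (nth 0 nodes i) \in nodes.
Proof. by move=> Hi; apply: closedN (node_neq_v Hi); rewrite mem_nth //; case/andP: Hi. Qed.

Lemma nth_par i : 0 < i < m -> nth 0 nodes (nth 0 tpar i) = Par (nth 0 nodes i).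
Proof. by move=> Hi; have /andP [_ Hm] := Hi; rewrite nth_tpar // nth_index // par_node. Qed.

Lemma tpar_lt i : 0 < i < m -> nth 0 tpar i < m.
Proof. by move=> Hi; have /andP [_ Hm] := Hi; rewrite nth_tpar // index_mem par_node. Qed.

Lemma nodes_S i : i < s -> nth 0 nodes i = nth 0 S i.
Proof. by move=> Hi; rewrite nth_cat Hi. Qed.

Lemma Rk_le u : u \in S ++ T -> Rk u <= p.
Proof.
move=> Hu; case: (eqVneq u v) => [->|Nu]; first by case: arb => _ ->.
by apply: ltnW; apply: arb_rk_lt arb Hu Nu.
Qed.

Lemma arbP u : u \in S ++ T -> u != v -> [/\ Par u \in S ++ T, D (Par u) u & Rk u < Rk (Par u)].
Proof. by case: arb => _ _ H _; apply: H. Qed.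

Lemma arb_inj u u' : u \in S ++ T -> u' \in S ++ T -> u != v -> u' != v ->
  Par u = Par u' -> Rk u = Rk u' -> u = u'.
Proof. by case: arb => _ _ _; apply. Qed.

Lemma template_valid : valid D S pow2s m tpar trk.
Proof.
apply/andP; split.
  by rewrite nth_trk // vnodes size_map size_iota; case: arb => _ ->.
apply/allP => i; rewrite behead_iota => Hi; have /andP [H0 Hm] := Hi.
have Hin : nth 0 nodes i \in S ++ T by apply: nodesST; rewrite mem_nth.
have [Q1 Q2 Q3] := arbP Hin (node_neq_v Hi).
rewrite /valid_node tpar_lt //= !nth_trk ?tpar_lt // nth_par // Q3 /=.
apply/andP; split.
  apply/allP => j; rewrite behead_iota => Hj; have /andP [_ Hjm] := Hj.
  case: (eqVneq i j) => //= Nij; apply/negP => /andP [/eqP E1 /eqP E2].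
  case/eqP: Nij; apply/eqP; rewrite -(nth_uniq 0 Hm Hjm uNodes); apply/eqP.
  apply: arb_inj; rewrite ?node_neq_v // ?nodesST ?mem_nth //.
    by rewrite -(nth_par Hi) -(nth_par Hj) E1.
  by rewrite E2 nth_trk.
case: ltnP => //= Hs; case: ltnP => //= Hp.
by rewrite -!nodes_S // nth_par.
Qed.

Lemma mem_tpures i j : i < m -> j < Rk (nth 0 nodes i) ->
  (forall u, u \in nodes -> u != v -> Par u = nth 0 nodes i -> Rk u <> j) ->
  j \in pures m tpar trk i.
Proof.
move=> Hi Hj H; rewrite mem_pures nth_trk // Hj andbT; apply/hasPn => z.
rewrite behead_iota => Hz; have /andP [_ Hzm] := Hz.
apply/negP => /andP [/eqP E1 /eqP E2].
apply: (H (nth 0 nodes z)); rewrite ?mem_nth ?node_neq_v //.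
  by rewrite -(nth_par Hz) E1.
by rewrite -nth_trk.
Qed.

(** The run read off from the arborescence. Of a child of [S] outside the template only the parent
    is kept; the placement gives it the largest rank still free. *)
Definition asgn (t : nat) : option nat :=
  if t \in N then Some (index t nodes)
  else if Par t \in S then Some (index (Par t) S) else None.

Lemma index_N t : t \in N -> s <= index t nodes < m.
Proof.
move=> tN; rewrite index_mem mem_cat tN orbT andbT index_cat.
by rewrite (negbTE (notST (NT tN))) leq_addr.
Qed.

Lemma asgn_lt t i : asgn t = Some i -> i < m.
Proof.
rewrite /asgn; case: ifP => [tN [<-]|_]; first by case/andP: (index_N tN).
by case: ifP => // H [<-]; rewrite size_cat ltn_addr // index_mem.
Qed.

Lemma asgn_root t i : asgn t = Some i -> i < s -> t \notin N /\ Par t = nth 0 S i.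
Proof.
rewrite /asgn; case: ifP => [tN [<-]|_]; first by have /andP [H _] := index_N tN; rewrite ltnNge H.
by case: ifP => // H [<-] _; rewrite nth_index.
Qed.

Lemma asgn_node t i : asgn t = Some i -> s <= i -> t \in N /\ t = nth 0 nodes i.
Proof.
rewrite /asgn; case: ifP => [tN [<-] _|_].
  by rewrite nth_index // mem_cat tN orbT.
by case: ifP => // H [<-]; rewrite leqNgt index_mem H.
Qed.

Lemma asgn_filler t : asgn t = None -> t \notin N /\ Par t \notin S.
Proof. by rewrite /asgn; case: ifP => // _; case: ifP. Qed.

Lemma cntof_map P i : cntof (map asgn P) i = count (fun t => asgn t == Some i) P.
Proof. by rewrite /cntof count_map. Qed.

Lemma root_rank t i : t \in T -> asgn t = Some i -> i < s -> Rk t \in pures m tpar trk i.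
Proof.
move=> tT Ea Hi; have [tN Ep] := asgn_root Ea Hi.
have tST : t \in S ++ T by rewrite mem_cat tT orbT.
have [_ _ Hr] := arbP tST (T_neq_v tT).
apply: mem_tpures; first exact: asgn_lt Ea.
  by rewrite nodes_S // -Ep.
rewrite nodes_S // => u Hu Nu Eu Er.
have Etu : u = t.
  by apply: arb_inj => //; [exact: nodesST | exact: T_neq_v | rewrite Eu Ep].
by move: Hu; rewrite Etu mem_cat (negbTE tN) (negbTE (notST tT)).
Qed.

Lemma root_ranks P i : uniq P -> {subset P <= T} -> i < s ->
  let R := [seq Rk t | t <- P & asgn t == Some i] in
  uniq R /\ {subset R <= pures m tpar trk i}.
Proof.
move=> UP HP Hi /=; split.
  rewrite map_inj_in_uniq ?filter_uniq // => t t'.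
  rewrite !mem_filter => /andP [/eqP E tP] /andP [/eqP E' tP'] Er.
  have [_ Ep] := asgn_root E Hi; have [_ Ep'] := asgn_root E' Hi.
  by apply: arb_inj => //; rewrite ?mem_cat ?HP ?orbT ?T_neq_v ?Ep ?HP.
by move=> r /mapP [t]; rewrite mem_filter => /andP [/eqP E tP] ->; apply: root_rank; rewrite ?HP.
Qed.

Lemma legit_asgn k : k < size T ->
  legit_opt D S m tpar trk (map asgn (take k T)) (nth 0 T k) (asgn (nth 0 T k)).
Proof.
move=> Hk; set t := nth 0 T k.
have tT : t \in T by rewrite mem_nth.
have tST : t \in S ++ T by rewrite mem_cat tT orbT.
have [Q1 Q2 Q3] := arbP tST (T_neq_v tT).
have tP : t \notin take k T.
  by apply/negP => /index_ltn; rewrite index_uniq // ltnn.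
case Ea : (asgn t) => [i|] //=; rewrite (asgn_lt Ea) /= /legit cntof_map.
case: ltnP => Hi.
  have [tN Ep] := asgn_root Ea Hi; rewrite -Ep Q2 /=.
  (* The prefix of length [k.+1] contains [t] itself, which makes the bound on the counter before
     [t] strict. *)
  have UP : uniq (take k.+1 T) by rewrite take_uniq.
  have HP : {subset take k.+1 T <= T} by move=> x; apply: mem_take.
  have [U1 U2] := root_ranks UP HP Hi.
  have := uniq_leq_size U1 U2; rewrite size_map size_filter (take_nth 0 Hk) -/t.
  by rewrite -cats1 count_cat /= Ea eqxx addn0 addn1.
have [tN Et] := asgn_node Ea Hi.
have Hm : 0 < i < m by rewrite (leq_trans S_gt0 Hi) (asgn_lt Ea).
apply/and3P; split.
- rewrite -leqn0 leqNgt -has_count; apply/negP => /hasP [t' t'P /eqP Ea'].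
  have [_ Et'] := asgn_node Ea' Hi.
  by rewrite Et -Et' t'P in tP.
- case: ltnP => Hp; first by rewrite -nodes_S // nth_par // -Et.
  have Pn := par_node Hm; rewrite -Et in Pn.
  have Ei : nth 0 tpar i = index (Par t) nodes by rewrite nth_tpar ?(asgn_lt Ea) // -Et.
  have PN : Par t \in N.
    move: Pn; rewrite mem_cat => /orP [PS|//].
    by move: Hp; rewrite Ei index_cat PS leqNgt index_mem PS.
  have Ap : asgn (Par t) = Some (nth 0 tpar i) by rewrite /asgn PN Ei.
  have Hidx : index (Par t) T < k.
    by have := idxT (NT PN) tT Q2; rewrite index_uniq.
  rewrite cntof_map (eq_in_count (a2 := pred1 (Par t))).
    rewrite count_uniq_mem ?take_uniq // in_take ?Hidx //; exact: NT.
  move=> x xP /=; apply/eqP/eqP => [Ex|->]; last exact: Ap.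
  have [_ ->] := asgn_node Ex Hp; have [_ E] := asgn_node Ap Hp.
  by rewrite -E.
- apply/allP => z; rewrite behead_iota => Hz; have /andP [Hz0 Hzs] := Hz.
  have Hzm : 0 < z < m by rewrite Hz0 size_cat ltn_addr.
  rewrite -implybE; apply/implyP => /eqP Ez.
  have := nth_par Hzm; rewrite Ez -Et => Et2.
  have zST : nth 0 nodes z \in S ++ T by apply: nodesST; rewrite mem_nth //; case/andP: Hzm.
  have [_ R2 _] := arbP zST (node_neq_v Hzm).
  by move: R2; rewrite -Et2 nodes_S.
Qed.

Definition free (o : nat) : seq nat :=
  if o \in N then pures m tpar trk (index o nodes) else iota 0 (Rk o).

(** The capacity that [t] creates, computed with its rank in the arborescence instead of the largest
    free one. *)
Definition gain (t : nat) : nat :=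
  match asgn t with
  | None => 0
  | Some i => if i < s then 2 ^ Rk t else (\sum_(j <- pures m tpar trk i) 2 ^ j).+1
  end.

(** The parent of a filler is outside [S] and stronger, hence in the same prefix; distinct fillers
    use distinct slots there. *)
Lemma filler_sum k P : P = take k T ->
  \sum_(t <- P | asgn t == None) 2 ^ Rk t <= \sum_(o <- P) \sum_(j <- free o) 2 ^ j.
Proof.
move=> EP; have PT x : x \in P -> x \in T by rewrite EP; apply: mem_take.
have UP : uniq P by rewrite EP take_uniq.
have PST x : x \in P -> x \in S ++ T by move/PT=> H; rewrite mem_cat H orbT.
pose slots := flatten [seq [seq (o, j) | j <- free o] | o <- P].
have -> : \sum_(o <- P) \sum_(j <- free o) 2 ^ j = \sum_(x <- slots) 2 ^ x.2.
  by rewrite big_flatten big_map; apply: eq_bigr => o _; rewrite big_map.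
have -> : \sum_(t <- P | asgn t == None) 2 ^ Rk t =
          \sum_(x <- [seq (Par t, Rk t) | t <- P & asgn t == None]) 2 ^ x.2.
  by rewrite big_map big_filter.
apply: leq_sum_subset.
  rewrite map_inj_in_uniq ?filter_uniq // => t t'.
  rewrite !mem_filter => /andP [_ tP] /andP [_ tP'] [E1 E2].
  by apply: arb_inj; rewrite // ?PST ?T_neq_v ?PT.
move=> x /mapP [t]; rewrite mem_filter => /andP [/eqP Ea tP] ->.
have [tN PS] := asgn_filler Ea.
have [Q1 Q2 Q3] := arbP (PST _ tP) (T_neq_v (PT _ tP)).
have PtT : Par t \in T by move: Q1; rewrite mem_cat (negbTE PS).
have PtP : Par t \in P.
  rewrite EP in_take //; apply: ltn_trans (idxT PtT (PT _ tP) Q2) _.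
  by apply: index_ltn; rewrite -EP.
apply/flattenP; exists [seq (Par t, j) | j <- free (Par t)].
  by apply/mapP; exists (Par t).
apply/mapP; exists (Rk t) => //; rewrite /free; case: ifP => PN; last by rewrite mem_iota.
have Hn : nth 0 nodes (index (Par t) nodes) = Par t by rewrite nth_index // mem_cat PN orbT.
apply: mem_tpures; first by case/andP: (index_N PN).
  by rewrite Hn.
rewrite Hn => u Hu Nu Eu Er.
have Etu : u = t.
  by apply: arb_inj => //; [exact: nodesST | exact: PST | apply: T_neq_v; apply: PT].
by move: Hu; rewrite Etu mem_cat (negbTE tN) (negbTE (notST (PT _ tP))).
Qed.

(* Each player [t] satisfies [2 ^ Rk t = 1 + \sum_(j < Rk t) 2 ^ j]; summing over a prefix of [T],
   the fillers are paid for by the slots opened in that prefix. *)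
Lemma size_le_gain k P : P = take k T -> size P <= \sum_(t <- P) gain t.
Proof.
move=> EP; have HF := filler_sum EP.
pose low t := \sum_(j <- iota 0 (Rk t)) 2 ^ j.
have E1 : size P + \sum_(t <- P) low t = \sum_(t <- P) 2 ^ Rk t.
  rewrite -sum1_size -big_split; apply: eq_bigr => t _.
  exact: sum_pow2.
rewrite [RHS](bigID (fun t => asgn t == None)) /= in E1.
have E2 : \sum_(t <- P | asgn t != None) 2 ^ Rk t + \sum_(o <- P) \sum_(j <- free o) 2 ^ j =
          \sum_(t <- P) gain t + \sum_(t <- P) low t.
  rewrite big_mkcond -!big_split; apply: eq_bigr => t _ /=.
  rewrite /gain /free; case Ea : (asgn t) => [i|] /=.
    case: ltnP => Hi.
      by have [tN _] := asgn_root Ea Hi; rewrite (negbTE tN).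
    have [tN Et] := asgn_node Ea Hi; rewrite tN.
    move: Ea; rewrite {1}/asgn tN => -[->].
    by rewrite -(sum_pow2 (Rk t)) -/(low t) !addSn addnC.
  by have [tN _] := asgn_filler Ea; rewrite (negbTE tN).
rewrite -(leq_add2r (\sum_(t <- P) low t)) E1 -E2 addnC leq_add2l; exact: HF.
Qed.

Lemma nth_pow2s j : j <= p -> nth 0 pow2s j = 2 ^ j.
Proof. by move=> Hj; rewrite (nth_map 0) ?size_iota // nth_iota. Qed.

Lemma sum_pow2s i (l : seq nat) : i < m -> {subset l <= pures m tpar trk i} ->
  sumn [seq nth 0 pow2s j | j <- l] = \sum_(j <- l) 2 ^ j.
Proof.
move=> Hi H; rewrite sumnE big_map; apply: eq_big_seq => j /H.
rewrite mem_pures nth_trk // => /andP [_ Hj]; rewrite nth_pow2s //.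
by apply: ltnW; apply: leq_trans Hj _; apply: Rk_le; apply: nodesST; rewrite mem_nth.
Qed.

Lemma pures_sorted i : sorted gtn (pures m tpar trk i).
Proof.
apply: sorted_filter; first by move=> a b c; rewrite /gtn /=; lia.
by rewrite rev_sorted; apply: iota_ltn_sorted.
Qed.

(** Below a player of [S] the weight counts the largest free ranks, the arborescence uses arbitrary
    ones, and [leq_sum_top] compares them. The other nodes contribute equally to both sides. *)
Lemma gain_le_weight k P : P = take k T ->
  \sum_(t <- P) gain t <= weight S pow2s m tpar trk (cntof (map asgn P)).
Proof.
move=> EP; have PT : {subset P <= T} by rewrite EP => x; apply: mem_take.
have UP : uniq P by rewrite EP take_uniq.
have -> : \sum_(t <- P) gain t = \sum_(i <- iota 0 m) \sum_(t <- P | asgn t == Some i) gain t.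
  rewrite (exchange_big_dep predT) //=; apply: eq_bigr => t _.
  case Ea : (asgn t) => [i|]; last by rewrite big_pred0 // /gain Ea.
  have Hi := asgn_lt Ea.
  rewrite (eq_bigl (pred1 i)); last by move=> j; rewrite /= (inj_eq Some_inj) eq_sym.
  by rewrite -big_filter filter_pred1_uniq ?iota_uniq ?mem_iota // big_seq1.
rewrite /weight sumnE big_map big_seq [X in _ <= X]big_seq; apply: leq_sum => i.
rewrite mem_iota add0n => /andP [_ Hi]; rewrite /node_weight cntof_map.
case: ltnP => Hs.
  have [U1 U2] := root_ranks UP PT Hs.
  have -> : \sum_(t <- P | asgn t == Some i) gain t =
            \sum_(j <- [seq Rk t | t <- P & asgn t == Some i]) 2 ^ j.
    rewrite big_map big_filter; apply: eq_bigr => t /eqP Ea.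
    by rewrite /gain Ea Hs.
  rewrite (sum_pow2s Hi); last by move=> j; apply: mem_take.
  have := leq_sum_top (pures_sorted i) U1 U2.
  by rewrite size_map size_filter.
case: eqP => [H0|/eqP H0].
  rewrite big_hasC //; apply/negP; rewrite has_count H0 //.
rewrite (sum_pow2s Hi) //.
have Hc : count (fun t => asgn t == Some i) P <= 1.
  apply: leq_trans (_ : count (pred1 (nth 0 nodes i)) P <= _); last first.
    by rewrite count_uniq_mem //; case: (_ \in _).
  by apply: sub_count => t /eqP Ea /=; have [_ <-] := asgn_node Ea Hs.
have Hg t : asgn t == Some i -> gain t = (\sum_(j <- pures m tpar trk i) 2 ^ j).+1.
  by move=> /eqP Ea; rewrite /gain Ea ltnNge Hs.
rewrite (eq_bigr _ Hg) big_const_seq iter_addn_0.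
by move: Hc; case: (count _ P) => [|[|]] //; rewrite ?muln0 ?muln1.
Qed.

Lemma run_of_arb : okrun D S pow2s m tpar trk T (map asgn T).
Proof.
split; first by rewrite size_map.
move=> k Hk; rewrite -!map_take (nth_map 0) //; split; first exact: legit_asgn.
apply: leq_trans (gain_le_weight (erefl (take k.+1 T))).
apply: leq_trans (size_le_gain (erefl (take k.+1 T))).
by rewrite size_takel.
Qed.

Lemma run_final i : s <= i < m -> cntof (map asgn T) i = 1.
Proof.
case/andP=> Hs Hi; rewrite cntof_map.
have iN : nth 0 nodes i \in N.
  by rewrite nth_cat ltnNge Hs /= mem_nth // -(ltn_add2l s) subnKC // -size_cat.
rewrite (eq_count (a2 := pred1 (nth 0 nodes i))).
  by rewrite count_uniq_mem // NT.
move=> t /=; apply/eqP/eqP => [/asgn_node [] //|->].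
by rewrite /asgn iN index_uniq.
Qed.

Lemma template_bounds q i : p < q -> m < q -> nth 0 tpar i < q /\ nth 0 trk i < q.
Proof.
move=> Hp Hm; case: (ltnP i L) => Hi; last first.
  by rewrite !nth_default ?size_mkseq //; split; apply: leq_ltn_trans Hp.
rewrite !nth_mkseq //; split.
  by apply: leq_ltn_trans Hm; apply: index_size.
case: ifP => Him; last by apply: leq_ltn_trans Hp.
by apply: leq_ltn_trans Hp; apply: Rk_le; apply: nodesST; rewrite mem_nth.
Qed.
End Complete.

(** * Correctness on an instance *)

(** Beyond [p] the default value 0 keeps the inequality true, so that soundness does not have to
    bound the ranks of a guessed template. *)
Lemma pow2s_le p j : nth 0 (pow2s p) j <= 2 ^ j.
Proof.
case: (leqP j p) => Hj; first by rewrite nth_pow2s.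
by rewrite nth_default // size_map size_iota.
Qed.

Lemma finalP S m x : size S <= m ->
  reflect (forall i, size S <= i < m -> nth 0 x i = 1) (final S m x).
Proof.
move=> Hm; have E : drop (size S) (iota 0 m) = iota (size S) (m - size S) by rewrite drop_iota.
rewrite /final E; apply: (iffP allP) => H i.
  by move=> Hi; apply/eqP; apply: H; rewrite mem_iota subnKC.
by rewrite mem_iota subnKC // => Hi; apply/eqP; apply: H.
Qed.

Section Decide.
Variables (D : rel nat) (S T : seq nat) (p : nat).
Hypothesis S_gt0 : 0 < size S.
Hypothesis uST : uniq (S ++ T).
Hypothesis sortT : forall i j, i < j -> j < size T -> D (nth 0 T i) (nth 0 T j).

Notation U := (univ (5 * size S) (radix S (pow2s p))).

Lemma decide_sound : decide D S T (pow2s p) U ->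
  exists Par Rk, bin_arb D (S ++ T) (nth 0 S 0) p Par Rk.
Proof.
case/hasP=> m _ /andP [Hm] /hasP [par _] /hasP [rk _] /andP [Hv] /hasP [x Hx].
move/(finalP _ Hm) => Hf.
have [a [Ha Ea]] := dp_sound S_gt0 Hm Hv Hx.
have [Par [Rk arb]] := arb_of_run S_gt0 Hm Hv (@pow2s_le p) uST sortT Ha
  (fun i Hi => etrans (esym (Ea i (proj2 (andP Hi)))) (Hf i Hi)).
by exists Par, Rk; move: arb; rewrite size_map size_iota.
Qed.

Lemma decide_complete N Par Rk : uniq N -> {subset N <= T} ->
  (forall x y, x \in T -> y \in T -> D x y -> index x T < index y T) ->
  bin_arb D (S ++ T) (nth 0 S 0) p Par Rk ->
  (forall u, u \in S ++ N -> u != nth 0 S 0 -> Par u \in S ++ N) ->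
  size (S ++ N) <= 5 * size S ->
  decide D S T (pow2s p) U.
Proof.
move=> uN NT idxT arb cl HL.
have Hsm : size S <= size (S ++ N) by rewrite size_cat leq_addr.
pose par := tpar S N (5 * size S) Par; pose rk := trk S N (5 * size S) Rk.
have Hq1 : p < radix S (pow2s p) by rewrite /radix size_map size_iota; lia.
have Hq2 : size (S ++ N) < radix S (pow2s p) by rewrite /radix; lia.
have HB i := template_bounds (5 * size S) NT arb i Hq1 Hq2.
have parU : par \in U.
  rewrite univP size_mkseq eqxx; apply/(all_nthP 0) => i _; by have [] := HB i.
have rkU : rk \in U.
  rewrite univP size_mkseq eqxx; apply/(all_nthP 0) => i _; by have [] := HB i.
have Hv := template_valid S_gt0 uST uN NT arb cl HL.
have Hrun := run_of_arb S_gt0 uST uN NT idxT arb cl HL.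
apply/hasP; exists (size (S ++ N)); first by rewrite mem_iota.
rewrite Hsm /=; apply/hasP; exists par => //; apply/hasP; exists rk => //.
apply/andP; split; first exact: Hv.
apply/hasP; exists (mkseq (cntof (map (asgn S N Par) T)) (5 * size S)).
  apply: dp_complete => //; first by rewrite /radix; lia.
  by move=> i; have [] := HB i.
apply/(finalP _ Hsm) => i Hi; rewrite nth_mkseq; last first.
  by case/andP: Hi => _ Hi; apply: leq_trans Hi HL.
exact: (run_final Par uST uN NT).
Qed.
End Decide.

Lemma memnE x s : memn x s = (x \in s).
Proof. by rewrite /memn has_pred1. Qed.

(** * Sorting the players outside the core *)

Section Ranked.
Variables (D : rel nat) (R : seq nat).
Hypothesis uR : uniq R.
Hypothesis irrD : forall x, x \in R -> ~~ D x x.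
Hypothesis totD : forall x y, x \in R -> y \in R -> x != y -> D x y || D y x.
Hypothesis transD : forall x y z, x \in R -> y \in R -> z \in R -> D x y -> D y z -> D x z.

Definition key (u : nat) : nat := count (fun x => D x u) R.

(** By transitivity whoever beats [x] also beats [y], and [x] itself comes in addition. *)
Lemma key_lt x y : x \in R -> y \in R -> D x y -> key x < key y.
Proof.
move=> xR yR xy; rewrite /key -!size_filter.
have Hs : {subset x :: [seq z <- R | D z x] <= [seq z <- R | D z y]}.
  move=> z; rewrite in_cons => /orP [/eqP ->|]; first by rewrite mem_filter xy.
  by rewrite !mem_filter => /andP [zx zR]; rewrite zR (transD zR xR yR zx xy).
have Hu : uniq (x :: [seq z <- R | D z x]).
  by rewrite /= filter_uniq // mem_filter negb_and (irrD xR).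
exact: uniq_leq_size Hu Hs.
Qed.

Lemma key_size x : x \in R -> key x < size R.
Proof.
move=> xR; rewrite /key -(count_predC (fun z => D z x) R) -addn1 leq_add2l.
by rewrite -has_count; apply/hasP; exists x => //=; apply: irrD.
Qed.

Lemma mem_ranked : ranked D R =i R.
Proof.
move=> x; apply/flattenP/idP => [[s /mapP [i _ ->]]|xR].
  by rewrite mem_filter => /andP [].
exists [seq u <- R | key u == key x]; last by rewrite mem_filter eqxx.
by apply/mapP; exists (key x); rewrite // mem_iota key_size.
Qed.

Lemma pairwise_key k l :
  pairwise (fun x y => (key x <= key y) && (x != y))
    (flatten [seq [seq u <- R | key u == i] | i <- iota k l]).
Proof.
elim: l k => // l IH k; rewrite /= pairwise_cat IH andbT; apply/andP; split.
  apply/allrelP => x y; rewrite mem_filter => /andP [/eqP Hx _].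
  case/flattenP=> s /mapP [i]; rewrite mem_iota => Hi ->; rewrite mem_filter => /andP [/eqP Hy _].
  by apply/andP; split; [lia | apply/eqP => E; move: Hx Hy; rewrite E; lia].
have: uniq [seq u <- R | key u == k] by rewrite filter_uniq.
have: forall x, x \in [seq u <- R | key u == k] -> key x = k.
  by move=> x; rewrite mem_filter => /andP [/eqP].
elim: [seq _ <- _ | _] => //= x s IHs H /andP [Nx Us]; apply/andP; split.
  apply/allP => y ys; rewrite !H ?mem_head ?in_cons ?ys ?orbT // leqnn /=.
  by apply: contraNneq Nx => ->.
by apply: IHs => // y ys; apply: H; rewrite in_cons ys orbT.
Qed.

Lemma ranked_sorted i j : i < j -> j < size (ranked D R) ->
  D (nth 0 (ranked D R) i) (nth 0 (ranked D R) j).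
Proof.
move=> Hij Hj; have Hi := ltn_trans Hij Hj.
have /(pairwiseP 0) H := pairwise_key 0 (size R).
have /andP [Hk Ne] := H i j Hi Hj Hij.
have xR : nth 0 (ranked D R) i \in R by rewrite -mem_ranked mem_nth.
have yR : nth 0 (ranked D R) j \in R by rewrite -mem_ranked mem_nth.
have := totD xR yR Ne; case/orP => // /(key_lt yR xR).
by rewrite ltnNge Hk.
Qed.

Lemma ranked_uniq : uniq (ranked D R).
Proof.
rewrite uniq_pairwise; apply: sub_pairwise (pairwise_key 0 (size R)).
by move=> x y /andP [].
Qed.

Lemma ranked_index x y : x \in ranked D R -> y \in ranked D R -> D x y ->
  index x (ranked D R) < index y (ranked D R).
Proof.
move=> xT yT xy.
have xR : x \in R by rewrite -mem_ranked.
have yR : y \in R by rewrite -mem_ranked.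
have Hx := key_lt xR yR xy.
case: ltngtP => // H; last first.
  by move: Hx; rewrite -(nth_index 0 xT) H nth_index // ltnn.
have := @ranked_sorted _ _ H; rewrite index_mem xT => /(_ isT).
by rewrite !nth_index // => /(key_lt yR xR); rewrite ltnNge ltnW.
Qed.
End Ranked.

Lemma nth_allpairs (A B C : Type) (f : A -> B -> C) x0 a0 b0 (s : seq A) (t : seq B) i j :
  i < size s -> j < size t ->
  nth x0 [seq f x y | x <- s, y <- t] (i * size t + j) = f (nth a0 s i) (nth b0 t j).
Proof.
elim: s i => [|x s IH] [|i] //= Hi Hj; rewrite nth_cat size_map.
  by rewrite mul0n Hj (nth_map b0).
by rewrite mulSn -addnA ltnNge leq_addr /= addKn IH.
Qed.

(** The head doubles at each round until it is 2^p; there are 2^p rounds, more than the p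
    required. *)
Lemma powersE p : powers (2 ^ p) = pow2s p.
Proof.
have H k : foldl (fun L (_ : nat) => powers_step (2 ^ p) L) [:: 1] (iota 0 k) = rev (pow2s (minn k p)).
  elim: k => [|k IH]; first by rewrite min0n.
  rewrite -[in iota 0 _]addn1 iotaD foldl_cat IH /= /powers_step.
  have -> : head 0 (rev (pow2s (minn k p))) = 2 ^ minn k p.
    rewrite /pow2s -[in iota 0 _](addn1 (minn k p)) iotaD map_cat rev_cat //=.
  rewrite addnn -mul2n -expnS leq_exp2l //; case: ifP => Hk.
    have -> : minn k.+1 p = (minn k p).+1 by lia.
    by rewrite [in RHS]/pow2s -[in iota 0 _.+2](addn1 (minn k p).+1) iotaD map_cat rev_cat.
  by have -> : minn k.+1 p = minn k p by lia.
rewrite /powers H revK; congr pow2s.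
by apply/minn_idPr; apply: ltnW; apply: ltn_expl.
Qed.

(** * The greedy core *)

Section CoreSet.
Variables (D : rel nat) (n v : nat).

Definition flat (ps : seq (nat * nat)) : seq nat := flatten [seq [:: e.1; e.2] | e <- ps].

Definition triangle (e : nat * nat) : bool := [&& D v e.1, D e.1 e.2 & D e.2 v].

(** A triangle is refused only if it already has an end in the set, which never shrinks; hence a
    single pass yields a maximal family. *)
Lemma core_fold (E : seq (nat * nat)) : ~~ D v v -> (forall e, e \in E -> ~~ D e.1 e.1) ->
  let S := foldl (core_step D v) [:: v] E in
  [/\ uniq S,
      (exists ps, [/\ S = v :: flat ps, {subset ps <= E} & all triangle ps]) &
      (forall e, e \in E -> triangle e -> (e.1 \in S) || (e.2 \in S))].
Proof.
move=> Dvv; elim/last_ind: E => [|E e IH] irr /=.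
  by split => //; exists [::].
have [|U [ps [ES sub tri]] max] := IH.
  by move=> e' He'; apply: irr; rewrite mem_rcons in_cons He' orbT.
rewrite foldl_rcons; set S := foldl _ _ _ in U ES max *.
have De : ~~ D e.1 e.1 by apply: irr; rewrite mem_rcons mem_head.
rewrite /core_step !memnE; case: ifP => He; last first.
  split => //.
    exists ps; split => // x /sub Hx; by rewrite mem_rcons in_cons Hx orbT.
  move=> e'; rewrite mem_rcons in_cons => /orP [/eqP ->|He'] Ht; last exact: max.
  move: He; case/and3P: Ht => -> -> -> /=.
  by case: (e.1 \in S); case: (e.2 \in S).
case/and5P: He => H1 H2 H3 H4 H5; split.
- rewrite cat_uniq U /= !inE orbF negb_or H4 H5 /= !andbT.
  by apply: contraNneq De => {2}->.
- exists (rcons ps e); split.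
  + by rewrite ES /flat map_rcons flatten_rcons.
  + move=> x; rewrite !mem_rcons !in_cons => /orP [->//|/sub ->]; by rewrite orbT.
  + by rewrite all_rcons tri andbT /triangle H1 H2 H3.
- move=> e'; rewrite mem_rcons in_cons !mem_cat => /orP [/eqP ->|He'] Ht.
    by rewrite mem_head orbT.
  by have /orP [->|->] := max _ He' Ht; rewrite ?orbT.
Qed.

Lemma core_setP : (forall x, ~~ D x x) -> v < n ->
  let S := core_set D n v in
  [/\ uniq S, nth 0 S 0 = v, (forall x, x \in S -> x < n),
      (exists ps, S = v :: flat ps /\ all triangle ps) &
      (forall b a, b < n -> a < n -> triangle (b, a) -> (b \in S) || (a \in S))].
Proof.
move=> irr vn /=; rewrite /core_set; set E := flatten _.
have memE e : (e \in E) = (e.1 < n) && (e.2 < n).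
  apply/flattenP/idP => [[s /mapP [b Hb ->] /mapP [a Ha ->]]|/andP [H1 H2]].
    by move: Hb Ha; rewrite !mem_iota => /= -> ->.
  exists [seq (e.1, a) | a <- iota 0 n]; first by apply/mapP; exists e.1; rewrite // mem_iota.
  by apply/mapP; exists e.2; rewrite ?mem_iota //; case: (e).
have [U [ps [ES sub tri]] max] := @core_fold E (irr v) (fun e _ => irr e.1).
split => //.
- by rewrite ES.
- move=> x; rewrite ES in_cons => /orP [/eqP -> //|/flattenP [s /mapP [e /sub]]].
  rewrite memE => /andP [H1 H2] ->; rewrite !inE => /orP [] /eqP -> //.
- by exists ps.
- by move=> b a Hb Ha; apply: (max (b, a)); rewrite memE Hb Ha.
Qed.
End CoreSet.

(** * Correctness of the algorithm on instance words *)

Section Instance.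
Variables (p : nat) (D : rel 'I_(2 ^ p)) (v : 'I_(2 ^ p)).
Hypothesis tourD : is_tournament D.
Hypothesis nacD : neighbor_acyclic D v.

Notation n := (2 ^ p).

Definition inst : seq bool :=
  [seq D i j | i <- enum 'I_n, j <- enum 'I_n] ++ [seq i == v | i <- enum 'I_n].

Notation Dn := (adj inst n).

Lemma encode_inst : encode_instance D v = map bit inst.
Proof. by rewrite /encode_instance /inst map_cat map_allpairs -map_comp. Qed.

Lemma size_inst : size inst = n * n + n.
Proof. by rewrite size_cat size_allpairs size_map size_enum_ord. Qed.

Lemma adjE (i j : 'I_n) : Dn i j = D i j.
Proof.
have Hs : size [seq D i j | i <- enum 'I_n, j <- enum 'I_n] = n * n.
  by rewrite size_allpairs size_enum_ord.
have Hi := ltn_ord i; have Hj := ltn_ord j.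
rewrite /adj /inst nth_cat Hs ifT; last by nia.
have := @nth_allpairs _ _ _ D false v v (enum 'I_n) (enum 'I_n) i j.
rewrite size_enum_ord => -> //.
by rewrite !nth_ord_enum.
Qed.

Lemma order_inst : order_of inst = n.
Proof.
rewrite /order_of size_inst (eq_in_filter (a2 := pred1 n)).
  by rewrite filter_pred1_uniq ?iota_uniq // mem_iota; lia.
move=> x _ /=; apply/eqP/eqP => [H|-> //]; nia.
Qed.

Lemma favorite_inst : favorite inst n = v.
Proof.
rewrite /favorite (eq_in_filter (a2 := pred1 (val v))).
  by rewrite filter_pred1_uniq ?iota_uniq // mem_iota /=.
move=> x; rewrite mem_iota => /andP [_ Hx].
rewrite /inst nth_cat size_allpairs size_enum_ord ltnNge leq_addr /= addKn.
rewrite (nth_map v) ?size_enum_ord //.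
by rewrite -(inj_eq val_inj) /= nth_enum_ord.
Qed.

Lemma adj_irr x : ~~ Dn x x.
Proof.
case: (ltnP x n) => Hx.
  by have := adjE (Ordinal Hx) (Ordinal Hx) => /= ->; case: tourD => H _; apply: H.
by rewrite /adj nth_default // size_inst; nia.
Qed.

Lemma adj_tot x y : x < n -> y < n -> x != y -> Dn x y (+) Dn y x.
Proof.
move=> Hx Hy Nxy; have := adjE (Ordinal Hx) (Ordinal Hy); have := adjE (Ordinal Hy) (Ordinal Hx).
by move=> /= -> ->; case: tourD => _; apply; rewrite -(inj_eq val_inj).
Qed.

Notation S := (core_set Dn n v).
Notation R := (rest n S).
Notation T := (ranked Dn R).

Let coreP := core_setP adj_irr (ltn_ord v).
Let uS : uniq S. Proof. by case: coreP. Qed.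
Let S0 : nth 0 S 0 = v. Proof. by case: coreP. Qed.
Let S_lt x : x \in S -> x < n. Proof. by case: coreP => _ _ H _ _; apply: H. Qed.
Let vS : (v : nat) \in S.
Proof. by case: coreP => _ _ _ [ps [-> _]] _; rewrite mem_head. Qed.
Let S_gt0 : 0 < size S. Proof. by move: vS; case: (S). Qed.
Let core_max b a : b < n -> a < n -> Dn v b -> Dn b a -> Dn a v -> (b \in S) || (a \in S).
Proof. by move=> Hb Ha H1 H2 H3; case: coreP => _ _ _ _; apply; rewrite // /triangle H1 H2. Qed.
Let uR : uniq R. Proof. by rewrite filter_uniq // iota_uniq. Qed.
Let memR x : (x \in R) = (x \notin S) && (x < n).
Proof. by rewrite mem_filter memnE mem_iota. Qed.

(** By maximality no arc outside [S] leads from an out-neighbor of [v] to an in-neighbor. Hence the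
    players of a cycle x, y, z would all lie on the same side of [v], against
    neighbor-acyclicity. *)
Lemma rest_trans x y z : x \in R -> y \in R -> z \in R -> Dn x y -> Dn y z -> Dn x z.
Proof.
rewrite !memR => /andP [xS xn] /andP [yS yn] /andP [zS zn] xy yz.
have Nxz : x != z.
  apply/eqP => E; subst z; have Nxy : x != y by apply: contraTneq xy => <-; apply: adj_irr.
  by have := adj_tot xn yn Nxy; rewrite xy yz.
case: (boolP (Dn x z)) => // /negbTE xz.
have zx : Dn z x by have := adj_tot xn zn Nxz; rewrite xz.
have vx u : u < n -> u \notin S -> (Dn u v = ~~ Dn v u).
  move=> un uS'; have Nu : u != v by apply: contraNneq uS' => ->.
  by have := adj_tot un (ltn_ord v) Nu; case: (Dn u v); case: (Dn v u).
have max b a : b < n -> a < n -> b \notin S -> a \notin S -> Dn b a -> Dn v b -> Dn v a.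
  move=> bn an bS aS ba vb; apply: contraT => va.
  have av : Dn a v by rewrite vx.
  by have := core_max bn an vb ba av; rewrite (negbTE bS) (negbTE aS).
pose X := Ordinal xn; pose Y := Ordinal yn; pose Z := Ordinal zn.
have cyc : cycle D [:: X; Y; Z] by rewrite /= -!adjE /= xy yz zx.
have XYZ : [:: X; Y; Z] != [::] by [].
case: nacD => HI HO.
case: (boolP (Dn v x)) => Hx.
  have Hy := max _ _ xn yn xS yS xy Hx; have Hz := max _ _ yn zn yS zS yz Hy.
  have := HO _ XYZ; rewrite cyc; apply.
  by rewrite /= /out_nbh -!adjE /= Hx Hy Hz.
have Hz : ~~ Dn v z by apply: contra Hx => Hz; apply: max zx Hz.
have Hy : ~~ Dn v y by apply: contra Hz => Hy; apply: max yz Hy.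
have := HI _ XYZ; rewrite cyc; apply.
by rewrite /= /in_nbh -!adjE /= !vx // Hx Hy Hz.
Qed.

Let R_tot x y : x \in R -> y \in R -> x != y -> Dn x y || Dn y x.
Proof.
rewrite !memR => /andP [_ xn] /andP [_ yn] /(adj_tot xn yn).
by case: (Dn x y); case: (Dn y x).
Qed.

Let memT : T =i R. Proof. by apply: mem_ranked => x _; apply: adj_irr. Qed.
Let uST : uniq (S ++ T).
Proof.
rewrite cat_uniq uS ranked_uniq // andbT; apply/hasPn => x.
by rewrite memT memR => /andP [].
Qed.
Let memST x : (x \in S ++ T) = (x < n).
Proof.
rewrite mem_cat memT memR; case: (boolP (x \in S)) => [/S_lt ->|] //.
Qed.

Let o (x : nat) : 'I_n := insubd v x.
Let oK x : x < n -> (o x : nat) = x. Proof. by move=> Hx; rewrite /o insubdK. Qed.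
Let valK (x : 'I_n) : o x = x. Proof. by apply: val_inj; rewrite /= oK. Qed.
Let oE x y : x < n -> y < n -> Dn x y = D (o x) (o y).
Proof. by move=> Hx Hy; rewrite -adjE !oK. Qed.

Lemma alg_inst : alg inst = decide Dn S T (pow2s p) (univ (5 * size S) (radix S (pow2s p))).
Proof. by rewrite /alg /solve /core_of order_inst favorite_inst powersE. Qed.

Lemma alg_correct : alg inst <-> TFP_yes D v.
Proof.
rewrite alg_inst (TFP_yesP _ tourD); split.
  have sortT i j : i < j -> j < size T -> Dn (nth 0 T i) (nth 0 T j).
    apply: ranked_sorted => //; [by move=> x _; apply: adj_irr | exact: rest_trans].
  move/(decide_sound S_gt0 uST sortT); rewrite S0 => -[Par [Rk [H1 H2 H3 H4]]].
  exists (fun u : 'I_n => o (Par u)), (fun u : 'I_n => Rk u); split => //.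
  - by rewrite mem_enum.
  - move=> u _ Nu; rewrite mem_enum; have [|Q1 Q2 Q3] := H3 u _ Nu; first by rewrite memST.
    move: Q1; rewrite memST => Q1; split => //; last by rewrite oK.
    by rewrite -adjE oK.
  - move=> u u' _ _ Nu Nu' E1 E2; apply: val_inj.
    apply: H4; [by rewrite memST ltn_ord | by rewrite memST ltn_ord | exact: Nu | exact: Nu' | | exact: E2].
    have [|Q1 _ _] := H3 u _ Nu; first by rewrite memST.
    have [|Q1' _ _] := H3 u' _ Nu'; first by rewrite memST.
    rewrite !memST in Q1 Q1'.
    by rewrite -(oK Q1) -(oK Q1') E1.
case=> par [rk [_ Hp H1 H2]].
pose SS : {set 'I_n} := [set x : 'I_n | (x : nat) \in S].
have arb0 : arbor D v p par rk.
  split => //; last by move=> x y; apply: H2; rewrite mem_enum.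
  by move=> u Nu; have [|_ ? ?] := H1 u _ Nu; rewrite ?mem_enum.
have vSS : v \in SS by rewrite inE.
have trSS a b c : a \notin SS -> b \notin SS -> c \notin SS -> D a b -> D b c -> D a c.
  rewrite !inE => aS bS cS; rewrite -!adjE; apply: rest_trans; by rewrite memR ?aS ?bS ?cS /=.
have [par' [rk' [M [[A1 A2 A3] SM Mc HM]]]] := arbor_skeleton tourD vSS trSS arb0.
(* The template nodes outside the core; together with [S] they form the set [M], closed under
   parents. *)
pose N : seq nat := map val (enum (M :\: SS)).
have memN x : (x \in N) = (x < n) && (o x \in M) && (x \notin S).
  apply/mapP/idP => [[y]|/andP [/andP [Hx xM] xS]].
    by rewrite mem_enum !inE => /andP [yS yM] ->; rewrite valK yM yS ltn_ord.
  by exists (o x); [rewrite mem_enum !inE xM oK // xS | rewrite /= oK].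
have uN : uniq N by rewrite map_inj_uniq ?enum_uniq //; apply: val_inj.
have NT : {subset N <= T}.
  by move=> x; rewrite memN memT memR => /andP [/andP [-> _] ->].
have memSN x : x < n -> (x \in S ++ N) = (o x \in M).
  move=> Hx; rewrite mem_cat memN Hx /=; case: (boolP (x \in S)) => //= xS.
    by rewrite (subsetP SM) // inE oK.
  by rewrite andbT.
apply: (@decide_complete _ _ _ _ S_gt0 uST N (fun x => par' (o x) : nat) (fun x => rk' (o x)) uN NT).
- apply: ranked_index => //; [by move=> x _; apply: adj_irr | exact: rest_trans].
- have Nv x : x < n -> x != v -> o x != v.
    by move=> Hx; apply: contraNneq => <-; rewrite oK.
  rewrite S0; split.
  + by rewrite memST.
  + by rewrite valK.
  + move=> u; rewrite memST => Hu Nu; have [Q1 Q2] := A2 (o u) (Nv _ Hu Nu).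
    by rewrite memST ltn_ord valK oE // valK.
  + move=> u u'; rewrite !memST => Hu Hu' Nu Nu' E1 E2.
    rewrite -(oK Hu) -(oK Hu'); congr (val _); apply: A3; rewrite ?Nv //.
    exact: val_inj.
- move=> u Hu; rewrite S0 => Nu.
  have un : u < n by move: Hu; rewrite mem_cat memN => /orP [/S_lt//|/andP [/andP []]].
  rewrite memSN // valK; apply: Mc; first by rewrite -memSN.
  by apply: contraNneq Nu => <-; rewrite oK.
- have HS : #|SS| = size S.
    rewrite cardE -(size_map val); apply: perm_size; apply: uniq_perm => //.
      by rewrite map_inj_uniq ?enum_uniq //; apply: val_inj.
    move=> x; apply/mapP/idP => [[y]|xS]; first by rewrite mem_enum inE => yS ->.
    by exists (o x); [rewrite mem_enum inE oK // S_lt | rewrite /= oK // S_lt].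
  rewrite size_cat size_map -cardE -HS.
  have := cardsID SS M; rewrite (setIidPr SM) => ->.
  by move: HM; rewrite mulnC mulnC.
Qed.

(* Each pair [(b, a)] of the core gives a cycle [v, b, a], and these cycles are arc-disjoint. *)
Lemma core_size F : sfasv_feasible D v F -> size S <= 2 * #|F| + 1.
Proof.
case=> _ HF; case: coreP => U _ Slt [ps [ES tri]] _.
pose FN := [seq (val e.1, val e.2) | e <- enum F].
(* An arc of the triangle that lies in [F]; for the last case this is the content of [hitF]. *)
pose hit (e : nat * nat) := if (val v, e.1) \in FN then (val v, e.1)
   else if (e.1, e.2) \in FN then (e.1, e.2) else (e.2, val v).
have inFN (x y : 'I_n) : (x, y) \in F -> (val x, val y) \in FN.
  by move=> H; apply/mapP; exists (x, y); rewrite ?mem_enum.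
have lt_ps e : e \in ps -> (e.1 < n) /\ (e.2 < n).
  move=> He; have H x : x \in [:: e.1; e.2] -> x < n.
    move=> Hx; apply: Slt; rewrite ES in_cons; apply/orP; right.
    by apply/flattenP; exists [:: e.1; e.2] => //; apply/mapP; exists e.
  by split; apply: H; rewrite !inE eqxx ?orbT.
have hitF e : e \in ps -> hit e \in FN.
  move=> He; rewrite /hit; case: ifPn => // N1; case: ifPn => // N2; apply: contraT => N3.
  have [bn an] := lt_ps e He; pose b := Ordinal bn; pose a := Ordinal an.
  have /and3P [T1 T2 T3] := allP tri e He.
  (* A triangle without arcs in [F] would survive the reversal as a cycle through [v]. *)
  have := HF [:: v; b; a]; rewrite mem_head => /(_ isT); case/negP.
  have R x y : Dn (val x) (val y) -> (val x, val y) \notin FN -> reverse_arcs D F x y.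
    by rewrite adjE /reverse_arcs => -> N; rewrite (contra (@inFN x y)).
  by rewrite /= !R.
(* Two triangles share only the vertex [v], so a common arc would repeat a vertex of the
   duplicate-free core. *)
have hitU : uniq (map hit ps).
  have Uv : val v \notin flat ps by move: U; rewrite ES /= => /andP [].
  have Uf : uniq (flat ps) by move: U; rewrite ES /= => /andP [].
  elim: ps Uv Uf {ES tri lt_ps hitF} => //= e ps IH.
  rewrite /flat /= !in_cons !negb_or => /and3P [Nv1 Nv2 Nv].
  case/and3P=> /andP [N12 N1] N2 Uf; rewrite IH // andbT.
  apply/mapP => -[e' He' E].
  have H x : x \in [:: e'.1; e'.2] -> x \in flat ps.
    by move=> Hx; apply/flattenP; exists [:: e'.1; e'.2] => //; apply/mapP; exists e'.
  have H1 : e'.1 \in flat ps by apply: H; rewrite !inE eqxx.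
  have H2 : e'.2 \in flat ps by apply: H; rewrite !inE eqxx orbT.
  have hitE x : [\/ hit x = (val v, x.1), hit x = (x.1, x.2) | hit x = (x.2, val v)].
    rewrite /hit; case: ifP => _; first by apply: Or31.
    by case: ifP => _; [apply: Or32 | apply: Or33].
  move: E; case: (hitE e) => ->; case: (hitE e') => -> E;
    have /= E1 := congr1 fst E; have /= E2 := congr1 snd E.
  - by rewrite E2 H1 in N1.
  - by rewrite E1 H1 in Nv.
  - by rewrite E1 H2 in Nv.
  - by rewrite E1 eqxx in Nv1.
  - by rewrite E1 H1 in N1.
  - by rewrite E1 H2 in N1.
  - by rewrite E1 eqxx in Nv2.
  - by rewrite E1 H1 in N2.
  - by rewrite E1 H2 in N2.
have : size (map hit ps) <= size FN.
  by apply: uniq_leq_size hitU _ => x /mapP [e /hitF H ->].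
rewrite !size_map -cardE ES /= /flat size_flatten /shape -map_comp.
have -> : sumn [seq (size \o (fun e : nat * nat => [:: e.1; e.2])) i | i <- ps] = 2 * size ps.
  by elim: (ps) => //= e s ->; lia.
by move=> Hsz; rewrite addn1 ltnS leq_mul2l Hsz.
Qed.
End Instance.

(** * The time bound *)

(** Bound x^k by the falling factorial of x + k, which is k! times a binomial coefficient at most
    2^(x + k). With x containing log n, this separates n from k: a power of log n becomes a function
    of k times n. *)
Lemma exp_le_fact x k : x ^ k <= k ^ k * 2 ^ (x + k).
Proof.
have H1 : x ^ k <= (x + k) ^_ k.
  elim: k => // k IH; rewrite expnS addnS ffactSS.
  by apply: leq_mul => //; rewrite -addnS leq_addr.
apply: leq_trans H1 _; rewrite -bin_ffact mulnC; apply: leq_mul.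
  elim: k => // k IH; rewrite factS expnS leq_mul2l /=.
  by apply: leq_trans IH _; apply: leq_exp_base.
rewrite -[2]/(1 + 1) Pascal (bigD1 (inord k)) //= inordK ?ltnS ?leq_addl //.
by rewrite !exp1n !muln1 leq_addr.
Qed.

Lemma self_power_bound : exists C E, forall k,
  (10 * k + 5) ^ (10 * k + 5) <= C * 2 ^ (E * k * (trunc_log 2 k).+1).
Proof.
(* [5 ^ 5] is the value at k = 0. For K > 0 and l = [trunc_log 2 K], the base is at most 2^(l + 5),
   with l + 5 <= 5 (l + 1) and 10 K + 5 <= 15 K, whence 75. *)
exists (5 ^ 5), 75; case=> [|k]; first by rewrite !muln0 add0n mul0n expn0 muln1.
move: (trunc_log_ltn k.+1 (ltnSn 1)) (ltn0Sn k); move: k.+1 (trunc_log 2 k.+1) => K l HK K0.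
apply: leq_trans (leq_pmull _ _); last by rewrite expn_gt0.
apply: (@leq_trans ((2 ^ (l + 5)) ^ (10 * K + 5))).
  apply: leq_exp_base.
  have -> : 2 ^ (l + 5) = 16 * 2 ^ l.+1 by rewrite -[16]/(2 ^ 4) -expnD; congr (2 ^ _); lia.
  by apply: (@leq_trans (16 * K)); [lia | rewrite leq_mul2l (ltnW HK) orbT].
rewrite -expnM; apply: leq_pexp2l => //; nia.
Qed.

Lemma budget_bound : exists C E, forall k p,
  (10 * k + 7 + p) ^ (10 * k + 5) <= C * 2 ^ (E * k * (trunc_log 2 k).+1) * 2 ^ p.
Proof.
(* The exponent of 2 is (10 k + 7 + p) + (10 k + 5) = 12 + 20 k + p; its part 2^p is the number of
   players. *)
have [C [E H]] := self_power_bound; exists (C * 2 ^ 12), (E + 20) => k p.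
apply: leq_trans (exp_le_fact _ _) _.
have -> : 2 ^ (10 * k + 7 + p + (10 * k + 5)) = 2 ^ 12 * 2 ^ (20 * k) * 2 ^ p.
  by rewrite -!expnD; congr (2 ^ _); lia.
rewrite mulnA leq_mul2r; apply/orP; right.
apply: leq_trans (leq_mul (H k) (leqnn _)) _.
rewrite mulnACA leq_mul2l; apply/orP; right.
by rewrite -expnD; apply: leq_pexp2l => //; nia.
Qed.

Lemma final_bound d : exists c d', forall k p beta w,
  beta <= (10 * k + 7 + p) ^ (10 * k + 5) -> w = 2 ^ p * 2 ^ p + 2 ^ p ->
  (beta + w + 2) ^ d <= c * 2 ^ (c * k * (trunc_log 2 k).+1) * (2 ^ p) ^ d'.
Proof.
have [C [E H]] := budget_bound.
(* One constant must serve both as factor and in the exponent, hence the sum; n^3 absorbs the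
   budget, linear in n, and the input length n * n + n. *)
exists ((C + 4) ^ d + E * d), (3 * d) => k p beta w Hb Hw.
set X := 2 ^ (E * k * (trunc_log 2 k).+1); set n := 2 ^ p.
have n0 : 0 < n by rewrite expn_gt0.
have X0 : 0 < X by rewrite expn_gt0.
have {}Hb : beta <= C * X * n by apply: leq_trans Hb (H k p).
have Hs : beta + w + 2 <= (C + 4) * X * n ^ 3.
  have -> : n ^ 3 = n * (n * n) by rewrite !expnS expn0 muln1.
  have A1 : C * X * n <= C * X * (n * (n * n)) by rewrite leq_mul2l leq_pmulr ?orbT // muln_gt0 n0.
  have A2 : n * n <= X * (n * (n * n)).
    exact: leq_trans (leq_pmull (n * n) n0) (leq_pmull _ X0).
  have A3 : n <= X * (n * (n * n)).
    exact: leq_trans (leq_pmull n n0) A2.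
  have A4 : 2 <= 2 * (X * (n * (n * n))) by rewrite leq_pmulr // !muln_gt0 X0 n0.
  rewrite -mulnA mulnDl mulnA; move: A1 A2 A3 A4; rewrite Hw -/n.
  by move: (X * _) (C * X * (n * _)) => Y Z; lia.
apply: leq_trans (leq_exp_base d Hs) _.
rewrite (expnMn ((C + 4) * X) (n ^ 3)) (expnMn (C + 4) X) -(expnM n 3 d).
apply: leq_mul => //.
apply: leq_mul; first exact: leq_addr.
by rewrite /X -expnM; apply: leq_pexp2l => //; nia.
Qed.

(* There is a fixed Turing machine M and constants c, d such that on every
   neighbor-acyclic TFP instance (D, v) with n = 2^p players and sfas-v
   number k, M decides the instance within
   c * 2^(c * k * (log2 k + 1)) * n^d  steps, i.e. 2^O(k log k) * n^O(1). *)
Theorem theorem4 :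
  exists (M : TM) (c d : nat),
    forall (p : nat) (D : rel 'I_(2 ^ p)) (v : 'I_(2 ^ p)) (k : nat),
      is_tournament D ->
      neighbor_acyclic D v ->
      is_sfasv_number D v k ->
      forall b : bool, (b <-> TFP_yes D v) ->
        decides_within M (encode_instance D v) b
          (c * 2 ^ (c * k * (trunc_log 2 k).+1) * (2 ^ p) ^ d).
Proof.
have [M [d HM]] := PT_decidable PT_alg.
have [c [d' Hc]] := final_bound d.
exists M, c, d' => p D v k tourD nacD [[F [HF <-]] _] b Hb.
have -> : b = alg (inst D v).
  by apply/idP/idP => H; [apply/(alg_correct tourD nacD); apply/Hb
                         |apply/Hb; apply/(alg_correct tourD nacD)].
rewrite encode_inst; apply: HM; apply: Hc; last exact: size_inst.
rewrite /budget /core_of order_inst favorite_inst powersE.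
have := core_size tourD HF; set s := size _ => Hs.
(* By [core_size] the core has at most 2 k + 1 players: the radix is at most 5 (2 k + 1) + (p + 1) +
   1 and its exponent at most 5 (2 k + 1). *)
have Er : radix (core_set (adj (inst D v) (2 ^ p)) (2 ^ p) v) (pow2s p) <= 10 * #|F| + 7 + p.
  by rewrite /radix size_map size_iota -/s; move: Hs; move: #|F| => k' Hs; lia.
apply: leq_trans (leq_exp_base _ Er) _; apply: leq_pexp2l; first by lia.
by rewrite -/s; move: Hs; move: #|F| => k' Hs; lia.
Qed.
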